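(* Let $m\in\mathbb{N}$ and let $A=\{A(k)\}_{k\in\mathbb{Z}}$, $B=\{B(k)\}_{k\in\mathbb{Z}}$ be sequences of self-adjoint complex $m\times m$ matrices with $A(k)>0$ (positive definite) for all $k\in\mathbb{Z}$, such that $\|A(k)\|+\|B(k)\|\le C$ for all $k\in\mathbb{Z}$ and some $C>0$. Let $H=H(A,B)=AS^++A^-S^-+B$ be the associated self-adjoint Jacobi operator on $\ell^2(\mathbb{Z})^m$. Suppose that $A$ and $B$ are reflectionless and that $\sigma(H(A,B))=[E_-,E_+]$ for some real $E_-<E_+$. Then $A$ and $B$ are of the form $$A(k)=\frac14(E_+-E_-)I_m,\qquad B(k)=\frac12(E_-+E_+)I_m,\qquad k\in\mathbb{Z}.$$
   Context: Notation: $I_m$ is the $m\times m$ identity matrix. $S^\pm$ are the shifts $(S^\pm f)(k)=f^\pm(k)=f(k\pm1)$ on sequences (of vectors or matrices) indexed by $\mathbb{Z}$. Thus $(Hf)(k)=A(k)f(k+1)+A(k-1)f(k-1)+B(k)f(k)$ for $f\in\ell^2(\mathbb{Z})^m=\ell^2(\mathbb{Z};\mathbb{C}^m)$; $H$ is bounded and self-adjoint. $\sigma(H)$ and $\sigma_{\mathrm{ess}}(H)$ are its spectrum and essential spectrum. Green's matrix: for $z\in\mathbb{C}\setminus\sigma(H)$, $G(z,k,\ell)=(H-z)^{-1}(k,\ell)\in\mathbb{C}^{m\times m}$ is the $(k,\ell)$ block of the resolvent, and $g(z,k)=G(z,k,k)$. For $z\in\mathbb{C}_+$ (open upper half-plane),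 $\operatorname{Im}(g(z,k))>0$, where $\operatorname{Im}(M)=(M-M^* )/(2i)$. Logarithm and $\Xi$: for an invertible matrix $M$ with $\operatorname{Im}(M)\ge0$, $\ln(M)$ is defined by the holomorphic functional calculus with the branch of $\ln$ on $\mathbb{C}\setminus\{-it:t\ge0\}$ satisfying $\ln 1=0$. Then $$\Xi(\lambda,k)=\lim_{\varepsilon\downarrow0}\frac1\pi\operatorname{Im}\big(\ln(g(\lambda+i\varepsilon,k))\big)\ \text{ for a.e. }\lambda\in\mathbb{R},$$ which exists for a.e. $\lambda$ and satisfies $0\le\Xi(\lambda,k)\le I_m$ a.e. Reflectionless: $A,B$ (equivalently $H(A,B)$) are called reflectionless if for all $k\in\mathbb{Z}$, $\Xi(\lambda,k)=\frac12I_m$ for a.e. $\lambda\in\sigma_{\mathrm{ess}}(H)$. *)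

(* Defs.v *)
From HB Require Import structures.
From mathcomp Require Import all_boot all_order all_algebra.
From mathcomp Require Import all_classical all_reals all_analysis.
From mathcomp Require Import complex.

Set Implicit Arguments.
Unset Strict Implicit.
Unset Printing Implicit Defensive.

Import Order.TTheory GRing.Theory Num.Theory.
Import numFieldNormedType.Exports.

Local Open Scope classical_set_scope.
Local Open Scope ring_scope.
Local Open Scope complex_scope.

(* The usual topology of the complex plane (absent from the library for the
   concrete type [R[i]]): it makes limits in [R[i]] and ['M[R[i]]_m] available. *)
#[non_forgetful_inheritance]
HB.instance Definition _ (R : rcfType) :=
  PseudoPointedMetric.copy R[i] (R[i] : numClosedFieldType)^o.

Section Matrices.
Variables (R : realType) (m : nat).
Implicit Types (M : 'M[R[i]]_m) (v : 'cV[R[i]]_m).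

Definition adjmx p q (M : 'M[R[i]]_(p, q)) : 'M[R[i]]_(q, p) :=
  map_mx (@conjc R) M^T.

Definition selfadjmx M : Prop := adjmx M = M.

(* The order of [R[i]] is partial: [0 < z] says that [z] is real and positive. *)
Definition posdefmx M : Prop :=
  selfadjmx M /\ forall v, v != 0 -> 0 < (adjmx v *m M *m v) 0 0.

Definition Immx M : 'M[R[i]]_m := (2 * 'i)^-1 *: (M - adjmx M).

Definition vnorm v : R :=
  Num.sqrt (\sum_i (complex.Re (v i 0) ^+ 2 + complex.Im (v i 0) ^+ 2)).

Definition opnorm M : R := sup [set vnorm (M *m v) | v in [set v | vnorm v <= 1]].

End Matrices.

Section FunctionalCalculus.
Variable R : realType.

Definition expi (t : R) : R[i] := cos t +i* sin t.

Definition cnorm (z : R[i]) : R := complex.Re `|z|.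

(* The polar angle in ]-pi/2, 3pi/2[, unique off the cut {-it : t >= 0}. *)
Definition carg (z : R[i]) : R :=
  xget 0 [set t : R | - (pi / 2) < t < 3 * pi / 2 /\ z = (cnorm z)%:C * expi t].

Definition cln (z : R[i]) : R[i] := ln (cnorm z) +i* carg z.

Definition cintegral (a b : R) (f : R -> R[i]) : R[i] :=
  (\int[lebesgue_measure]_(t in `[a, b]) complex.Re (f t))
  +i* (\int[lebesgue_measure]_(t in `[a, b]) complex.Im (f t)).

Definition circle_integral (w : R[i]) (r : R) (f : R[i] -> R[i]) : R[i] :=
  cintegral 0 (2 * pi)
    (fun t => f (w + r%:C * expi t) * ('i * r%:C * expi t)).

Variable m : nat.

(* (2 pi i)^-1 times the integral of f(z) (z - M)^-1 over the cycle formed by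
   the positively oriented circles of radius [r] around the eigenvalues. *)
Definition dunford (f : R[i] -> R[i]) (M : 'M[R[i]]_m) (r : R) : 'M[R[i]]_m :=
  (2 * pi%:C * 'i)^-1 *:
  \sum_(w \in [set w : R[i] | eigenvalue M w])
     \matrix_(i < m, j < m)
        circle_integral w r (fun z => f z * invmx (z%:M - M) i j).

(* If f is holomorphic near the spectrum of M, then by Cauchy's theorem
   [dunford f M r] does not depend on the small radius [r]. *)
Definition holo_calc (f : R[i] -> R[i]) (M : 'M[R[i]]_m) : 'M[R[i]]_m :=
  xget 0 [set L : 'M[R[i]]_m | \forall r \near (0 : R)^'+, L = dunford f M r].

Definition lnmx (M : 'M[R[i]]_m) : 'M[R[i]]_m := holo_calc cln M.

End FunctionalCalculus.

Section Jacobi.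
Variables (R : realType) (m : nat).

Definition vseq := int -> 'cV[R[i]]_m.
Implicit Types (u f : vseq) (z : R[i]).

Definition l2sum u : \bar R := (\esum_(k in [set: int]) (vnorm (u k) ^+ 2)%:E)%E.
Definition l2 u : Prop := (l2sum u < +oo)%E.
Definition l2norm u : R := Num.sqrt (fine (l2sum u)).

Definition shiftp (T : Type) (f : int -> T) : int -> T := fun k => f (k + 1).
Definition shiftm (T : Type) (f : int -> T) : int -> T := fun k => f (k - 1).

Variables A B : int -> 'M[R[i]]_m.

Definition jacobi f : vseq :=
  fun k => A k *m shiftp f k + shiftm A k *m shiftm f k + B k *m f k.

Definition jacobi_sub z f : vseq := fun k => jacobi f k - z *: f k.

(* For bounded [A] and [B], [jacobi] maps l2 to l2. *)
Definition resolvent_set : set R[i] :=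
  [set z | (forall f, l2 f -> exists! u, l2 u /\ jacobi_sub z u = f) /\
           exists K : R, forall u, l2 u -> l2norm u <= K * l2norm (jacobi_sub z u)].

Definition spectrum : set R[i] := ~` resolvent_set.

Definition finite_dim_kernel z : Prop :=
  exists (n : nat) (e : 'I_n -> vseq), forall u,
    l2 u -> (forall k, jacobi_sub z u k = 0) ->
    exists c : 'I_n -> R[i], forall k, u k = \sum_i c i *: e i k.

Definition l2_eigenvalue z : Prop :=
  exists u, [/\ l2 u, exists k, u k != 0 & forall k, jacobi_sub z u k = 0].

(* The convention for self-adjoint operators: the discrete spectrum consists of
   the isolated points of the spectrum that are eigenvalues of finite
   multiplicity, and the essential spectrum is the rest of the spectrum. *)
Definition discrete_spectrum : set R[i] :=
  [set z | [/\ isolated spectrum z, l2_eigenvalue z & finite_dim_kernel z]].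

Definition ess_spectrum : set R[i] := spectrum `\` discrete_spectrum.

Definition resolvent z f : vseq :=
  xget (fun=> 0) [set u | l2 u /\ jacobi_sub z u = f].

Definition delta_seq (l : int) (j : 'I_m) : vseq :=
  fun k => if k == l then delta_mx j 0 else 0.

Definition Green z (k l : int) : 'M[R[i]]_m :=
  \matrix_(i < m, j < m) resolvent z (delta_seq l j) k i 0.

Definition green z (k : int) : 'M[R[i]]_m := Green z k k.

Definition Xi (x : R) (k : int) : 'M[R[i]]_m :=
  lim ((pi^-1)%:C *: Immx (lnmx (green (x +i* e) k)) @[e --> (0 : R)^'+]).

Definition reflectionless : Prop :=
  forall k : int, \forall x \ae (@lebesgue_measure R),
    ess_spectrum x%:C -> Xi x k = (2^-1)%:M.

End Jacobi.

(* Main.v *)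
Require Import Defs.
From mathcomp Require Import all_boot all_order all_algebra.
From mathcomp Require Import all_classical all_reals all_analysis.
From mathcomp Require Import complex.
From mathcomp Require Import ring lra.

Set Implicit Arguments.
Unset Strict Implicit.
Unset Printing Implicit Defensive.

Import Order.TTheory GRing.Theory Num.Theory.
Import numFieldNormedType.Exports.

Local Open Scope classical_set_scope.
Local Open Scope ring_scope.
Local Open Scope complex_scope.

(** Fix a site [k] and let [G z] be the diagonal Green's matrix there, [z] in the
    upper half plane. The boundary values of [Im (ln (G z))] on the real line
    are [0] to the left of [Em] and [pi] to the right of [Ep], since [G] is positive,
    resp. negative, definite there, and [pi / 2] in between, by hypothesis. So
    [ln G + (ln (z - Em) + ln (z - Ep)) / 2 - i pi] has a bounded imaginary part
    with vanishing boundary values: by the Poisson formula it is a real constant,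
    which the behaviour of [G] at infinity identifies as [0].
    Injectivity of the principal logarithm on matrices with positive real part
    gives [G (c0 + i y) = i / sqrt (y ^ 2 + 4 c ^ 2)], with [c0] the centre of
    the band and [4 c] its length. Compared with the Neumann series of the
    resolvent at infinity, this says that the first, second and fourth moments
    of [H - c0] at every site are [0], [2 c ^ 2] and [6 c ^ 4], that is
    [B k = c0], [A k ^ 2 + A (k - 1) ^ 2 = 2 c ^ 2] and
    [(A k ^ 2 - c ^ 2) ^ 2 = 0]. *)

(** * Complex moduli and integrals *)

(** The values of [G] at different points need not commute and little more than the resolvent
    identity is available, so the logarithm and holomorphy are used in forms that avoid spectral
    theory. The logarithm is an integral of inverses along the segment from the identity. A
    difference of two such logarithms is again an integral, with [M - N] placed between two
    inverses; holomorphy, continuity and injectivity then follow from operator bounds alone. The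
    rotation by [- 'i] takes a matrix with positive imaginary part to one with positive real part,
    where these bounds are uniform. All identities are tested on a fixed vector, so the Poisson
    formula is needed for scalar functions only. The final comparison takes place on the vertical
    line through the centre of the band because the candidate value there is ['i] times a positive
    number: after the rotation it is a positive scalar matrix, the case in which injectivity of the
    logarithm is proved. The fourth moment is decisive because, once the second moments are known,
    what remains of it is the square of a self-adjoint matrix. *)

Section ComplexModulus.
Variable R : realType.
Implicit Types (x y z : R[i]) (a b : R).

Lemma cnormE z : (cnorm z)%:C = `|z|.
Proof. by rewrite /cnorm normc_def. Qed.

Lemma cnorm_sqrt z :
  cnorm z = Num.sqrt (complex.Re z ^+ 2 + complex.Im z ^+ 2).
Proof. by rewrite /cnorm normc_def. Qed.

Lemma cnorm_ge0 z : 0 <= cnorm z.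
Proof. by rewrite cnorm_sqrt sqrtr_ge0. Qed.

Lemma cnorm_sqr z : cnorm z ^+ 2 = complex.Re z ^+ 2 + complex.Im z ^+ 2.
Proof. by rewrite cnorm_sqrt sqr_sqrtr// addr_ge0// sqr_ge0. Qed.

Lemma cnormM x y : cnorm (x * y) = cnorm x * cnorm y.
Proof.
apply: (@complexI R); rewrite rmorphM/=.
by rewrite !cnormE normrM.
Qed.

Lemma cnorm0 : cnorm (0 : R[i]) = 0.
Proof. by apply: (@complexI R); rewrite cnormE normr0. Qed.

Lemma cnorm1 : cnorm (1 : R[i]) = 1.
Proof. by apply: (@complexI R); rewrite cnormE normr1. Qed.

Lemma cnormN z : cnorm (- z) = cnorm z.
Proof. by rewrite /cnorm normrN. Qed.

Lemma cdistC x y : cnorm (x - y) = cnorm (y - x).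
Proof. by rewrite -cnormN opprB. Qed.

Lemma cnormV z : cnorm z^-1 = (cnorm z)^-1.
Proof. by apply: (@complexI R); rewrite fmorphV/= !cnormE normfV. Qed.

Lemma cnormX z n : cnorm (z ^+ n) = cnorm z ^+ n.
Proof. by apply: (@complexI R); rewrite rmorphXn/= !cnormE normrX. Qed.

Lemma cnormD x y : cnorm (x + y) <= cnorm x + cnorm y.
Proof. by rewrite -lecR rmorphD/= !cnormE ler_normD. Qed.

Lemma cnormB x y : cnorm (x - y) <= cnorm x + cnorm y.
Proof. by rewrite -(cnormN y) cnormD. Qed.

Lemma cnorm_sum I (s : seq I) (P : pred I) (F : I -> R[i]) :
  cnorm (\sum_(k <- s | P k) F k) <= \sum_(k <- s | P k) cnorm (F k).
Proof.
elim/big_rec2: _ => [|k c z _ h]; first by rewrite cnorm0.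
by apply: le_trans (cnormD _ _) _; rewrite lerD2l.
Qed.

Lemma cnorm_real a : cnorm a%:C = `|a|.
Proof. by rewrite cnorm_sqrt/= expr0n/= addr0 sqrtr_sqr. Qed.

Lemma cnorm_i : cnorm ('i : R[i]) = 1.
Proof. by rewrite cnorm_sqrt/= expr0n/= add0r expr1n sqrtr1. Qed.

Lemma cnorm_conj z : cnorm (conjc z) = cnorm z.
Proof. by case: z => a b; rewrite !cnorm_sqrt/= sqrrN. Qed.

Lemma cnorm_eq0 z : (cnorm z == 0) = (z == 0).
Proof. by rewrite -(inj_eq (@complexI R)) cnormE normr_eq0. Qed.

Lemma cnorm_gt0 z : (0 < cnorm z) = (z != 0).
Proof. by rewrite lt_def cnorm_ge0 cnorm_eq0 andbT. Qed.

Lemma normRe_le z : `|complex.Re z| <= cnorm z.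
Proof.
by rewrite cnorm_sqrt -sqrtr_sqr ler_sqrt ?addr_ge0 ?sqr_ge0// lerDl sqr_ge0.
Qed.

Lemma normIm_le z : `|complex.Im z| <= cnorm z.
Proof.
by rewrite cnorm_sqrt -sqrtr_sqr ler_sqrt ?addr_ge0 ?sqr_ge0// lerDr sqr_ge0.
Qed.

Lemma complexRI z : z = (complex.Re z)%:C + 'i * (complex.Im z)%:C.
Proof. by rewrite {1}(complexE z). Qed.

Lemma cnorm_le_ReIm z : cnorm z <= `|complex.Re z| + `|complex.Im z|.
Proof.
by rewrite {1}(complexRI z) (le_trans (cnormD _ _))// cnormM cnorm_i mul1r !cnorm_real.
Qed.

Lemma cReD x y : complex.Re (x + y) = complex.Re x + complex.Re y.
Proof. by case: x y => [? ?] [? ?]. Qed.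
Lemma cImD x y : complex.Im (x + y) = complex.Im x + complex.Im y.
Proof. by case: x y => [? ?] [? ?]. Qed.
Lemma cReN x : complex.Re (- x) = - complex.Re x.
Proof. by case: x. Qed.
Lemma cImN x : complex.Im (- x) = - complex.Im x.
Proof. by case: x. Qed.
Lemma cReM x y : complex.Re (x * y) =
  complex.Re x * complex.Re y - complex.Im x * complex.Im y.
Proof. by case: x y => [? ?] [? ?]. Qed.
Lemma cImM x y : complex.Im (x * y) =
  complex.Re x * complex.Im y + complex.Im x * complex.Re y.
Proof. by case: x y => [? ?] [? ?]. Qed.
Lemma Re_conj z : complex.Re (conjc z) = complex.Re z.
Proof. by case: z. Qed.
Lemma Im_conj z : complex.Im (conjc z) = - complex.Im z.
Proof. by case: z. Qed.
Lemma complexP x y :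
  complex.Re x = complex.Re y -> complex.Im x = complex.Im y -> x = y.
Proof. by case: x y => [? ?] [? ?] /= -> ->. Qed.

Definition ReImE := (cReD, cImD, cReN, cImN, cReM, cImM, Re_conj, Im_conj).

Lemma mulcc z : z * conjc z = (cnorm z ^+ 2)%:C.
Proof. by apply: complexP; rewrite !ReImE/= ?cnorm_sqr; ring. Qed.

Lemma cnorm0P z : (forall e, 0 < e -> cnorm z <= e) -> z = 0.
Proof.
move=> h; apply/eqP; rewrite -cnorm_eq0 eq_le cnorm_ge0 andbT.
by apply/ler_addgt0Pl => e /h; rewrite addr0.
Qed.

End ComplexModulus.

Section ComplexIntegral.
Variable R : realType.
Implicit Types (f g : R -> R[i]) (a b : R).

(** Continuity relative to the segment, for the real-valued modulus [cnorm]: Lipschitz and product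
    estimates apply directly, and the library's continuity enters only for real and imaginary parts,
    where the integral is defined. *)
Definition ccont a b f := forall x, a <= x <= b -> forall e, 0 < e ->
  exists2 d, 0 < d & forall y, a <= y <= b -> `|x - y| < d -> cnorm (f x - f y) < e.

Lemma within_continuous_epsdelta a b (h : R -> R) :
  (forall x, a <= x <= b -> forall e, 0 < e -> exists2 d, 0 < d &
     forall y, a <= y <= b -> `|x - y| < d -> `|h x - h y| < e) ->
  {within `[a, b], continuous h}.
Proof.
move=> H; apply/subspace_continuousP => x /=; rewrite in_itv/= => xab.
apply/cvgrPdist_lt => e e0; have [d d0 hd] := H x xab e e0.
rewrite near_withinE; apply/nbhs_ballP; exists d => //= y xy.
by rewrite in_itv/= => yab; apply: hd.
Qed.

Lemma ccont_Re a b f : ccont a b f ->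
  {within `[a, b], continuous (fun t => complex.Re (f t))}.
Proof.
move=> H; apply: within_continuous_epsdelta => x xab e e0.
have [d d0 hd] := H x xab e e0; exists d => // y yab xy.
by apply: le_lt_trans (hd y yab xy); rewrite -cReN -cReD normRe_le.
Qed.

Lemma ccont_Im a b f : ccont a b f ->
  {within `[a, b], continuous (fun t => complex.Im (f t))}.
Proof.
move=> H; apply: within_continuous_epsdelta => x xab e e0.
have [d d0 hd] := H x xab e e0; exists d => // y yab xy.
by apply: le_lt_trans (hd y yab xy); rewrite -cImN -cImD normIm_le.
Qed.

Local Notation mu := (@lebesgue_measure R).

Lemma ccont_int_Re a b f : ccont a b f ->
  mu.-integrable `[a, b] (EFin \o (fun t => complex.Re (f t))).
Proof.
by move=> /ccont_Re; apply: continuous_compact_integrable; exact: segment_compact.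
Qed.

Lemma ccont_int_Im a b f : ccont a b f ->
  mu.-integrable `[a, b] (EFin \o (fun t => complex.Im (f t))).
Proof.
by move=> /ccont_Im; apply: continuous_compact_integrable; exact: segment_compact.
Qed.

Lemma ccont_lip a b f (K : R) :
  (forall x y, a <= x <= b -> a <= y <= b -> cnorm (f x - f y) <= K * `|x - y|) ->
  ccont a b f.
Proof.
move=> H x xab e e0; have K1 : 0 < `|K| + 1 by rewrite ltr_wpDl.
exists (e / (`|K| + 1)); first by rewrite divr_gt0.
move=> y yab; rewrite ltr_pdivlMr// => xy.
apply: le_lt_trans (H x y xab yab) _; apply: le_lt_trans xy.
rewrite mulrC ler_wpM2l//; apply: le_trans (ler_norm K) _; lra.
Qed.

Lemma ccont_bounded_at a b f x : a <= x <= b -> ccont a b f ->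
  exists2 d, 0 < d & forall y, a <= y <= b -> `|x - y| < d ->
    cnorm (f y) <= cnorm (f x) + 1.
Proof.
move=> xab H; have [d d0 hd] := H x xab 1 ltr01.
exists d => // y yab xy; rewrite -[f y](subrK (f x)) addrC.
apply: le_trans (cnormD _ _) _; rewrite lerD2l cdistC; exact/ltW/hd.
Qed.

Lemma ccont_cst a b c : ccont a b (fun=> c).
Proof. by apply: (@ccont_lip _ _ _ 0) => x y _ _; rewrite subrr cnorm0 mul0r. Qed.

Lemma ccont_id a b : ccont a b (fun t => t%:C).
Proof.
by apply: (@ccont_lip _ _ _ 1) => x y _ _; rewrite -rmorphB/= cnorm_real mul1r.
Qed.

Lemma ccontD a b f g : ccont a b f -> ccont a b g -> ccont a b (fun t => f t + g t).
Proof.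
move=> hf hg x xab e e0; have e2 : 0 < e / 2 by rewrite divr_gt0.
have [d d0 hd] := hf x xab _ e2; have [d' d0' hd'] := hg x xab _ e2.
exists (Num.min d d'); first by rewrite lt_min d0.
move=> y yab; rewrite lt_min => /andP[xd xd'].
rewrite opprD addrACA [ltRHS](splitr e) (le_lt_trans (cnormD _ _))//.
by rewrite ltrD ?hd ?hd'.
Qed.

Lemma ccontM a b f g : ccont a b f -> ccont a b g -> ccont a b (fun t => f t * g t).
Proof.
move=> hf hg x xab e e0; have [d1 d10 hd1] := ccont_bounded_at xab hg.
pose K := cnorm (f x) + (cnorm (g x) + 1) + 1.
have Kf : 0 <= cnorm (f x) by exact: cnorm_ge0.
have Kg : 0 <= cnorm (g x) by exact: cnorm_ge0.
have K0 : 0 < K by rewrite /K; lra.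
have e2 : 0 < e / K by rewrite divr_gt0.
have [d d0 hd] := hf x xab _ e2; have [d' d0' hd'] := hg x xab _ e2.
exists (Num.min d1 (Num.min d d')); first by rewrite !lt_min d0 d10.
move=> y yab; rewrite !lt_min => /and3P[xd1 xd xd'].
have -> : f x * g x - f y * g y = f x * (g x - g y) + (f x - f y) * g y by ring.
rewrite (le_lt_trans (cnormD _ _))// !cnormM.
have h1 : cnorm (g x - g y) <= e / K by exact/ltW/hd'.
have h2 : cnorm (f x - f y) <= e / K by exact/ltW/hd.
have h3 : cnorm (g y) <= cnorm (g x) + 1 by exact: hd1.
have Kgy : 0 <= cnorm (g y) by exact: cnorm_ge0.
have : e = K * (e / K) by rewrite mulrCA divff ?gt_eqF// mulr1.
have h0 : 0 < e / K by [].
have h4 : 0 <= cnorm (f x - f y) by exact: cnorm_ge0.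
move: h0 h1 h2 h3 h4; rewrite /K; set q := e / _; nra.
Qed.

Lemma ccont_mull a b f (c : R[i]) : ccont a b f -> ccont a b (fun t => c * f t).
Proof. by apply: ccontM; exact: ccont_cst. Qed.

Lemma ccontN a b f : ccont a b f -> ccont a b (fun t => - f t).
Proof.
move=> h x xab e e0; have [d d0 hd] := h x xab e e0; exists d => // y yab xy.
by rewrite -opprD cnormN; apply: hd.
Qed.

Lemma eq_ccont a b f g : (forall t, a <= t <= b -> f t = g t) ->
  ccont a b f -> ccont a b g.
Proof.
move=> fg h x xab e e0; have [d d0 hd] := h x xab e e0; exists d => // y yab xy.
by rewrite -!fg//; apply: hd.
Qed.

Lemma ccont_sum a b (I : Type) (s : seq I) (P : pred I) (F : I -> R -> R[i]) :
  (forall k, P k -> ccont a b (F k)) -> ccont a b (fun t => \sum_(k <- s | P k) F k t).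
Proof.
move=> h; elim: s => [|k s IH].
  by apply: (eq_ccont _ (@ccont_cst a b 0)) => t _; rewrite big_nil.
case: (boolP (P k)) => Pk.
  by apply: (eq_ccont _ (ccontD (h k Pk) IH)) => t _; rewrite big_cons Pk.
by apply: (eq_ccont _ IH) => t _; rewrite big_cons (negbTE Pk).
Qed.

Lemma ccont_conj a b f : ccont a b f -> ccont a b (fun t => conjc (f t)).
Proof.
move=> h x xab e e0; have [d d0 hd] := h x xab e e0; exists d => // y yab xy.
by rewrite -rmorphB/= cnorm_conj; apply: hd.
Qed.

Lemma eq_cintegral a b f g : (forall t, a <= t <= b -> f t = g t) ->
  cintegral a b f = cintegral a b g.
Proof.
move=> fg; rewrite /cintegral; congr (_ +i* _); apply: eq_Rintegral => t;
  by rewrite inE/= in_itv/= => /fg ->.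
Qed.

Lemma cintegralD a b f g : ccont a b f -> ccont a b g ->
  cintegral a b (fun t => f t + g t) = cintegral a b f + cintegral a b g.
Proof.
move=> hf hg; apply: complexP; rewrite !ReImE/=.
- under eq_Rintegral do rewrite cReD.
  by rewrite RintegralD//; exact: ccont_int_Re.
- under eq_Rintegral do rewrite cImD.
  by rewrite RintegralD//; exact: ccont_int_Im.
Qed.

Lemma ccont_ReC a b f : ccont a b f -> ccont a b (fun t => (complex.Re (f t))%:C).
Proof.
move=> h x xab e e0; have [d d0 hd] := h x xab e e0; exists d => // y yab xy.
rewrite -rmorphB/= cnorm_real -cReN -cReD; apply: le_lt_trans (normRe_le _) _.
exact: hd.
Qed.

Lemma ccont_ImC a b f : ccont a b f -> ccont a b (fun t => (complex.Im (f t))%:C).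
Proof.
move=> h x xab e e0; have [d d0 hd] := h x xab e e0; exists d => // y yab xy.
rewrite -rmorphB/= cnorm_real -cImN -cImD; apply: le_lt_trans (normIm_le _) _.
exact: hd.
Qed.

Lemma cintegralZ a b f (c : R[i]) : ccont a b f ->
  cintegral a b (fun t => c * f t) = c * cintegral a b f.
Proof.
move=> hf; apply: complexP; rewrite !ReImE/=.
- under eq_Rintegral do rewrite cReM.
  rewrite RintegralB//.
  + rewrite !RintegralZl//; by [exact: ccont_int_Re|exact: ccont_int_Im].
  + have := ccont_int_Re (ccont_mull (complex.Re c)%:C (ccont_ReC hf)).
    by apply: eq_integrable => // t _; rewrite /= ?ReImE/= ?mul0r ?subr0 ?addr0.
  + have := ccont_int_Re (ccont_mull (complex.Im c)%:C (ccont_ImC hf)).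
    by apply: eq_integrable => // t _; rewrite /= ?ReImE/= ?mul0r ?subr0 ?addr0.
- under eq_Rintegral do rewrite cImM.
  rewrite RintegralD//.
  + rewrite !RintegralZl//; by [exact: ccont_int_Re|exact: ccont_int_Im].
  + have := ccont_int_Re (ccont_mull (complex.Re c)%:C (ccont_ImC hf)).
    by apply: eq_integrable => // t _; rewrite /= ?ReImE/= ?mul0r ?subr0 ?addr0.
  + have := ccont_int_Re (ccont_mull (complex.Im c)%:C (ccont_ReC hf)).
    by apply: eq_integrable => // t _; rewrite /= ?ReImE/= ?mul0r ?subr0 ?addr0.
Qed.

Lemma cintegralN a b f : ccont a b f ->
  cintegral a b (fun t => - f t) = - cintegral a b f.
Proof.
move=> hf; rewrite -[RHS]mulN1r -cintegralZ//.
by apply: eq_cintegral => t _; rewrite mulN1r.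
Qed.

Lemma cintegralB a b f g : ccont a b f -> ccont a b g ->
  cintegral a b (fun t => f t - g t) = cintegral a b f - cintegral a b g.
Proof. by move=> hf hg; rewrite cintegralD ?cintegralN//; exact: ccontN. Qed.

Lemma cintegral_cst a b (c : R[i]) : a <= b ->
  cintegral a b (fun=> c) = (b - a)%:C * c.
Proof.
move=> ab; rewrite /cintegral !Rintegral_cst//= lebesgue_measure_itv/= lte_fin.
apply: complexP; rewrite !ReImE/=; case: ltgtP ab => //= [_ _|-> _]; ring.
Qed.

Lemma cintegral_sum a b (I : Type) (s : seq I) (F : I -> R -> R[i]) : a <= b ->
  (forall k, ccont a b (F k)) ->
  cintegral a b (fun t => \sum_(k <- s) F k t) = \sum_(k <- s) cintegral a b (F k).
Proof.
move=> ab h; elim: s => [|k s IH].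
  rewrite big_nil -[RHS](mulr0 (b - a)%:C) -cintegral_cst//.
  by apply: eq_cintegral => t _; rewrite big_nil.
rewrite big_cons -IH -cintegralD//; last by apply: ccont_sum.
by apply: eq_cintegral => t _; rewrite big_cons.
Qed.

Lemma cintegral_conj a b f : ccont a b f ->
  cintegral a b (fun t => conjc (f t)) = conjc (cintegral a b f).
Proof.
move=> hf; apply: complexP; rewrite ?ReImE/=.
  by apply: eq_Rintegral => t _; rewrite Re_conj.
under eq_Rintegral do rewrite Im_conj -mulN1r.
by rewrite RintegralZl// ?mulN1r//; exact: ccont_int_Im.
Qed.

(* The factor 2 spares a rotation of the integral to the real axis. *)
Lemma cintegral_le a b f (g : R -> R) : ccont a b f -> ccont a b (fun t => (g t)%:C) ->
  (forall t, a <= t <= b -> cnorm (f t) <= g t) ->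
  cnorm (cintegral a b f) <= 2 * \int[mu]_(t in `[a, b]) g t.
Proof.
move=> hf hg fg; have ig : mu.-integrable `[a, b] (EFin \o g).
  by have := ccont_int_Re hg; apply: eq_integrable.
apply: le_trans (cnorm_le_ReIm _) _; rewrite mulr_natl mulr2n lerD//=.
- apply: le_trans (le_normr_Rintegral _ (ccont_int_Re hf)) _ => //.
  apply: le_Rintegral => //; first exact: integrable_norm (ccont_int_Re hf).
  by move=> t /=; rewrite in_itv/= => /fg; apply: le_trans; exact: normRe_le.
- apply: le_trans (le_normr_Rintegral _ (ccont_int_Im hf)) _ => //.
  apply: le_Rintegral => //; first exact: integrable_norm (ccont_int_Im hf).
  by move=> t /=; rewrite in_itv/= => /fg; apply: le_trans; exact: normIm_le.
Qed.

Lemma cintegral_le_cst a b f (K : R) : a <= b -> ccont a b f ->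
  (forall t, a <= t <= b -> cnorm (f t) <= K) ->
  cnorm (cintegral a b f) <= 2 * (b - a) * K.
Proof.
move=> ab hf fK; apply: le_trans (cintegral_le hf (ccont_cst K%:C) fK) _.
rewrite -mulrA ler_wpM2l// Rintegral_cst//= lebesgue_measure_itv/= lte_fin.
by case: ltgtP ab => //= [_ _|-> _]; rewrite ?subrr ?mulr0 ?mul0r// mulrC.
Qed.

End ComplexIntegral.

(** * Holomorphic functions *)

Section QuadraticHolomorphy.
Variable R : realType.
Implicit Types (f g : R[i] -> R[i]) (S : set R[i]) (z w : R[i]).

(* Holomorphy as a first order expansion whose quadratic remainder is uniform on
   [S]: this is what the resolvent identity and the explicit integrals provide. *)
Definition qhol S f := exists (f' : R[i] -> R[i]) (K : R), forall z w, S z -> S w ->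
  [/\ cnorm (f z) <= K, cnorm (f' w) <= K &
      cnorm (f z - f w - (z - w) * f' w) <= K * cnorm (z - w) ^+ 2].

Lemma eq_qhol S f g : (forall z, S z -> f z = g z) -> qhol S f -> qhol S g.
Proof.
move=> fg [f' [K h]]; exists f', K => z w Sz Sw.
by rewrite -!fg//; apply: h.
Qed.

(** Points at distance at least 1 are handled by the bound on [f], closer ones by the expansion,
    whose quadratic remainder is then dominated by a linear one. No path inside [S] is involved. *)
Lemma qhol_lip S f : qhol S f ->
  exists K, forall z w, S z -> S w -> cnorm (f z - f w) <= K * cnorm (z - w).
Proof.
move=> [f' [K h]]; exists (2 * K) => z w Sz Sw.
have [h1 h2 h3] := h z w Sz Sw; have [h4 _ _] := h w w Sw Sw.
have d0 : 0 <= cnorm (z - w) by exact: cnorm_ge0.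
have K0 : 0 <= K by apply: le_trans h1; exact: cnorm_ge0.
have [d1|d1] := leP 1 (cnorm (z - w)).
  by apply: le_trans (cnormB _ _) _; nra.
have -> : f z - f w = (f z - f w - (z - w) * f' w) + (z - w) * f' w by ring.
apply: le_trans (cnormD _ _) _; rewrite cnormM.
have e1 : K * cnorm (z - w) ^+ 2 <= K * cnorm (z - w).
  by rewrite ler_wpM2l// expr2 ler_piMl// ltW.
have e2 : cnorm (z - w) * cnorm (f' w) <= cnorm (z - w) * K by rewrite ler_wpM2l.
lra.
Qed.

(** Adding the expansion at [w] to the one at [z] makes the values of [f] cancel and leaves
    [(f' z - f' w) * (z - w)] of second order: the derivative is Lipschitz. *)
Lemma qhol_deriv_unique S f : qhol S f ->
  exists (f' : R[i] -> R[i]) (K : R), forall z w, S z -> S w ->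
  [/\ cnorm (f z) <= K, cnorm (f' w) <= K,
      cnorm (f z - f w - (z - w) * f' w) <= K * cnorm (z - w) ^+ 2 &
      cnorm (f' z - f' w) <= K * cnorm (z - w)].
Proof.
move=> [f' [K h]]; exists f', (2 * `|K|) => z w Sz Sw.
have [h1 h2 h3] := h z w Sz Sw; have [h4 h5 h6] := h w z Sw Sz.
have d0 : 0 <= cnorm (z - w) by exact: cnorm_ge0.
have K0 : 0 <= K by apply: le_trans h1; exact: cnorm_ge0.
rewrite ger0_norm//; split; [lra|lra|apply: le_trans h3 _; nra|].
have [->|zw] := eqVneq z w; first by rewrite !subrr cnorm0 mulr0.
have zw0 : 0 < cnorm (z - w) by rewrite cnorm_gt0 subr_eq0.
rewrite -(ler_pM2r zw0) -cnormM -mulrA -expr2.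
have -> : (f' z - f' w) * (z - w) =
  (f z - f w - (z - w) * f' w) + (f w - f z - (w - z) * f' z) by ring.
apply: le_trans (cnormD _ _) _; rewrite (cdistC w z) in h6; lra.
Qed.

Lemma qhol_cst S (c : R[i]) : qhol S (fun=> c).
Proof.
exists (fun=> 0), (cnorm c) => z w _ _.
rewrite subrr mulr0 subr0 cnorm0; split=> //; rewrite ?cnorm_ge0//.
by rewrite mulr_ge0 ?cnorm_ge0 ?sqr_ge0.
Qed.

Lemma qhol_id S (X : R) : (forall z, S z -> cnorm z <= X) -> qhol S id.
Proof.
move=> SX; exists (fun=> 1), (`|X| + 1) => z w /SX zX _.
have X0 : 0 <= `|X| by [].
rewrite cnorm1; split; [|lra|].
  by apply: le_trans zX _; apply: le_trans (ler_norm X) _; lra.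
by rewrite mulr1 subrr cnorm0 mulr_ge0 ?sqr_ge0//; lra.
Qed.

Lemma qholD S f g : qhol S f -> qhol S g -> qhol S (fun z => f z + g z).
Proof.
move=> [f' [K h]] [g' [L k]]; exists (fun z => f' z + g' z), (K + L) => z w Sz Sw.
have [h1 h2 h3] := h z w Sz Sw; have [k1 k2 k3] := k z w Sz Sw.
split; [by apply: le_trans (cnormD _ _) _; lra
       |by apply: le_trans (cnormD _ _) _; lra|].
have -> : f z + g z - (f w + g w) - (z - w) * (f' w + g' w) =
  (f z - f w - (z - w) * f' w) + (g z - g w - (z - w) * g' w) by ring.
by apply: le_trans (cnormD _ _) _; rewrite [leRHS]mulrDl; exact: lerD.
Qed.

Lemma qholM S f g : qhol S f -> qhol S g -> qhol S (fun z => f z * g z).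
Proof.
move=> hf hg; have [LL HL] := qhol_lip hf; have [LM HM] := qhol_lip hg.
case: hf => [f' [K h]]; case: hg => [g' [L k]].
exists (fun z => f' z * g z + f z * g' z), (K * L + K * L + `|LL| * `|LM|) => z w Sz Sw.
have [h1 h2 h3] := h z w Sz Sw; have [k1 k2 k3] := k z w Sz Sw.
have [h1' _ _] := h w w Sw Sw; have [k1' _ _] := k w w Sw Sw.
have [e1 e2] := (cnorm_ge0 (f z), cnorm_ge0 (g z)).
have [e3 e4] := (cnorm_ge0 (f' w), cnorm_ge0 (g' w)).
have [e5 e6] := (cnorm_ge0 (f w), cnorm_ge0 (g w)).
have K0 : 0 <= K by lra.
have L0 : 0 <= L by lra.
have LL0 : 0 <= `|LL| * `|LM| by rewrite mulr_ge0.
have M1 : forall a b : R, 0 <= a -> 0 <= b -> a <= K -> b <= L -> a * b <= K * L.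
  by move=> a b a0 b0 aK bL; exact: ler_pM.
split.
- rewrite cnormM; have := M1 _ _ e1 e2 h1 k1; have : 0 <= K * L by rewrite mulr_ge0.
  by move=> ? ?; lra.

- apply: le_trans (cnormD _ _) _; rewrite !cnormM.
  by have := M1 _ _ e3 e6 h2 k1'; have := M1 _ _ e5 e4 h1' k2; lra.
have -> : f z * g z - f w * g w - (z - w) * (f' w * g w + f w * g' w) =
  (f z - f w - (z - w) * f' w) * g w + f w * (g z - g w - (z - w) * g' w)
  + (f z - f w) * (g z - g w) by ring.
apply: le_trans (cnormD _ _) _; rewrite [leRHS]mulrDl lerD//.
  apply: le_trans (cnormD _ _) _; rewrite !cnormM [leRHS]mulrDl lerD//.
    by rewrite mulrAC ler_pM// cnorm_ge0.
  by rewrite -mulrA ler_pM// cnorm_ge0.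
rewrite cnormM; have -> : `|LL| * `|LM| * cnorm (z - w) ^+ 2 =
  (`|LL| * cnorm (z - w)) * (`|LM| * cnorm (z - w)) by ring.
by rewrite ler_pM ?cnorm_ge0//; [apply: le_trans (HL _ _ Sz Sw) _
  |apply: le_trans (HM _ _ Sz Sw) _]; rewrite ler_wpM2r ?cnorm_ge0 ?ler_norm.
Qed.

Lemma qholZ S f (c : R[i]) : qhol S f -> qhol S (fun z => c * f z).
Proof. by move=> h; apply: qholM => //; exact: qhol_cst. Qed.

Lemma qholN S f : qhol S f -> qhol S (fun z => - f z).
Proof.
by move=> /(qholZ (-1)); apply: eq_qhol => z _; rewrite mulN1r.
Qed.

Lemma qholB S f g : qhol S f -> qhol S g -> qhol S (fun z => f z - g z).
Proof. by move=> hf hg; apply: qholD => //; exact: qholN. Qed.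

Lemma qholX S f n : qhol S f -> qhol S (fun z => f z ^+ n).
Proof.
move=> h; elim: n => [|n IH]; first exact: qhol_cst.
by apply: (eq_qhol _ (qholM h IH)) => z _; rewrite exprS.
Qed.

Lemma qholV S f (c : R) : 0 < c -> (forall z, S z -> c <= cnorm (f z)) ->
  qhol S f -> qhol S (fun z => (f z)^-1).
Proof.
move=> c0 cf hf; have [L HL] := qhol_lip hf; case: hf => [f' [K h]].
exists (fun z => - f' z / f z ^+ 2), (c^-1 + K * c^-1 ^+ 2 + `|L| ^+ 2 * c^-1 ^+ 3) => z w Sz Sw.
have [h1 h2 h3] := h z w Sz Sw.
have K0 : 0 <= K by apply: le_trans h1; exact: cnorm_ge0.
have b0 : 0 <= c^-1 by rewrite invr_ge0 ltW.
have A1 : 0 <= K * c^-1 ^+ 2 by rewrite mulr_ge0 ?exprn_ge0.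
have A2 : 0 <= `|L| ^+ 2 * c^-1 ^+ 3 by rewrite mulr_ge0 ?exprn_ge0.
have iz : forall z, S z -> cnorm (f z)^-1 <= c^-1.
  by move=> y Sy; rewrite cnormV lef_pV2 ?posrE ?cf// (lt_le_trans c0) ?cf.
have nz : forall z, S z -> f z != 0.
  by move=> y Sy; rewrite -cnorm_gt0 (lt_le_trans c0) ?cf.
split.
- by apply: le_trans (iz z Sz) _; lra.
- rewrite cnormM cnormN -exprVn cnormX.
  have : cnorm (f' w) * cnorm (f w)^-1 ^+ 2 <= K * c^-1 ^+ 2.
    by rewrite ler_pM ?exprn_ge0 ?cnorm_ge0// lerXn2r ?nnegrE ?cnorm_ge0 ?iz.
  lra.
have -> : (f z)^-1 - (f w)^-1 - (z - w) * (- f' w / f w ^+ 2) =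
  - (f z - f w - (z - w) * f' w) * (f w)^-1 ^+ 2 +
  (f z - f w) ^+ 2 * ((f z)^-1 * (f w)^-1 ^+ 2).
  by have := nz z Sz; have := nz w Sw; move=> n1 n2; field; rewrite n1 n2.
apply: le_trans (cnormD _ _) _; rewrite !(cnormM, cnormN, cnormX).
have B1 : cnorm (f z - f w - (z - w) * f' w) * cnorm (f w)^-1 ^+ 2 <=
  K * cnorm (z - w) ^+ 2 * c^-1 ^+ 2.
  by rewrite ler_pM ?exprn_ge0 ?cnorm_ge0// lerXn2r ?nnegrE ?cnorm_ge0 ?iz.
have B2 : cnorm (f z - f w) ^+ 2 * (cnorm (f z)^-1 * cnorm (f w)^-1 ^+ 2) <=
  (`|L| * cnorm (z - w)) ^+ 2 * (c^-1 * c^-1 ^+ 2).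
  rewrite ler_pM ?mulr_ge0 ?exprn_ge0 ?cnorm_ge0//.
    rewrite lerXn2r ?nnegrE ?cnorm_ge0 ?mulr_ge0 ?cnorm_ge0//.
    by apply: le_trans (HL _ _ Sz Sw) _; rewrite ler_wpM2r ?cnorm_ge0 ?ler_norm.
  by rewrite ler_pM ?exprn_ge0 ?cnorm_ge0 ?iz// lerXn2r ?nnegrE ?cnorm_ge0 ?iz.
apply: le_trans (lerD B1 B2) _.
have : 0 <= c^-1 * cnorm (z - w) ^+ 2 by rewrite mulr_ge0 ?sqr_ge0.
set d := cnorm (z - w); set b := c^-1 => bb; nra.
Qed.

Lemma qhol_comp S S' f g : (forall z, S z -> S' (g z)) ->
  qhol S' f -> qhol S g -> qhol S (fun z => f (g z)).
Proof.
move=> SS hf hg; have [L HL] := qhol_lip hg.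
case: hf => [f' [K h]]; case: hg => [g' [M k]].
exists (fun z => f' (g z) * g' z), (K + K * M + K * `|L| ^+ 2) => z w Sz Sw.
have [h1 h2 h3] := h _ _ (SS z Sz) (SS w Sw); have [k1 k2 k3] := k z w Sz Sw.
have K0 : 0 <= K by apply: le_trans h1; exact: cnorm_ge0.
have M0 : 0 <= M by apply: le_trans k1; exact: cnorm_ge0.
have A1 : 0 <= K * M by rewrite mulr_ge0.
have A2 : 0 <= K * `|L| ^+ 2 by rewrite mulr_ge0 ?exprn_ge0.
split; first lra.
  rewrite cnormM; have : cnorm (f' (g w)) * cnorm (g' w) <= K * M.
    by rewrite ler_pM ?cnorm_ge0.
  lra.
have -> : f (g z) - f (g w) - (z - w) * (f' (g w) * g' w) =
  (f (g z) - f (g w) - (g z - g w) * f' (g w)) +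
  f' (g w) * (g z - g w - (z - w) * g' w) by ring.
apply: le_trans (cnormD _ _) _; rewrite cnormM.
have B1 : cnorm (f' (g w)) * cnorm (g z - g w - (z - w) * g' w) <=
   K * (M * cnorm (z - w) ^+ 2) by rewrite ler_pM ?cnorm_ge0.
have B2 : cnorm (g z - g w) ^+ 2 <= (`|L| * cnorm (z - w)) ^+ 2.
  rewrite lerXn2r ?nnegrE ?cnorm_ge0 ?mulr_ge0 ?cnorm_ge0//.
  by apply: le_trans (HL _ _ Sz Sw) _; rewrite ler_wpM2r ?cnorm_ge0 ?ler_norm.
have B3 : K * cnorm (g z - g w) ^+ 2 <= K * (`|L| * cnorm (z - w)) ^+ 2.
  by rewrite ler_wpM2l.
have : 0 <= K * cnorm (z - w) ^+ 2 by rewrite mulr_ge0 ?sqr_ge0.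
move: h3 B1 B3; set d := cnorm (z - w); set l := `|L|; lra.
Qed.

End QuadraticHolomorphy.

(** * Derivatives from quadratic estimates *)

Section RealAnalysis.
Variable R : realType.

Lemma is_derive_quad (h : R -> R) (x d K e : R) : 0 < e ->
  (forall y, `|y - x| < e -> `|h y - h x - (y - x) * d| <= K * (y - x) ^+ 2) ->
  is_derive x 1 h d.
Proof.
move=> e0 hq.
suff cv : t^-1 *: (h (t + x) - h x) @[t --> 0^'] --> d.
  apply: DeriveDef; last by apply/cvg_lim => //; under eq_fun do rewrite -[_ *: 1]/(_ * 1) mulr1.
  by apply/cvg_ex; exists d; under eq_fun do rewrite -[_ *: 1]/(_ * 1) mulr1.
apply/cvgrPdist_le => r r0.
near=> t; have t0 : t != 0 by near: t; exact: nbhs_dnbhs_neq.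
have te : `|t| < e.
  near: t; apply: dnbhs0_lt; exact: e0.
have tr : `|t| < r / (`|K| + 1).
  by near: t; apply: dnbhs0_lt; rewrite divr_gt0// ltr_wpDl.
have := hq (t + x); rewrite addrK => /(_ te) ht.
rewrite -[X in `|X|]opprK normrN opprB -[_ *: _]/(_ * _).
have -> : t^-1 * (h (t + x) - h x) - d = t^-1 * (h (t + x) - h x - t * d).
  by field.
rewrite normrM normrV ?unitfE// ler_pdivrMl ?normr_gt0//.
apply: le_trans ht _; rewrite -[t ^+ 2]real_normK ?num_real//.
have K1 : 0 < `|K| + 1 by rewrite ltr_wpDl.
move: tr; rewrite ltr_pdivlMr// => tr.
have := ler_norm K; have := normr_ge0 t; nra.
Unshelve. all: by end_near. Qed.

(** The derivative vanishes in the interior and the mean value theorem concludes. Second-order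
    estimates thus yield constancy, both of circular means and of holomorphic functions with
    vanishing imaginary part along vertical lines. *)
Lemma quad_const (h : R -> R) (a b K : R) : a <= b ->
  (forall x y, a <= x <= b -> a <= y <= b -> `|h y - h x| <= K * (y - x) ^+ 2) ->
  h a = h b.
Proof.
rewrite le_eqVlt => /predU1P[->//|ab] hq.
have cd x : x \in `]a, b[ -> is_derive x 1 h (cst 0 x).
  rewrite in_itv/= => /andP[ax xb].
  apply: (@is_derive_quad h x _ K (Num.min (x - a) (b - x))).
    by rewrite lt_min !subr_gt0 ax.
  move=> y; rewrite lt_min => /andP[]; rewrite !ltr_norml => /andP[y1 y2] /andP[y3 y4].
  by rewrite mulr0 subr0; apply: hq; apply/andP; split; lra.
have ch : {within `[a, b], continuous h}.
  apply: within_continuous_epsdelta => x xab e e0.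
  have K1 : 0 < `|K| + 1 by rewrite ltr_wpDl.
  have c0 : 0 < e / (`|K| + 1) by rewrite divr_gt0.
  exists (Num.min 1 (e / (`|K| + 1))); first by rewrite lt_min c0 ltr01.
  move=> y yab; rewrite lt_min ltr_pdivlMr// => /andP[xy1 xy2].
  rewrite distrC; apply: le_lt_trans (hq _ _ xab yab) _.
  rewrite -[(y - x) ^+ 2]real_normK ?num_real// distrC.
  have := ler_norm K; have := normr_ge0 (x - y); nra.
have [c _ hc] := MVT ab cd ch.
by apply/eqP; rewrite eq_sym -subr_eq0 hc mul0r.
Qed.

Lemma sin_le_norm (x : R) : `|sin x| <= `|x|.
Proof.
wlog x0 : x / 0 <= x.
  move=> hw; have [/hw//|x0] := leP 0 x.
  by rewrite -[X in sin X]opprK sinN normrN -[in leRHS]normrN hw// oppr_ge0 ltW.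
have [c _] : exists2 c, c \in `[0, x] & sin x - sin 0 = cos c * (x - 0).
  apply: (@MVT_segment _ sin cos 0 x) => //.
  by apply: continuous_subspaceT; exact: continuous_sin.
by rewrite sin0 !subr0 => ->; rewrite normrM ler_piMl// cos_max.
Qed.

Lemma cos_sub1_le (x : R) : `|cos x - 1| <= x ^+ 2.
Proof.
have -> : cos x - 1 = - ((sin (x / 2)) ^+ 2 *+ 2).
  have E : x = (x / 2) *+ 2 by rewrite -mulr_natr; field.
  rewrite {1}E cos_mulr2n; have := cos2Dsin2 (x / 2); lra.
rewrite normrN normrMn normrX -[_ *+ 2]mulr_natr.
have := sin_le_norm (x / 2); have := normr_ge0 (sin (x / 2)).
have h : `|x / 2| ^+ 2 = x ^+ 2 / 4 by rewrite real_normK ?num_real//; field.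
have := normr_ge0 (x / 2); have := sqr_ge0 x; nra.
Qed.

Lemma sin_subid_le (x : R) : `|sin x - x| <= 2 * x ^+ 2.
Proof.
have [x1|x1] := leP 1 `|x|.
  apply: le_trans (ler_normB _ _) _; have := sin_le_norm x.
  by rewrite -[x ^+ 2]real_normK ?num_real//; nra.
wlog x0 : x x1 / 0 <= x.
  move=> hw; have [/hw|x0] := leP 0 x; first exact.
  have -> : sin x - x = - (sin (- x) - - x) by rewrite sinN; ring.
  by rewrite normrN -sqrrN; apply: hw; rewrite ?normrN ?oppr_ge0 ?ltW.
have [c cx] : exists2 c, c \in `[0, x] & sin x - sin 0 = cos c * (x - 0).
  apply: (@MVT_segment _ sin cos 0 x) => //.
  by apply: continuous_subspaceT; exact: continuous_sin.
rewrite sin0 !subr0 => ->; rewrite -{2}[x]mul1r -mulrBl normrM.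
move: cx x1; rewrite in_itv/= (ger0_norm x0) => /andP[c0 cx] x1.
have := cos_sub1_le c; have := normr_ge0 (cos c - 1); nra.
Qed.

End RealAnalysis.

(** * The mean value property on circles *)

Section CircleMean.
Variable R : realType.
Implicit Types (f : R[i] -> R[i]).

Lemma expiD (a b : R) : expi (a + b) = expi a * expi b.
Proof. by apply: complexP; rewrite !ReImE/= ?cosD ?sinD; ring. Qed.

Lemma expi0 : expi (0 : R) = 1.
Proof. by rewrite /expi cos0 sin0. Qed.

Lemma cnorm_expi (a : R) : cnorm (expi a) = 1.
Proof. by rewrite cnorm_sqrt/= cos2Dsin2 sqrtr1. Qed.

Lemma expi2pi : expi (2 * pi) = 1 :> R[i].
Proof. by rewrite /expi mulr_natl cos2pi sin2pi. Qed.

Lemma expiN (a : R) : expi (- a) = conjc (expi a).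
Proof. by rewrite /expi cosN sinN. Qed.

Lemma expi_quad (x y : R) :
  cnorm (expi y - expi x - (y - x)%:C * ('i * expi x)) <= 3 * (y - x) ^+ 2.
Proof.
have -> : expi y = expi x * expi (y - x) by rewrite -expiD addrC subrK.
have -> : expi x * expi (y - x) - expi x - (y - x)%:C * ('i * expi x) =
  expi x * (expi (y - x) - 1 - 'i * (y - x)%:C) by ring.
rewrite cnormM cnorm_expi mul1r; apply: le_trans (cnorm_le_ReIm _) _.
rewrite !ReImE/=.
have -> : cos (y - x) - 1 - (0 * (y - x) - 1 * 0) = cos (y - x) - 1 by ring.
have -> : sin (y - x) - 0 - (0 * 0 + 1 * (y - x)) = sin (y - x) - (y - x) by ring.
have := cos_sub1_le (y - x); have := sin_subid_le (y - x); lra.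
Qed.

Lemma expi_lip (x y : R) : cnorm (expi x - expi y) <= 2 * `|x - y|.
Proof.
have -> : expi x - expi y = expi y * (expi (x - y) - 1).
  by rewrite mulrBr mulr1 -expiD [y + _]addrC subrK.
rewrite cnormM cnorm_expi mul1r; set t := x - y.
apply: le_trans (cnorm_le_ReIm _) _; rewrite !ReImE/= subr0.
have := sin_le_norm t; have : `|cos t - 1| <= `|t|.
  have -> : cos t - 1 = - ((sin (t / 2)) ^+ 2 *+ 2).
    have E : t = (t / 2) *+ 2 by rewrite -mulr_natr; field.
    rewrite {1}E cos_mulr2n; have := cos2Dsin2 (t / 2); lra.
  rewrite normrN normrMn normrX -[_ *+ 2]mulr_natr.
  have := sin_le_norm (t / 2); rewrite normrM (@gtr0_norm _ 2^-1)//.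
  have := sin_max (t / 2); have := normr_ge0 (sin (t / 2)); nra.
lra.
Qed.

Definition circle (r : R) : R -> R[i] := fun t => r%:C * expi t.

Lemma cnorm_circle r t : 0 <= r -> cnorm (circle r t) = r.
Proof. by move=> r0; rewrite cnormM cnorm_expi mulr1 cnorm_real ger0_norm. Qed.

Lemma ccont_circle (a b r : R) : ccont a b (circle r).
Proof.
apply: ccont_mull; apply: (@ccont_lip _ _ _ _ 2) => x y _ _.
exact: expi_lip.
Qed.

Lemma ccont_comp_lip (S : set R[i]) f (g : R -> R[i]) (a b L : R) :
  (forall t, a <= t <= b -> S (g t)) ->
  (forall z w, S z -> S w -> cnorm (f z - f w) <= L * cnorm (z - w)) ->
  ccont a b g -> ccont a b (fun t => f (g t)).
Proof.
move=> Sg fL cg x xab e e0; have L1 : 0 < `|L| + 1 by rewrite ltr_wpDl.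
have c0 : 0 < e / (`|L| + 1) by rewrite divr_gt0.
have [d d0 hd] := cg x xab _ c0; exists d => // y yab xy.
apply: le_lt_trans (fL _ _ (Sg _ xab) (Sg _ yab)) _.
have := hd y yab xy; rewrite ltr_pdivlMr//.
have := ler_norm L; have := cnorm_ge0 (g x - g y); nra.
Qed.

Lemma ccontB (a b : R) (f g : R -> R[i]) :
  ccont a b f -> ccont a b g -> ccont a b (fun t => f t - g t).
Proof. by move=> hf hg; apply: ccontD => //; exact: ccontN. Qed.

Lemma ccont_qhol_circle (S : set R[i]) f (a b r : R) : 0 <= r ->
  (forall z, cnorm z <= r -> S z) -> qhol S f ->
  ccont a b (fun t => f (circle r t)).
Proof.
move=> r0 SB /qhol_lip[L hL].
apply: (ccont_comp_lip (S := S) (L := L)) => //; last exact: ccont_circle.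
by move=> t _; apply: SB; rewrite cnorm_circle.
Qed.

Lemma cintegral_FTC2 (F f : R -> R[i]) (a b : R) : a < b -> ccont a b f ->
  (exists K, forall x y, cnorm (F y - F x - (y - x)%:C * f x) <= K * (y - x) ^+ 2) ->
  cintegral a b f = F b - F a.
Proof.
move=> ab cf [K hK].
have dRe (x : R) : is_derive x 1 (fun t => complex.Re (F t)) (complex.Re (f x)).
  apply: (@is_derive_quad _ _ _ _ K 1) => // y _.
  apply: le_trans (hK x y); apply: le_trans (normRe_le _).
  by rewrite !ReImE/= mul0r subr0.
have dIm (x : R) : is_derive x 1 (fun t => complex.Im (F t)) (complex.Im (f x)).
  apply: (@is_derive_quad _ _ _ _ K 1) => // y _.
  apply: le_trans (hK x y); apply: le_trans (normIm_le _).
  by rewrite !ReImE/= mul0r addr0.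
have dL (h : R -> R) (h' : R -> R) : (forall x : R, is_derive x 1 h (h' x)) ->
    derivable_oo_LRcontinuous h a b.
  move=> dh; have ch x : {for x, continuous h}.
    by apply: differentiable_continuous; apply/derivable1_diffP; have [] := dh x.
  split; first by move=> x _; have [] := dh x.
    exact/cvg_at_right_filter/ch.
  exact/cvg_at_left_filter/ch.
apply: complexP; rewrite !ReImE/= /Rintegral.
- rewrite (@continuous_FTC2 _ _ (fun t => complex.Re (F t)) _ _ ab (ccont_Re cf))//.
    exact: dL dRe.
  by move=> x _; rewrite derive1E; have [] := dRe x.
- rewrite (@continuous_FTC2 _ _ (fun t => complex.Im (F t)) _ _ ab (ccont_Im cf))//.
    exact: dL dIm.
  by move=> x _; rewrite derive1E; have [] := dIm x.
Qed.

Lemma circle_quad (r x y : R) :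
  cnorm (circle r y - circle r x - (y - x)%:C * ('i * circle r x)) <=
    3 * `|r| * (y - x) ^+ 2.
Proof.
have -> : circle r y - circle r x - (y - x)%:C * ('i * circle r x) =
  r%:C * (expi y - expi x - (y - x)%:C * ('i * expi x)) by rewrite /circle; ring.
rewrite cnormM cnorm_real [3 * _]mulrC -mulrA ler_wpM2l//.
exact: expi_quad.
Qed.

Lemma circle_lip (r x y : R) : cnorm (circle r x - circle r y) <= 2 * `|r| * `|x - y|.
Proof.
rewrite -mulrBr cnormM cnorm_real [2 * _]mulrC -mulrA ler_wpM2l//.
exact: expi_lip.
Qed.

(* [f'(w) i w] is the angular derivative of [f], so its integral over a full
   circle vanishes, and with it the radial derivative of the circular means. *)
Lemma circle_mean f (r : R) : 0 < r -> qhol [set z | cnorm z <= r] f ->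
  cintegral 0 (2 * pi) (fun t => f (circle r t)) = (2 * pi)%:C * f 0.
Proof.
move=> r0 hf; have [L hL] := qhol_lip hf.
have [f' [K hK]] := qhol_deriv_unique hf.
have K0 : 0 <= K.
  have z0 : cnorm (0 : R[i]) <= r by rewrite cnorm0 ltW.
  by have [h _ _ _] := hK 0 0 z0 z0; apply: le_trans h; exact: cnorm_ge0.
have pi2 : 0 < 2 * pi :> R by rewrite mulr_gt0 ?pi_gt0.
pose Phi s := cintegral 0 (2 * pi) (fun t => f (circle s t)).
have inB s t : 0 <= s -> s <= r -> cnorm (circle s t) <= r.
  by move=> s0 sr; rewrite cnorm_circle.
have cf s : 0 <= s -> s <= r -> ccont 0 (2 * pi) (fun t => f (circle s t)).
  move=> s0 sr; apply: (ccont_qhol_circle s0 _ hf) => z /= zs; exact: le_trans zs sr.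
have cf' s : 0 <= s -> s <= r -> ccont 0 (2 * pi) (fun t => f' (circle s t)).
  move=> s0 sr; apply: (ccont_comp_lip (S := [set z | cnorm z <= r]) (L := K)).
  - by move=> t _ /=; exact: inB.
  - by move=> z w zS wS; have [] := hK z w zS wS.
  - exact: ccont_circle.
have cg s : 0 <= s -> s <= r ->
    ccont 0 (2 * pi) (fun t => circle s t * f' (circle s t)).
  by move=> s0 sr; apply: ccontM; [exact: ccont_circle|exact: cf'].
have zero s : 0 <= s -> s <= r ->
    cintegral 0 (2 * pi) (fun t => circle s t * f' (circle s t)) = 0.
  move=> s0 sr; have i0 : 'i != 0 :> R[i] by rewrite -cnorm_gt0 cnorm_i.
  apply: (mulfI i0); rewrite mulr0 -cintegralZ; last exact: cg.
  rewrite (cintegral_FTC2 (F := fun t => f (circle s t)))//.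
  - by rewrite /circle expi2pi expi0 subrr.
  - exact/ccont_mull/cg.
  exists (K * (2 * s) ^+ 2 + K * (3 * s)) => x y.
  have [_ hk2 hk _] := hK _ _ (inB s y s0 sr) (inB s x s0 sr).
  have -> : f (circle s y) - f (circle s x) - (y - x)%:C *
      ('i * (circle s x * f' (circle s x))) =
    (f (circle s y) - f (circle s x) - (circle s y - circle s x) * f' (circle s x)) +
    (circle s y - circle s x - (y - x)%:C * ('i * circle s x)) * f' (circle s x) by ring.
  apply: le_trans (cnormD _ _) _; rewrite [leRHS]mulrDl cnormM lerD//.
    apply: le_trans hk _; rewrite -mulrA ler_wpM2l//.
    rewrite -[(y - x) ^+ 2]real_normK ?num_real// -exprMn lerXn2r ?nnegrE ?cnorm_ge0//.
      by rewrite !mulr_ge0.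
    by have := circle_lip s y x; rewrite (ger0_norm s0).
  have := circle_quad s x y; rewrite (ger0_norm s0) => hq.
  rewrite mulrC -mulrA ler_pM ?cnorm_ge0//.
pose Q := 2 * (2 * pi) * K.
have step s s' : 0 <= s <= r -> 0 <= s' <= r ->
    s * cnorm (Phi s' - Phi s) <= s * (Q * (s' - s) ^+ 2).
  move=> /andP[s0 sr] /andP[s0' sr'].
  have [->|sn0] := eqVneq s 0; first by rewrite !mul0r.
  rewrite ler_wpM2l//.
  have sp : 0 < s by rewrite lt_def sn0.
  (* A multiple of the integral that vanishes by [zero] is subtracted, chosen so that the integrand
     becomes the quadratic remainder of [f] at [circle s t]. *)
  have -> : Phi s' - Phi s = cintegral 0 (2 * pi) (fun t =>
    f (circle s' t) - f (circle s t) - ((s' - s) / s)%:C * (circle s t * f' (circle s t))).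
    rewrite cintegralB; [|by apply: ccontB; exact: cf|exact/ccont_mull/cg].
    by rewrite cintegralB ?cintegralZ ?zero ?mulr0 ?subr0//; [exact: cg|exact: cf..].
  have -> : Q * (s' - s) ^+ 2 = 2 * (2 * pi - 0) * (K * (s' - s) ^+ 2).
    by rewrite /Q subr0; ring.
  apply: cintegral_le_cst; first exact: ltW.
    by apply: ccontB; [apply: ccontB; exact: cf|exact/ccont_mull/cg].
  move=> t _; have [_ _ hk _] := hK _ _ (inB s' t s0' sr') (inB s t s0 sr).
  have E : circle s' t - circle s t = (s' - s)%:C * expi t.
    by rewrite /circle rmorphB/=; ring.
  have -> : ((s' - s) / s)%:C * (circle s t * f' (circle s t)) =
     (circle s' t - circle s t) * f' (circle s t).
    rewrite E /circle rmorphM/= fmorphV/= !mulrA; congr (_ * _ * _).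
    by rewrite -mulrA mulVf ?mulr1// (inj_eq (@complexI R) _ 0).
  by apply: le_trans hk _; rewrite E cnormM cnorm_expi mulr1 cnorm_real real_normK ?num_real.
have const s : 0 < s -> s <= r -> Phi s = Phi r.
  move=> s0 sr.
  have hs x y : s <= x <= r -> s <= y <= r -> cnorm (Phi y - Phi x) <= Q * (y - x) ^+ 2.
    move=> /andP[x1 x2] /andP[y1 y2].
    have x0 : 0 < x by exact: lt_le_trans x1.
    have := step x y; rewrite ler_pM2l//; apply; apply/andP; split=> //; lra.
  apply: complexP.
  - apply: (@quad_const _ (fun s => complex.Re (Phi s)) _ _ Q sr) => x y xr yr.
    by rewrite -cReN -cReD; apply: le_trans (normRe_le _) (hs x y xr yr).
  - apply: (@quad_const _ (fun s => complex.Im (Phi s)) _ _ Q sr) => x y xr yr.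
    by rewrite -cImN -cImD; apply: le_trans (normIm_le _) (hs x y xr yr).
rewrite -[LHS]/(Phi r); apply/eqP; rewrite -subr_eq0; apply/eqP.
apply: cnorm0P => e e0.
have LL : 0 < `|L| + 1 by rewrite ltr_wpDl.
(* A radius so small that, by the Lipschitz bound, the integral over its circle differs from
   [2 * pi] times the central value by at most [e]. The radius 0 itself is excluded by the division
   in [step]. *)
pose s := Num.min r (e / (2 * (2 * pi) * (`|L| + 1))).
have s0 : 0 < s by rewrite lt_min r0 divr_gt0// !mulr_gt0 ?pi_gt0.
have sr : s <= r by rewrite ge_min lexx.
have se : s * (2 * (2 * pi) * (`|L| + 1)) <= e.
  by rewrite -ler_pdivlMr ?mulr_gt0 ?pi_gt0// ge_min lexx orbT.
rewrite -(const s)// /Phi.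
have -> : (2 * pi)%:C * f 0 = cintegral 0 (2 * pi) (fun=> f 0).
  by rewrite cintegral_cst ?subr0// ltW.
rewrite -cintegralB; [|exact: cf (ltW s0) sr|exact: ccont_cst].
apply: le_trans se.
have -> : s * (2 * (2 * pi) * (`|L| + 1)) = 2 * (2 * pi - 0) * ((`|L| + 1) * s).
  by rewrite subr0; ring.
apply: cintegral_le_cst; first exact: ltW.
  by apply: ccontB; [exact: cf (ltW s0) sr|exact: ccont_cst].
move=> t _; have z0 : cnorm (0 : R[i]) <= r by rewrite cnorm0 ltW.
apply: le_trans (hL _ _ (inB s t (ltW s0) sr) z0) _.
rewrite subr0 cnorm_circle ?ltW//.
have := ler_norm L; nra.
Qed.

End CircleMean.

(** * The Poisson formula in the half plane *)

Section HalfPlane.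
Variable R : realType.
Local Notation mu := (@lebesgue_measure R).

Definition upper_box (e X : R) : set R[i] :=
  [set z | e <= complex.Im z /\ cnorm z <= X].

(** Holomorphy in the open upper half plane with constants uniform on bounded parts away from the
    real line; nothing is asked as [e] tends to 0, so boundary values are approached along
    horizontal lines. *)
Definition holU (f : R[i] -> R[i]) := forall e X, 0 < e -> qhol (upper_box e X) f.

Lemma ae_mono (P Q : R -> Prop) : (forall x, P x -> Q x) ->
  (\forall x \ae mu, P x) -> \forall x \ae mu, Q x.
Proof. by move=> PQ; apply: negligibleS => x nQ Px; apply: nQ; exact: PQ. Qed.

Lemma Rintegral_split (h : R -> R) (a x b : R) : a <= x -> x <= b ->
  {within `[a, b], continuous h} ->
  \int[mu]_(t in `[a, b]) h t =
  \int[mu]_(t in `[a, x]) h t + \int[mu]_(t in `[x, b]) h t.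
Proof.
move=> ax xb ch; have ih : mu.-integrable `[a, b] (EFin \o h).
  by apply: continuous_compact_integrable => //; exact: segment_compact.
have := @Rintegral_itvB R h (BLeft a) (BRight b) x ih.
rewrite !bnd_simp => /(_ ax xb); rewrite Rintegral_itv_obnd_cbnd.
  by move=> <-; rewrite addrC subrK.
apply: (integrableS _ _ _ ih) => //.
by apply: subset_itvr; rewrite bnd_simp.
Qed.

Lemma normr_Rintegral_le (h : R -> R) (a b K : R) : a <= b ->
  {within `[a, b], continuous h} -> (forall t, a <= t <= b -> `|h t| <= K) ->
  `|\int[mu]_(t in `[a, b]) h t| <= K * (b - a).
Proof.
move=> ab ch hK; have ih : mu.-integrable `[a, b] (EFin \o h).
  by apply: continuous_compact_integrable => //; exact: segment_compact.
apply: le_trans (le_normr_Rintegral _ ih) _ => //.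
have -> : K * (b - a) = \int[mu]_(t in `[a, b]) (cst K t).
  rewrite Rintegral_cst//= lebesgue_measure_itv/= lte_fin.
  by case: ltgtP ab => //= -> _; rewrite subrr.
apply: le_Rintegral => //; first exact: integrable_norm ih.
  apply: continuous_compact_integrable; first exact: segment_compact.
  by apply: continuous_subspaceT; exact: cst_continuous.
Qed.

Section Poisson.
Variables (x0 eta : R).
Hypothesis eta0 : 0 < eta.

(** The angle on the unit circle that the map [psi] below sends to the real point [x - x0]; its
    derivative [th'] is [2 * pi] times the Poisson kernel of the point [x0 +i* eta]. *)
Let th (x : R) := pi + 2 * atan ((x - x0) / eta).
Let th' (x : R) := 2 * ((1 + ((x - x0) / eta) ^+ 2)^-1 / eta).

Lemma th_derive (x : R) : is_derive x 1 th (th' x).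
Proof.
rewrite /th /th'.
have d1 : is_derive x 1 (fun x => (x - x0) / eta) eta^-1.
  have -> : (fun x => (x - x0) / eta) = (eta^-1) \*: (id - cst x0 : R -> R).
    by apply/funext => t /=; rewrite mulrC.
  apply: is_derive_eq; by rewrite subr0 [_ *: _]mulr1.
have d2 : is_derive x 1 (atan \o (fun x => (x - x0) / eta))
    ((1 + ((x - x0) / eta) ^+ 2)^-1 * eta^-1).
  exact: is_derive1_comp.
have -> : (fun x => pi + 2 * atan ((x - x0) / eta)) =
   (cst pi + 2 \*: (atan \o (fun x => (x - x0) / eta))) by apply/funext.
by apply: is_derive_eq; rewrite add0r.
Qed.

Lemma th_cont : continuous th.
Proof.
move=> x; apply: differentiable_continuous; apply/derivable1_diffP.
by have [] := th_derive x.
Qed.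

Lemma th'_le (x : R) : 0 <= th' x <= 2 / eta.
Proof.
rewrite /th'; have h1 : 1 <= 1 + ((x - x0) / eta) ^+ 2 by rewrite lerDl sqr_ge0.
have h2 : 0 < 1 + ((x - x0) / eta) ^+ 2 by rewrite (lt_le_trans ltr01).
apply/andP; split.
  by rewrite mulr_ge0// divr_ge0 ?ltW// invr_gt0.
rewrite ler_wpM2l// -[leRHS]mul1r ler_wpM2r ?invr_ge0 ?(ltW eta0)//.
by rewrite invf_le1.
Qed.

Lemma th'_cont : continuous th'.
Proof.
move=> x; rewrite /th'.
apply: cvgM; first exact: cvg_cst.
apply: cvgM; last exact: cvg_cst.
apply: cvgV; first by rewrite gt_eqF// ltr_wpDr ?sqr_ge0.
apply: cvgD; first exact: cvg_cst.
have c : (fun y => (y - x0) / eta) y @[y --> x] --> (x - x0) / eta.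
  apply: cvgM; last exact: cvg_cst.
  by apply: cvgB; [exact: cvg_id|exact: cvg_cst].
by rewrite expr2; under eq_fun do rewrite expr2; exact: cvgM.
Qed.

Lemma th_homo : {homo th : x y / x < y}.
Proof.
move=> x y xy; rewrite ltrD2l ltr_pM2l// lt_atan// ltr_pM2r ?invr_gt0//.
by rewrite ltrD2r.
Qed.

Lemma Rintegral_th (G : R -> R) (a b : R) : a <= b ->
  {within `[th a, th b], continuous G} ->
  \int[mu]_(t in `[th a, th b]) G t = \int[mu]_(x in `[a, b]) (G (th x) * th' x).
Proof.
move=> ab cG; have dE : derive1 th = th'.
  by apply/funext => x; rewrite derive1E; have [] := th_derive x.
rewrite /Rintegral (@integration_by_substitution_increasing R th G a b)//.
- by congr fine; apply: eq_integral => x _; rewrite dE.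
- by move=> x y _ _; exact: th_homo.
- by rewrite dE => x _; exact: th'_cont.
- by rewrite dE; apply/cvg_ex; exists (th' a); apply: cvg_at_right_filter; exact: th'_cont.
- by rewrite dE; apply/cvg_ex; exists (th' b); apply: cvg_at_left_filter; exact: th'_cont.
- split.
  + by move=> x _; have [] := th_derive x.
  + by apply: cvg_at_right_filter; exact: th_cont.
  + by apply: cvg_at_left_filter; exact: th_cont.
Qed.

Lemma expi_th (x : R) (y := (x - x0) / eta) :
  expi (th x) * (1 - 'i * y%:C) = - (1 + 'i * y%:C).
Proof.
have t2 : atan y = (atan y) by [].
have h2 : 0 < 1 + y ^+ 2 by rewrite ltr_wpDr ?sqr_ge0.
have cy : cos (atan y) != 0 by rewrite cos_atan invr_neq0// gt_eqF// sqrtr_gt0.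
have c2 : cos (atan y) ^+ 2 * (1 + y ^+ 2) = 1.
  by rewrite cos_atan exprVn sqr_sqrtr ?ltW// mulVf// gt_eqF.
have s1 : sin (atan y) = y * cos (atan y).
  by have := atanK y; rewrite /tan => {2}<-; rewrite divfK.
rewrite /th -/y expiD [2 * _]mulr_natl [_ *+ 2]mulr2n (expiD (atan y)).
have -> : expi (pi : R) = -1 by rewrite /expi cospi sinpi; apply: complexP => /=; rewrite ?oppr0.
rewrite mulN1r mulNr; congr (- _).
apply: complexP; rewrite !ReImE/= s1.
  transitivity (cos (atan y) ^+ 2 * (1 + y ^+ 2)); [ring|rewrite c2; ring].
transitivity (y * (cos (atan y) ^+ 2 * (1 + y ^+ 2))); [ring|rewrite c2; ring].
Qed.

(** The Cayley map of the unit disc onto the upper half plane that takes 0 to ['i * eta]. *)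
Let psi (w : R[i]) : R[i] := 'i * eta%:C * (1 + w) / (1 - w).

Lemma Im_psi_ge0 w : cnorm w < 1 -> 0 <= complex.Im (psi w).
Proof.
move=> w1; have n0 : 1 - w != 0.
  rewrite subr_eq0; apply/eqP => e; move: w1; rewrite -e cnorm1 ltxx//.
have p0 : 0 < cnorm (1 - w) ^+ 2 by rewrite exprn_gt0// cnorm_gt0.
have -> : psi w = 'i * ((eta / cnorm (1 - w) ^+ 2)%:C * ((1 + w) * conjc (1 - w))).
  rewrite /psi -!mulrA; congr (_ * _); rewrite rmorphM/= -!mulrA; congr (_ * _).
  rewrite [RHS]mulrC -!mulrA; congr (_ * _); rewrite fmorphV/= -mulcc.
  have nc : conjc (1 - w) != 0 by rewrite -cnorm_eq0 cnorm_conj cnorm_eq0.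
  by rewrite invfM mulrCA (mulfV nc) mulr1.
rewrite !ReImE/= !mul1r !mul0r !add0r ?addr0 ?subr0.
have -> : (1 + complex.Re w) * (1 - complex.Re w) - complex.Im w * - - complex.Im w
   = 1 - cnorm w ^+ 2 by rewrite cnorm_sqr; ring.
rewrite mulr_ge0 ?divr_ge0 ?ltW//.
by rewrite subr_gt0 exprn_ilt1// cnorm_ge0.
Qed.

Lemma cnorm_psi_le (r : R) w : 0 <= r < 1 -> cnorm w <= r ->
  cnorm (psi w) <= 2 * eta / (1 - r) /\ 1 - r <= cnorm (1 - w).
Proof.
move=> /andP[r0 r1] wr.
have d0 : 0 < 1 - r by rewrite subr_gt0.
have d1 : 1 - r <= cnorm (1 - w).
  have : cnorm (1 - w + w) <= cnorm (1 - w) + cnorm w by exact: cnormD.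
  rewrite subrK cnorm1; lra.
split=> //; rewrite /psi !cnormM cnorm_i mul1r cnorm_real gtr0_norm// cnormV.
have d2 : (cnorm (1 - w))^-1 <= (1 - r)^-1 by rewrite lef_pV2 ?posrE// (lt_le_trans d0).
apply: ler_pM => //; rewrite ?mulr_ge0 ?cnorm_ge0 ?invr_ge0 ?cnorm_ge0 ?(ltW eta0)//.
rewrite mulrC ler_wpM2r ?(ltW eta0)//; apply: le_trans (cnormD _ _) _; rewrite cnorm1; lra.
Qed.

Lemma qhol_psi (r : R) : 0 <= r < 1 -> qhol [set w | cnorm w <= r] psi.
Proof.
move=> /andP[r0 r1]; have d0 : 0 < 1 - r by rewrite subr_gt0.
have i1 : qhol [set w | cnorm w <= r] id by apply: (qhol_id (X := r)).
apply: qholM.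
  by apply: qholZ; apply: qholD => //; exact: qhol_cst.
apply: (@qholV _ _ _ (1 - r)) => //.
  by move=> w /= wr; have [] := @cnorm_psi_le r w _ wr => //; apply/andP.
by apply: qholB => //; exact: qhol_cst.
Qed.

(** The difference equals ['i * eta * (1 - r) * (1 + y ^+ 2)] divided by
    [(1 + r) - 'i * (1 - r) * y], a denominator whose real part is at least 1. It controls the error
    of replacing the unit circle by the circle of radius [r]. *)
Lemma psi_th (r x : R) (y := (x - x0) / eta) : 0 <= r < 1 ->
  cnorm (psi (circle r (th x)) - (x - x0)%:C) <= eta * (1 - r) * (1 + y ^+ 2).
Proof.
move=> /andP[r0 r1]; have E := expi_th x; rewrite -/y in E.
have d1 : 1 <= cnorm ((1 + r)%:C - 'i * ((1 - r) * y)%:C).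
  apply: le_trans (normRe_le _); rewrite !ReImE/= ger0_norm; lra.
have n1 : 1 - 'i * y%:C != 0.
  apply/eqP => /(congr1 (@complex.Re R)); rewrite !ReImE/= => h; lra.
have n2 : (1 + r)%:C - 'i * ((1 - r) * y)%:C != 0.
  by rewrite -cnorm_gt0 (lt_le_trans ltr01).
have ex : expi (th x) = - (1 + 'i * y%:C) / (1 - 'i * y%:C) by rewrite -E mulfK.
have xe : (x - x0)%:C = eta%:C * y%:C by rewrite -rmorphM/= mulrCA divff ?gt_eqF ?mulr1.
clearbody y.
have D : 1 - circle r (th x) = ((1 + r)%:C - 'i * ((1 - r) * y)%:C) / (1 - 'i * y%:C).
  rewrite /circle ex !(rmorphD, rmorphM, rmorphB, rmorph1)/=; field; exact: n1.
have -> : psi (circle r (th x)) - (x - x0)%:C =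
   'i * (eta * (1 - r) * (1 + y ^+ 2))%:C / ((1 + r)%:C - 'i * ((1 - r) * y)%:C).
  rewrite /psi D xe /circle ex.
  have ii : 'i * 'i = -1 :> R[i] by rewrite -expr2 sqr_i.
  apply: (canRL (mulfK n2)).
  rewrite invf_div mulrBl.
  set d := (1 + r)%:C - _.
  have -> : 'i * eta%:C * (1 + r%:C * (- (1 + 'i * y%:C) / (1 - 'i * y%:C))) *
     ((1 - 'i * y%:C) / d) * d =
     'i * eta%:C * ((1 - 'i * y%:C) - r%:C * (1 + 'i * y%:C)).
    by field; rewrite n1 n2.
  rewrite /d; apply: complexP => /=; ring.
rewrite !cnormM cnorm_i mul1r cnormV cnorm_real ger0_norm; last first.
  by rewrite !mulr_ge0// ?subr_ge0 ?addr_ge0 ?sqr_ge0// ltW.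
rewrite ler_piMr ?invf_le1// ?(lt_le_trans ltr01)//.
by rewrite !mulr_ge0// ?subr_ge0 ?addr_ge0 ?sqr_ge0// ltW.
Qed.

Lemma ccont_real (h : R -> R) (a b : R) : continuous h -> ccont a b (fun t => (h t)%:C).
Proof.
move=> ch x _ e e0; have /cvgrPdist_lt/(_ e e0)/nbhs_ballP[d /= d0 hd] := ch x.
by exists d => // y _ xy; rewrite -rmorphB/= cnorm_real; exact: hd.
Qed.

Lemma ccont_comp_real (h : R -> R) (g : R -> R[i]) (L a b : R) : continuous h ->
  (forall x y, cnorm (g x - g y) <= L * `|x - y|) -> ccont a b (fun t => g (h t)).
Proof.
move=> ch gL x xab e e0; have L1 : 0 < `|L| + 1 by rewrite ltr_wpDl.
have c0 : 0 < e / (`|L| + 1) by rewrite divr_gt0.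
have [d d0 hd] := ccont_real (a := a) (b := b) ch xab c0; exists d => // y yab xy.
apply: le_lt_trans (gL _ _) _.
have := hd y yab xy; rewrite -rmorphB/= cnorm_real ltr_pdivlMr//.
have := ler_norm L; have := normr_ge0 (h x - h y); nra.
Qed.

Lemma ccont_normIm (g : R -> R[i]) (a b : R) : ccont a b g ->
  ccont a b (fun t => `|complex.Im (g t)|%:C).
Proof.
move=> h x xab e e0; have [d d0 hd] := h x xab e e0; exists d => // y yab xy.
rewrite -rmorphB/= cnorm_real; apply: le_lt_trans (hd y yab xy).
by apply: le_trans (ler_dist_dist _ _) _; rewrite -cImN -cImD normIm_le.
Qed.

Lemma le_of_le_add_1sub (A B D : R) :
  (forall r, 0 < r < 1 -> A <= B + D * (1 - r)) -> A <= B.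
Proof.
move=> h; apply/ler_addgt0Pl => e e0.
have D1 : 0 < `|D| + 1 by rewrite ltr_wpDl.
pose t := Num.min 2^-1 (e / (`|D| + 1)).
have t0 : 0 < t by rewrite lt_min divr_gt0// invr_gt0 ltr0n.
have t1 : t <= 2^-1 by rewrite ge_min lexx.
have te : t * (`|D| + 1) <= e by rewrite -ler_pdivlMr// ge_min lexx orbT.
have /h : 0 < 1 - t < 1 by apply/andP; split; lra.
have := ler_norm D; nra.
Qed.

(** The mean value property is applied to [f] composed with the Cayley map, shifted up by [eps] to
    stay where [f] is holomorphic. The arc that corresponds to the segment is transported to it,
    with density at most [2 / eta]. On the two remaining arcs, each of length [th (x0 - X)], only
    the bound [K] is used. *)
Lemma poisson_bound (f : R[i] -> R[i]) (K eps X : R) : holU f -> 0 < eps -> 0 < X ->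
  (forall z, 0 < complex.Im z -> `|complex.Im (f z)| <= K) ->
  2 * pi * `|complex.Im (f (x0 +i* (eps + eta)))| <=
  2 * K * th (x0 - X) +
  2 / eta * \int[mu]_(x in `[x0 - X, x0 + X]) `|complex.Im (f (x +i* eps))|.
Proof.
move=> hf e0 X0 fK.
pose Y := X / eta; pose M := 1 + Y ^+ 2.
have Y0 : 0 < Y by rewrite divr_gt0.
have M0 : 0 < M by rewrite ltr_wpDr ?sqr_ge0.
(* Large enough for the box to contain the segment at height [eps] together with the images of the
   corresponding arcs for every [r < 1], so that one Lipschitz constant serves them all. *)
pose X2 := cnorm (x0 +i* eps) + X + eta * M.
have [L0 hL0] := qhol_lip (hf eps X2 e0).
pose L := `|L0|.
have hL z w : upper_box eps X2 z -> upper_box eps X2 w ->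
    cnorm (f z - f w) <= L * cnorm (z - w).
  move=> zS wS; apply: le_trans (hL0 z w zS wS) _.
  by rewrite ler_wpM2r ?cnorm_ge0 ?ler_norm.
have L_ge0 : 0 <= L by rewrite /L normr_ge0.
have K0 : 0 <= K by apply: le_trans (fK 'i _) => //=.
have yM x : x0 - X <= x <= x0 + X -> 1 + ((x - x0) / eta) ^+ 2 <= M.
  move=> /andP[x1 x2]; rewrite lerD2l -[leLHS]real_normK ?num_real// lerXn2r ?nnegrE ?(ltW Y0)//.
  rewrite normrM [`|eta^-1|]gtr0_norm ?invr_gt0// ler_wpM2r ?invr_ge0 ?(ltW eta0)//.
  rewrite ler_norml; apply/andP; split; lra.
have inS x : x0 - X <= x <= x0 + X -> upper_box eps X2 (x +i* eps).
  move=> /andP[x1 x2]; split=> //=.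
  have -> : x +i* eps = (x0 +i* eps) + (x - x0)%:C by apply: complexP => /=; ring.
  apply: le_trans (cnormD _ _) _; rewrite /X2 -addrA lerD2l cnorm_real.
  have : `|x - x0| <= X by rewrite ler_norml; apply/andP; split; lra.
  have : 0 < eta * M by rewrite mulr_gt0.
  lra.
pose g x := f (x +i* eps).
have cg : ccont (x0 - X) (x0 + X) g.
  apply: (@ccont_lip _ _ _ _ L) => x y xX yX; apply: le_trans (hL _ _ (inS x xX) (inS y yX)) _.
  have -> : x +i* eps - y +i* eps = (x - y)%:C by apply: complexP => /=; ring.
  by rewrite cnorm_real.
have ig := ccont_int_Re (ccont_normIm cg).
apply: (@le_of_le_add_1sub _ _ (2 / eta * (2 * X * (L * (eta * M))))) => r /andP[r0 r1].
have rr : 0 <= r < 1 by rewrite (ltW r0) r1.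
pose F w := f ((x0 +i* eps) + psi w).
pose X1 := cnorm (x0 +i* eps) + 2 * eta / (1 - r).
have hF : qhol [set w | cnorm w <= r] F.
  apply: (@qhol_comp _ _ (upper_box eps X1) f (fun w => (x0 +i* eps) + psi w)).
  - move=> w /= wr; split.
      by rewrite cImD/= lerDl Im_psi_ge0// (le_lt_trans wr).
    by apply: le_trans (cnormD _ _) _; rewrite lerD2l; have [] := cnorm_psi_le rr wr.
  - exact: hf.
  - by apply: qholD; [exact: qhol_cst|exact: qhol_psi].
have mean := circle_mean r0 hF.
have F0 : F 0 = f (x0 +i* (eps + eta)).
  rewrite /F /psi addr0 subr0 divr1 mulr1; congr f.
  by apply: complexP => /=; ring.
have cF (a b : R) : ccont a b (fun t => F (circle r t)).
  by apply: (ccont_qhol_circle (ltW r0) _ hF).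
pose h t := complex.Im (F (circle r t)).
have ch (a b : R) : {within `[a, b], continuous h} by exact: ccont_Im (cF a b).
have hK t : `|h t| <= K.
  have c1 : cnorm (circle r t) < 1 by rewrite cnorm_circle ?ltW.
  apply: (fK ((x0 +i* eps) + psi (circle r t))).
  by rewrite cImD -[complex.Im (_ +i* _)]/eps; have := Im_psi_ge0 c1; lra.
have E : \int[mu]_(t in `[0, 2 * pi]) h t = 2 * pi * complex.Im (f (x0 +i* (eps + eta))).
  have := congr1 (@complex.Im R) mean; rewrite F0 /= => ->.
  by rewrite cImM/= mul0r addr0.
have t1 : 0 <= th (x0 - X).
  by rewrite /th; have := atan_gtNpi2 ((x0 - X - x0) / eta); lra.
have t2 : th (x0 + X) <= 2 * pi.
  by rewrite /th; have := atan_ltpi2 ((x0 + X - x0) / eta); lra.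
have t3 : th (x0 - X) <= th (x0 + X) by apply/ltW/th_homo; lra.
(* The arc functions are odd around [pi], hence the two end arcs have the same length. *)
have t4 : 2 * pi - th (x0 + X) = th (x0 - X).
  rewrite /th; have -> : (x0 - X - x0) / eta = - ((x0 + X - x0) / eta) by ring.
  by rewrite atanN; ring.
have pi2 : 0 < 2 * pi :> R by rewrite mulr_gt0 ?pi_gt0.
rewrite -(gtr0_norm pi2) -normrM -E.
rewrite (Rintegral_split t1 (le_trans t3 t2))//.
rewrite (Rintegral_split t3 t2)//.
have b1 := normr_Rintegral_le t1 (ch _ _) (fun t _ => hK t).
have b2 := normr_Rintegral_le t2 (ch _ _) (fun t _ => hK t).
rewrite t4 in b2; rewrite subr0 in b1.
have xX : x0 - X <= x0 + X by lra.
rewrite (Rintegral_th xX (ch _ _)).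
suff b3 : `|\int[mu]_(x in `[x0 - X, x0 + X]) (h (th x) * th' x)| <=
    2 / eta * \int[mu]_(x in `[x0 - X, x0 + X]) `|complex.Im (f (x +i* eps))| +
    2 / eta * (2 * X * (L * (eta * M))) * (1 - r).
  apply: le_trans (ler_normD _ _) _.
  have := ler_normD (\int[mu]_(x in `[x0 - X, x0 + X]) (h (th x) * th' x))
    (\int[mu]_(t in `[th (x0 + X), 2 * pi]) h t).
  have ar (x1 x2 x3 s p q k t : R) : x1 <= k * t -> x2 <= k * t -> x3 <= p + q ->
    s <= x3 + x2 -> x1 + s <= 2 * k * t + p + q by lra.
  exact: (ar _ _ _ _ _ _ _ _ b1 b2 b3).
have cht : ccont (x0 - X) (x0 + X) (fun x => F (circle r (th x))).
  have [L1 hL1] := qhol_lip hF.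
  apply: (@ccont_comp_real th (fun t => F (circle r t)) (`|L1| * (2 * `|r|))).
    exact: th_cont.
  move=> x y; apply: le_trans (hL1 _ _ _ _) _; rewrite /= ?cnorm_circle ?(ltW r0)//.
  apply: le_trans (_ : `|L1| * cnorm (circle r x - circle r y) <= _).
    by rewrite ler_wpM2r ?cnorm_ge0 ?ler_norm.
  by rewrite -mulrA ler_wpM2l// circle_lip.
have cp : ccont (x0 - X) (x0 + X) (fun x => (h (th x) * th' x)%:C).
  apply: (eq_ccont _ (ccontM (ccont_ImC cht) (ccont_real th'_cont))) => t _.
  by rewrite -rmorphM.
(* Bounds the change of [f] between the image of the arc and the segment: the Lipschitz constant
   times the distance from [psi_th]. *)
pose B := L * (eta * M) * (1 - r).
have cq : ccont (x0 - X) (x0 + X) (fun x => (2 / eta * `|complex.Im (g x)| + 2 / eta * B)%:C).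
  apply: (eq_ccont _ (ccontD (ccont_mull (2 / eta)%:C (ccont_normIm cg)) (ccont_cst (2 / eta * B)%:C))) => t _.
  by apply: complexP => /=; ring.
apply: le_trans (le_normr_Rintegral _ (ccont_int_Re cp)) _ => //.
have -> : 2 / eta * \int[mu]_(x in `[x0 - X, x0 + X]) `|complex.Im (f (x +i* eps))| +
    2 / eta * (2 * X * (L * (eta * M))) * (1 - r) =
   \int[mu]_(x in `[x0 - X, x0 + X]) (2 / eta * `|complex.Im (g x)| + 2 / eta * B).
  rewrite RintegralD//.
  - rewrite RintegralZl// Rintegral_cst//= lebesgue_measure_itv/= lte_fin.
    rewrite ifT /=; last lra.
    by congr (_ + _); rewrite /B; ring.
  - have := ccont_int_Re (ccont_mull (2 / eta)%:C (ccont_normIm cg)).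
    by apply: eq_integrable => // t _ /=; rewrite mul0r subr0.
  - exact: (ccont_int_Re (ccont_cst (2 / eta * B)%:C)).
apply: le_Rintegral => //; first exact: integrable_norm (ccont_int_Re cp).
  exact: ccont_int_Re cq.
move=> x /=; rewrite in_itv/= => xx.
have /andP[p0 p1] := th'_le x.
rewrite normrM (ger0_norm p0) -mulrDr mulrC ler_pM//.
have := psi_th x rr => hpsi.
have hy := yM x xx.
have r1' : 0 < 1 - r by lra.
have d1 : cnorm (psi (circle r (th x)) - (x - x0)%:C) <= eta * M * (1 - r).
  apply: le_trans hpsi _; rewrite -!mulrA ler_wpM2l ?(ltW eta0)// mulrC.
  by rewrite ler_wpM2r ?(ltW r1').
have S1 : upper_box eps X2 ((x0 +i* eps) + psi (circle r (th x))).
  split.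
    have c1 : cnorm (circle r (th x)) < 1 by rewrite cnorm_circle ?ltW.
    by rewrite cImD -[complex.Im (_ +i* _)]/eps lerDl Im_psi_ge0.
  apply: le_trans (cnormD _ _) _; rewrite /X2 -addrA lerD2l.
  rewrite -[psi _](subrK (x - x0)%:C); apply: le_trans (cnormD _ _) _.
  rewrite cnorm_real addrC; apply: lerD.
    apply: le_trans d1 _; rewrite ler_piMr//; [exact: ltW (mulr_gt0 eta0 M0)|lra].
  by rewrite ler_norml; move: xx => /andP[? ?]; apply/andP; split; lra.
have hlip := hL _ _ S1 (inS x xx).
have eqd : (x0 +i* eps) + psi (circle r (th x)) - (x +i* eps) =
   psi (circle r (th x)) - (x - x0)%:C.
  by case: (psi _) => p q; apply: complexP => /=; ring.
rewrite eqd in hlip.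
have -> : h (th x) = complex.Im (g x) + complex.Im (F (circle r (th x)) - g x).
  by rewrite /h !ReImE; ring.
apply: le_trans (ler_normD _ _) _; rewrite lerD2l.
apply: le_trans (normIm_le _) _; apply: le_trans hlip _.
by rewrite /B -mulrA ler_wpM2l.
Qed.

End Poisson.

(** In [poisson_bound] at height [1 / (n + 1)] the integral tends to 0 by dominated convergence,
    with [K] as the dominating constant, and the left side tends to its value at [eps = 0]. There
    remains the contribution of the end arcs, which a large [X] makes arbitrarily small. *)
Theorem boundary_Im_zero (f : R[i] -> R[i]) (K : R) : holU f ->
  (forall z, 0 < complex.Im z -> `|complex.Im (f z)| <= K) ->
  (\forall x \ae mu, complex.Im (f (x +i* n.+1%:R^-1)) @[n --> \oo] --> 0) ->
  forall z, 0 < complex.Im z -> complex.Im (f z) = 0.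
Proof.
move=> hf fK ae0 [x0 eta] /= eta0.
have K0 : 0 <= K by apply: le_trans (fK 'i _) => //=.

set u := complex.Im _.
have key d : 0 < d < 1 -> 2 * pi * `|u| <= 2 * K * d.
  move=> /andP[d0 d1]; have pi2 := pi_ge2 R.
  (* The solution of [th (x0 - X) = d], so that the end arcs have length [d]. *)
  pose X := eta * tan (pi / 2 - d / 2).
  have ra : pi / 2 - d / 2 \in `](- (pi / 2)), (pi / 2)[ by rewrite in_itv/=; apply/andP; split; lra.
  have X0 : 0 < X.
    rewrite mulr_gt0// -(@tan0 R) ltr_tan//; first lra.
    by rewrite in_itv/=; apply/andP; split; lra.
  have thX : pi + 2 * atan ((x0 - X - x0) / eta) = d.
    have -> : (x0 - X - x0) / eta = - tan (pi / 2 - d / 2).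
      by rewrite /X; field; rewrite gt_eqF.
    rewrite atanN tanK//; lra.
  pose D : set R := `[x0 - X, x0 + X]%classic.
  pose F n (x : R) := (`|complex.Im (f (x +i* n.+1%:R^-1))|)%:E.
  have n0 n : 0 < n.+1%:R^-1 :> R by rewrite invr_gt0 ltr0n.
  have iF n : mu.-integrable D (F n).
    have [L hL] := qhol_lip (hf n.+1%:R^-1 (`|x0| + X + 1) (n0 n)).
    suff cg : ccont (x0 - X) (x0 + X) (fun x => f (x +i* n.+1%:R^-1)).
      exact: (ccont_int_Re (ccont_normIm cg)).
    have inS x : x0 - X <= x <= x0 + X -> upper_box n.+1%:R^-1 (`|x0| + X + 1) (x +i* n.+1%:R^-1).
      move=> /andP[x1 x2]; split=> //=; apply: le_trans (cnorm_le_ReIm _) _ => /=.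
      apply: lerD; last by rewrite gtr0_norm// invf_le1 ?ler1n ?ltr0n.
      have := ler_norm x0; have := ler_norm (- x0); rewrite normrN => h1 h2.
      by rewrite ler_norml; apply/andP; split; lra.
    apply: (@ccont_lip _ _ _ _ L) => x y xX yX; apply: le_trans (hL _ _ (inS x xX) (inS y yX)) _.
    have -> : x +i* n.+1%:R^-1 - y +i* n.+1%:R^-1 = (x - y)%:C by apply: complexP => /=; ring.
    by rewrite cnorm_real.
  have I0 : (\int[mu]_(x in D) F n x)%E @[n --> \oo] --> 0%E.
    have := @dominated_convergence _ _ R mu D _ F (cst 0%E) (cst K%:E).
    case=> //.
    - exact: measurable_itv.
    - by move=> n; exact: measurable_int (iF n).
    - apply: ae_mono ae0 => x hx _; rewrite /F.
      apply: cvg_EFin; first by near=> n.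
      rewrite -(@normr0 _ R); exact: cvg_norm hx.
    - exact: (ccont_int_Re (ccont_cst K%:C)).
    - apply: aeW => x n _; rewrite /F /= lee_fin normr_id; apply: fK => /=; exact: n0.
    by move=> _ _; rewrite integral0.
  have I1 : \int[mu]_(x in D) `|complex.Im (f (x +i* n.+1%:R^-1))| @[n --> \oo] --> 0.
    exact: (fine_cvg I0).
  have uc : 2 * pi * `|complex.Im (f (x0 +i* (n.+1%:R^-1 + eta)))| @[n --> \oo] --> 2 * pi * `|u|.
    apply: cvgM; first exact: cvg_cst.
    apply: cvg_norm.
    have [L hL] := qhol_lip (hf eta (`|x0| + eta + 1) eta0).
    apply/cvgrPdist_lt => e e0.
    have L1 : 0 < `|L| + 1 by rewrite ltr_wpDl.
    have nL : \forall n \near \oo, n.+1%:R^-1 < e / (`|L| + 1) :> R.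
      have h0 : 0 < e / (`|L| + 1) by rewrite divr_gt0.
      exact: (near_infty_natSinv_lt (PosNum h0)).
    apply: filterS nL => n hn.
    have S1 : upper_box eta (`|x0| + eta + 1) (x0 +i* eta).
      split=> //=; apply: le_trans (cnorm_le_ReIm _) _ => /=; rewrite (gtr0_norm eta0); lra.
    have S2 : upper_box eta (`|x0| + eta + 1) (x0 +i* (n.+1%:R^-1 + eta)).
      have h := n0 n; have h1 : n.+1%:R^-1 <= 1 :> R by rewrite invf_le1 ?ler1n ?ltr0n.
      move: (n.+1%:R^-1 : R) h h1 => q h h1.
      split=> /=; first lra.
      apply: le_trans (cnorm_le_ReIm _) _ => /=; rewrite (@gtr0_norm _ (_ + _)); lra.
    have := hL _ _ S1 S2; rewrite -cImN -cImD => hh.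
    apply: le_lt_trans (normIm_le _) _; apply: le_lt_trans hh _.
    have -> : x0 +i* eta - x0 +i* (n.+1%:R^-1 + eta) = - ('i * (n.+1%:R^-1)%:C).
      by apply: complexP; rewrite !ReImE/=; ring.
    rewrite cnormN cnormM cnorm_i mul1r cnorm_real gtr0_norm//.
    move: hn (n0 n); set q := n.+1%:R^-1; rewrite ltr_pdivlMr// => qe q0.
    by apply: le_lt_trans qe; rewrite mulrC ler_wpM2l ?ltW//; have := ler_norm L; lra.
  have rc : 2 * K * d + 2 / eta * \int[mu]_(x in D) `|complex.Im (f (x +i* n.+1%:R^-1))|
      @[n --> \oo] --> 2 * K * d + 2 / eta * 0.
    apply: cvgD; first exact: cvg_cst.
    by apply: cvgM => //; exact: cvg_cst.
  rewrite mulr0 addr0 in rc; apply: (ler_cvg_to uc rc).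
  by near=> n; have := poisson_bound x0 eta0 hf (n0 n) X0 fK; rewrite thX.
apply/eqP; rewrite -normr_le0; apply/ler_addgt0Pl => e e0; rewrite addr0.
have K1 : 0 < K + 1 by lra.
pose d := Num.min 2^-1 (e / (K + 1)).
have d0 : 0 < d by rewrite lt_min divr_gt0// invr_gt0 ltr0n.
have d1 : d <= 2^-1 by rewrite ge_min lexx.
have de : d * (K + 1) <= e by rewrite -ler_pdivlMr// ge_min lexx orbT.
have /key : 0 < d < 1 by apply/andP; split; lra.
have := pi_ge2 R; have := normr_ge0 u; nra.
Unshelve. all: by end_near. Qed.

End HalfPlane.

(** * Matrices as sesquilinear forms *)

Section Vectors.
Variables (R : realType) (m : nat).
Implicit Types (u v w : 'cV[R[i]]_m) (M N : 'M[R[i]]_m) (c : R[i]).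

Definition dotc u v : R[i] := (adjmx u *m v) 0 0.

Lemma dotcE u v : dotc u v = \sum_i conjc (u i 0) * v i 0.
Proof. by rewrite /dotc mxE; apply: eq_bigr => i _; rewrite !mxE. Qed.

Lemma dotcDr u v w : dotc u (v + w) = dotc u v + dotc u w.
Proof. by rewrite /dotc mulmxDr mxE. Qed.

Lemma dotcZr u v c : dotc u (c *: v) = c * dotc u v.
Proof. by rewrite /dotc -scalemxAr mxE. Qed.

Lemma dotcC u v : dotc v u = conjc (dotc u v).
Proof.
rewrite !dotcE rmorph_sum; apply: eq_bigr => i _.
by rewrite rmorphM/= conjcK mulrC.
Qed.

Lemma dotcDl u v w : dotc (u + v) w = dotc u w + dotc v w.
Proof. by rewrite dotcC dotcDr rmorphD/= -!dotcC. Qed.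

Lemma dotcZl u v c : dotc (c *: u) v = conjc c * dotc u v.
Proof. by rewrite dotcC dotcZr rmorphM/= -dotcC. Qed.

Lemma dotcNr u v : dotc u (- v) = - dotc u v.
Proof. by rewrite -scaleN1r dotcZr mulN1r. Qed.

Lemma dotcNl u v : dotc (- u) v = - dotc u v.
Proof. by rewrite dotcC dotcNr rmorphN/= -dotcC. Qed.

Lemma dotcBr u v w : dotc u (v - w) = dotc u v - dotc u w.
Proof. by rewrite dotcDr dotcNr. Qed.

Lemma dotcBl u v w : dotc (u - v) w = dotc u w - dotc v w.
Proof. by rewrite dotcDl dotcNl. Qed.

Lemma dotc0r u : dotc u 0 = 0.
Proof. by rewrite -(scale0r 0) dotcZr mul0r. Qed.

Lemma dotc0l u : dotc 0 u = 0.
Proof. by rewrite dotcC dotc0r rmorph0. Qed.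

Lemma adjmxM p q r (M : 'M[R[i]]_(p, q)) (N : 'M[R[i]]_(q, r)) :
  adjmx (M *m N) = adjmx N *m adjmx M.
Proof. by rewrite /adjmx trmx_mul map_mxM. Qed.

Lemma adjmxK p q (M : 'M[R[i]]_(p, q)) : adjmx (adjmx M) = M.
Proof. by apply/matrixP => i j; rewrite !mxE conjcK. Qed.

Lemma dotc_adj u v M : dotc u (M *m v) = dotc (adjmx M *m u) v.
Proof. by rewrite /dotc adjmxM adjmxK mulmxA. Qed.

Lemma dotc_selfadj u v M : selfadjmx M -> dotc u (M *m v) = dotc (M *m u) v.
Proof. by move=> hM; rewrite dotc_adj hM. Qed.

Lemma vnorm_sqr v : vnorm v ^+ 2 = \sum_i cnorm (v i 0) ^+ 2.
Proof.
rewrite /vnorm sqr_sqrtr; first by apply: eq_bigr => i _; rewrite cnorm_sqr.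
by apply: sumr_ge0 => i _; rewrite addr_ge0 ?sqr_ge0.
Qed.

Lemma dotcc v : dotc v v = (vnorm v ^+ 2)%:C.
Proof.
rewrite vnorm_sqr dotcE rmorph_sum; apply: eq_bigr => i _.
by rewrite mulrC mulcc.
Qed.

Lemma vnorm_ge0 v : 0 <= vnorm v.
Proof. exact: sqrtr_ge0. Qed.

Lemma vnorm_eq0 v : (vnorm v == 0) = (v == 0).
Proof.
apply/eqP/eqP => [v0|->].
  apply/matrixP => i j; rewrite (ord1 j) mxE; apply/eqP; rewrite -cnorm_eq0.
  have : \sum_i cnorm (v i 0) ^+ 2 == 0 by rewrite -vnorm_sqr v0 expr0n.
  rewrite psumr_eq0 => [/allP/(_ i)|k _]; last exact: sqr_ge0.
  by rewrite mem_index_enum sqrf_eq0 => /(_ isT).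
rewrite /vnorm big1 ?sqrtr0// => i _; rewrite mxE/= expr0n addr0 //.
Qed.

Lemma vnorm0 : vnorm (0 : 'cV[R[i]]_m) = 0.
Proof. by apply/eqP; rewrite vnorm_eq0. Qed.

Lemma vnorm_gt0 v : (0 < vnorm v) = (v != 0).
Proof. by rewrite lt_def vnorm_ge0 vnorm_eq0 andbT. Qed.

Lemma vnormZ c v : vnorm (c *: v) = cnorm c * vnorm v.
Proof.
apply/eqP; rewrite -(@eqrXn2 _ 2)// ?mulr_ge0 ?cnorm_ge0 ?vnorm_ge0//.
rewrite exprMn !vnorm_sqr mulr_sumr; apply/eqP/eq_bigr => i _.
by rewrite mxE cnormM exprMn.
Qed.

Lemma vnormN v : vnorm (- v) = vnorm v.
Proof. by rewrite -scaleN1r vnormZ cnormN cnorm1 mul1r. Qed.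

Lemma cauchy_schwarz u v : cnorm (dotc u v) <= vnorm u * vnorm v.
Proof.
have [->|v0] := eqVneq v 0; first by rewrite dotc0r cnorm0 mulr_ge0 ?vnorm_ge0.
have b0 : 0 < vnorm v by rewrite vnorm_gt0.
rewrite -(@ler_pXn2r _ 2) ?nnegrE ?mulr_ge0 ?cnorm_ge0 ?vnorm_ge0//.
pose b := vnorm v ^+ 2; have bp : 0 < b by rewrite exprn_gt0.
pose w := b%:C *: u - dotc v u *: v.
have : (vnorm w ^+ 2)%:C = (b * (b * vnorm u ^+ 2 - cnorm (dotc u v) ^+ 2))%:C.
  rewrite -dotcc /w dotcBl !dotcBr !dotcZl !dotcZr !dotcc -/b (dotcC u v) conjcK.
  have -> : (b * (b * vnorm u ^+ 2 - cnorm (dotc u v) ^+ 2))%:C =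
    b%:C * (b%:C * (vnorm u ^+ 2)%:C - dotc u v * conjc (dotc u v)).
    by rewrite mulcc; apply: complexP => /=; ring.
  have -> : conjc b%:C = b%:C by apply: complexP => //=; rewrite oppr0.
  ring.
move=> /(@complexI R) h; have := sqr_ge0 (vnorm w); rewrite h pmulr_rge0// subr_ge0.
by rewrite exprMn mulrC.
Qed.

Lemma vnormD u v : vnorm (u + v) <= vnorm u + vnorm v.
Proof.
rewrite -(@ler_pXn2r _ 2) ?nnegrE ?addr_ge0 ?vnorm_ge0//.
have : (vnorm (u + v) ^+ 2)%:C =
    (vnorm u ^+ 2 + vnorm v ^+ 2 + 2 * complex.Re (dotc u v))%:C.
  rewrite -dotcc dotcDl !dotcDr !dotcc (dotcC u v).
  by apply: complexP; rewrite !ReImE/=; ring.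
move=> /(@complexI R) ->; rewrite sqrrD.
have := normRe_le (dotc u v); have := cauchy_schwarz u v.
have := ler_norm (complex.Re (dotc u v)); rewrite mulr2n; lra.
Qed.

Lemma vnormB u v : vnorm (u - v) <= vnorm u + vnorm v.
Proof. by rewrite -(vnormN v) vnormD. Qed.

Lemma vnorm_sqrD u v : vnorm (u + v) ^+ 2 <= 2 * vnorm u ^+ 2 + 2 * vnorm v ^+ 2.
Proof.
have := vnormD u v; have := vnorm_ge0 (u + v); set a := vnorm (u + v) => a0 h.
have : a ^+ 2 <= (vnorm u + vnorm v) ^+ 2 by rewrite lerXn2r ?nnegrE// (le_trans a0).
have := sqr_ge0 (vnorm u - vnorm v); rewrite sqrrB sqrrD !mulr2n; lra.
Qed.

Lemma vnorm_sum (I : Type) (s : seq I) (P : pred I) (F : I -> 'cV[R[i]]_m) :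
  vnorm (\sum_(k <- s | P k) F k) <= \sum_(k <- s | P k) vnorm (F k).
Proof.
elim/big_rec2: _ => [|k c z _ h]; first by rewrite vnorm0.
by apply: le_trans (vnormD _ _) _; rewrite lerD2l.
Qed.

Lemma cnorm_coord v i : cnorm (v i 0) <= vnorm v.
Proof.
rewrite -(@ler_pXn2r _ 2) ?nnegrE ?cnorm_ge0 ?vnorm_ge0// vnorm_sqr (bigD1 i)//=.
by rewrite lerDl sumr_ge0// => k _; rewrite sqr_ge0.
Qed.

Lemma vnorm_le_coord v : vnorm v <= \sum_i cnorm (v i 0).
Proof.
have s0 : 0 <= \sum_i cnorm (v i 0) by apply: sumr_ge0 => i _; exact: cnorm_ge0.
rewrite -(@ler_pXn2r _ 2) ?nnegrE ?vnorm_ge0// vnorm_sqr.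
rewrite expr2 mulr_suml; apply: ler_sum => i _.
by rewrite expr2 ler_wpM2l ?cnorm_ge0// (bigD1 i)//= lerDl sumr_ge0// => k _; exact: cnorm_ge0.
Qed.

Lemma vnorm_delta (j : 'I_m) : vnorm (delta_mx j 0 : 'cV[R[i]]_m) = 1.
Proof.
apply/eqP; rewrite -(@eqrXn2 _ 2)// ?vnorm_ge0// vnorm_sqr (bigD1 j)//= mxE !eqxx.
rewrite cnorm1 big1 ?addr0// => k kj; rewrite mxE (negbTE kj)/= cnorm0 expr0n//.
Qed.

(** An upper bound for the operator norm as a predicate: explicit constants compose without
    reference to a supremum. *)
Definition mbound M (K : R) := forall v, vnorm (M *m v) <= K * vnorm v.

Lemma mbound_entries M : mbound M (\sum_i \sum_j cnorm (M i j)).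
Proof.
move=> v; apply: le_trans (vnorm_le_coord _) _.
rewrite mulr_suml; apply: ler_sum => i _; rewrite mxE.
apply: le_trans (cnorm_sum _ _ _) _; rewrite mulr_suml; apply: ler_sum => j _.
by rewrite cnormM ler_wpM2l ?cnorm_ge0// cnorm_coord.
Qed.

Lemma mbound_exists M : exists2 K, 0 <= K & mbound M K.
Proof.
exists (\sum_i \sum_j cnorm (M i j)); last exact: mbound_entries.
by apply: sumr_ge0 => i _; apply: sumr_ge0 => j _; exact: cnorm_ge0.
Qed.

Lemma mbound_entry M K i j : mbound M K -> cnorm (M i j) <= K.
Proof.
move=> /(_ (delta_mx j 0)); rewrite vnorm_delta mulr1; apply: le_trans.
by have := cnorm_coord (M *m delta_mx j 0) i; rewrite -colE mxE.
Qed.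

Lemma dotc_bound u v M K : mbound M K -> cnorm (dotc u (M *m v)) <= K * (vnorm u * vnorm v).
Proof.
move=> hM; apply: le_trans (cauchy_schwarz _ _) _.
by rewrite mulrCA ler_wpM2l ?vnorm_ge0.
Qed.

Lemma unitmx_inj M : (forall v, M *m v = 0 -> v = 0) -> M \in unitmx.
Proof.
move=> h; rewrite -unitmx_tr -row_free_unit -kermx_eq0; apply/eqP/row_matrixP => i.
rewrite row0; apply: (can_inj (@trmxK _ _ _)); rewrite trmx0; apply: h.
apply: (can_inj (@trmxK _ _ _)); rewrite trmx_mul trmxK trmx0.
by apply/sub_kermxP; exact: row_sub.
Qed.

Lemma unitmx_lower M (t : R) : 0 < t -> (forall v, t * vnorm v <= vnorm (M *m v)) ->
  M \in unitmx.
Proof.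
move=> t0 h; apply: unitmx_inj => v Mv; apply/eqP; rewrite -vnorm_eq0.
have := h v; rewrite Mv vnorm0 pmulr_rle0// => v0.
by rewrite eq_le v0 vnorm_ge0.
Qed.

Lemma mbound_inv M (t : R) : 0 < t -> (forall v, t * vnorm v <= vnorm (M *m v)) ->
  mbound (invmx M) t^-1.
Proof.
move=> t0 h v; have uM := unitmx_lower t0 h.
by rewrite ler_pdivlMl//; apply: le_trans (h _) _; rewrite mulKVmx.
Qed.

Lemma lower_Re M (t : R) : (forall v, t * vnorm v ^+ 2 <= complex.Re (dotc v (M *m v))) ->
  forall v, t * vnorm v <= vnorm (M *m v).
Proof.
move=> h v; have [->|v0] := eqVneq v 0; first by rewrite mulmx0 vnorm0 mulr0.
have n0 : 0 < vnorm v by rewrite vnorm_gt0.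
rewrite -(ler_pM2r n0) -mulrA -expr2; apply: le_trans (h v) _.
apply: le_trans (ler_norm _) _; apply: le_trans (normRe_le _) _.
by apply: le_trans (cauchy_schwarz _ _) _; rewrite mulrC.
Qed.

(** Polarization with [u + v] and [u + 'i *: v]: over the complex numbers a form that vanishes on
    the diagonal vanishes everywhere. *)
Lemma dotc_polar M : (forall v, dotc v (M *m v) = 0) -> M = 0.
Proof.
move=> h; have h2 u v : dotc u (M *m v) = 0.
  have e1 := h (u + v); have e2 := h (u + 'i *: v).
  rewrite mulmxDr dotcDl !dotcDr !h add0r addr0 in e1.
  rewrite mulmxDr -scalemxAr dotcDl !dotcDr !dotcZl !dotcZr !h !mulr0 add0r addr0 in e2.
  have i2 : 'i * 'i = -1 :> R[i] by rewrite -expr2 sqr_i.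
  have ci : conjc ('i : R[i]) = - 'i by apply: complexP; rewrite !ReImE/= ?oppr0.
  have e3 : 'i * (dotc u (M *m v) - dotc v (M *m u)) = 0 by rewrite -[RHS]e2 ci; ring.
  have i0 : 'i != 0 :> R[i] by rewrite -cnorm_gt0 cnorm_i.
  move/eqP: e3; rewrite mulf_eq0 (negbTE i0)/= subr_eq0 => /eqP e3.
  move: e1; rewrite -e3 -mulr2n => /eqP; rewrite mulrn_eq0 => /eqP//.
apply/matrixP => i j; rewrite mxE.
have := h2 (delta_mx i 0) (delta_mx j 0); rewrite -colE dotcE (bigD1 i)//= !mxE !eqxx/=.
rewrite big1 ?addr0; first by rewrite oppr0 mul1r.
by move=> k ki; rewrite !mxE (negbTE ki)/= oppr0 mul0r.
Qed.

End Vectors.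

(** * The principal logarithm of a matrix *)

Section MatrixLog.
Variables (R : realType) (m : nat).
Implicit Types (M N X : 'M[R[i]]_m) (u v : 'cV[R[i]]_m) (s t K : R).

Lemma mboundM M N K t : 0 <= K -> mbound M K -> mbound N t -> mbound (M *m N) (K * t).
Proof.
move=> K0 hM hN v; rewrite -mulmxA; apply: le_trans (hM _) _.
by rewrite -mulrA ler_wpM2l.
Qed.

Lemma mboundD M N K t : mbound M K -> mbound N t -> mbound (M + N) (K + t).
Proof.
move=> hM hN v; rewrite mulmxDl mulrDl; apply: le_trans (vnormD _ _) _.
exact: lerD.
Qed.

Lemma mboundZ M K (c : R[i]) : mbound M K -> mbound (c *: M) (cnorm c * K).
Proof.
by move=> hM v; rewrite -scalemxAl vnormZ -mulrA ler_wpM2l ?cnorm_ge0.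
Qed.

Lemma mboundN M K : mbound M K -> mbound (- M) K.
Proof. by move=> hM v; rewrite mulNmx vnormN. Qed.

Lemma mbound1 : mbound (1%:M : 'M[R[i]]_m) 1.
Proof. by move=> v; rewrite mul1mx mul1r. Qed.

Lemma mbound_le M K t : K <= t -> mbound M K -> mbound M t.
Proof.
by move=> Kt hM v; apply: le_trans (hM v) _; rewrite ler_wpM2r ?vnorm_ge0.
Qed.

Definition mccont (F : R -> 'M[R[i]]_m) := forall i j, ccont 0 1 (fun s => F s i j).

Definition mint (F : R -> 'M[R[i]]_m) : 'M[R[i]]_m :=
  \matrix_(i, j) cintegral 0 1 (fun s => F s i j).

Lemma mccontM F G : mccont F -> mccont G -> mccont (fun s => F s *m G s).
Proof.
move=> hF hG i j; apply: (eq_ccont _ (ccont_sum _ (F := fun k s => F s i k * G s k j) _)).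
  by move=> t _; rewrite mxE.
by move=> k _; apply: ccontM.
Qed.

Lemma mccont_cst M : mccont (fun=> M).
Proof. by move=> i j; exact: ccont_cst. Qed.

Lemma mccontD F G : mccont F -> mccont G -> mccont (fun s => F s + G s).
Proof.
move=> hF hG i j; apply: (eq_ccont _ (ccontD (hF i j) (hG i j))).
by move=> t _; rewrite mxE.
Qed.

Lemma mccontZ F (c : R -> R[i]) : ccont 0 1 c -> mccont F -> mccont (fun s => c s *: F s).
Proof.
move=> hc hF i j; apply: (eq_ccont _ (ccontM hc (hF i j))).
by move=> t _; rewrite mxE.
Qed.

Lemma mccontN F : mccont F -> mccont (fun s => - F s).
Proof.
by move=> hF i j; apply: (eq_ccont _ (ccontN (hF i j))) => t _; rewrite mxE.
Qed.

Lemma mintB F G : mccont F -> mccont G -> mint (fun s => F s - G s) = mint F - mint G.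
Proof.
move=> hF hG; apply/matrixP => i j; rewrite !mxE -cintegralB//.
by apply: eq_cintegral => t _; rewrite !mxE.
Qed.

Lemma mint_mulr F M : mccont F -> mint (fun s => F s *m M) = mint F *m M.
Proof.
move=> hF; apply/matrixP => i j; rewrite !mxE.
under [RHS]eq_bigr do rewrite mxE mulrC -cintegralZ//.
rewrite -cintegral_sum//; last by move=> k; apply: ccont_mull.
by apply: eq_cintegral => t _; rewrite mxE; apply: eq_bigr => k _; rewrite mulrC.
Qed.

Lemma eq_mint F G : (forall s, 0 <= s <= 1 -> F s = G s) -> mint F = mint G.
Proof.
by move=> FG; apply/matrixP => i j; rewrite !mxE; apply: eq_cintegral => t /FG ->.
Qed.

Lemma ccont_dotc F u v : mccont F -> ccont 0 1 (fun s => dotc u (F s *m v)).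
Proof.
move=> hF; apply: (eq_ccont _ (ccont_sum _ (F := fun i s =>
   conjc (u i 0) * \sum_j F s i j * v j 0) _)).
  by move=> t _; rewrite dotcE; apply: eq_bigr => i _; rewrite mxE.
move=> i _; apply: ccont_mull; apply: ccont_sum => j _.
by apply: ccontM => //; exact: ccont_cst.
Qed.

Lemma dotc_mint F u v : mccont F ->
  dotc u (mint F *m v) = cintegral 0 1 (fun s => dotc u (F s *m v)).
Proof.
move=> hF; rewrite dotcE.
have h1 i : (mint F *m v) i 0 = cintegral 0 1 (fun s => (F s *m v) i 0).
  rewrite mxE; under eq_bigr do rewrite mxE mulrC -cintegralZ//.
  rewrite -cintegral_sum//; last by move=> k; apply: ccont_mull.
  by apply: eq_cintegral => t _; rewrite mxE; apply: eq_bigr => k _; rewrite mulrC.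
have c1 i : ccont 0 1 (fun s => (F s *m v) i 0).
  apply: (eq_ccont _ (ccont_sum _ (F := fun j s => F s i j * v j 0) _)).
    by move=> t _; rewrite mxE.
  by move=> j _; apply: ccontM => //; exact: ccont_cst.
under eq_bigr do rewrite h1 -cintegralZ//.
rewrite -cintegral_sum//; last by move=> k; apply: ccont_mull.
by apply: eq_cintegral => t _; rewrite dotcE.
Qed.

Lemma dotc_mint_le F u v K : mccont F ->
  (forall s, 0 <= s <= 1 -> mbound (F s) K) ->
  cnorm (dotc u (mint F *m v)) <= 2 * (K * (vnorm u * vnorm v)).
Proof.
move=> hF hK; rewrite dotc_mint//.
have -> : 2 * (K * (vnorm u * vnorm v)) = 2 * (1 - 0) * (K * (vnorm u * vnorm v)).
  by rewrite subr0 mulr1.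
apply: cintegral_le_cst => //; first exact: ccont_dotc.
by move=> s /hK h; exact: dotc_bound.
Qed.

Definition seg s M : 'M[R[i]]_m := (1 - s)%:C%:M + s%:C *: M.
Definition segT s M : 'M[R[i]]_m := invmx (seg s M).
(** A quantitative way of saying that the segment from the identity to [M] avoids singular matrices:
    [tau^-1] bounds all the inverses at once, and a common [tau] makes estimates uniform over
    families of matrices. *)
Definition seglow M (tau : R) := 0 < tau /\
  forall s, 0 <= s <= 1 -> forall v, tau * vnorm v <= vnorm (seg s M *m v).

(* [Lmx M] is the principal logarithm of [M], as the integral of dw/w along the
   segment from the identity to [M]. *)
Definition Lmx M : 'M[R[i]]_m := mint (fun s => (M - 1%:M) *m segT s M).

Lemma seg_unit M tau s : seglow M tau -> 0 <= s <= 1 -> seg s M \in unitmx.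
Proof. by move=> [t0 h] s01; apply: (unitmx_lower t0); exact: h. Qed.

Lemma segT_bound M tau s : seglow M tau -> 0 <= s <= 1 -> mbound (segT s M) tau^-1.
Proof. by move=> [t0 h] s01; apply: (mbound_inv t0); exact: h. Qed.

Lemma seg_sub M s t : seg t M - seg s M = (t - s)%:C *: (M - 1%:M).
Proof.
by apply/matrixP => i j; rewrite !mxE !(rmorphB, rmorph1)/=; case: (i == j);
  rewrite ?mulr1n ?mulr0n; ring.
Qed.

Lemma seg_subM M N s : seg s M - seg s N = s%:C *: (M - N).
Proof. by apply/matrixP => i j; rewrite !mxE; ring. Qed.

Lemma seg_comm M s : seg s M *m M = M *m seg s M.
Proof.
by rewrite /seg mulmxDl mulmxDr mul_scalar_mx mul_mx_scalar -scalemxAl -scalemxAr.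
Qed.

Lemma invmx_comm M X : X \in unitmx -> X *m M = M *m X -> invmx X *m M = M *m invmx X.
Proof.
move=> uX h; rewrite -[M in LHS](mulmxK uX) -h mulmxA.
by rewrite (mulmxA (invmx X) X) mulVmx// mul1mx.
Qed.

Lemma invmx_sub M N : M \in unitmx -> N \in unitmx ->
  invmx M - invmx N = - (invmx M *m (M - N) *m invmx N).
Proof.
move=> uM uN; rewrite mulmxBr mulVmx// mulmxBl mul1mx mulmxK// opprB //.
Qed.

Lemma segT_sub M tau s t : seglow M tau -> 0 <= s <= 1 -> 0 <= t <= 1 ->
  segT s M - segT t M = (t - s)%:C *: (segT s M *m (M - 1%:M) *m segT t M).
Proof.
move=> h s01 t01; rewrite invmx_sub ?(seg_unit h)// seg_sub.
rewrite -scalemxAr -scalemxAl -scaleNr; congr (_ *: _).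
by rewrite -rmorphN/= opprB.
Qed.

Lemma segT_subM M N tau sig s : seglow M tau -> seglow N sig -> 0 <= s <= 1 ->
  segT s M - segT s N = (- s)%:C *: (segT s M *m (M - N) *m segT s N).
Proof.
move=> h k s01; rewrite invmx_sub ?(seg_unit h) ?(seg_unit k)// seg_subM.
by rewrite -scalemxAr -scalemxAl -scaleNr rmorphN.
Qed.

Lemma mccont_segT M tau : seglow M tau -> mccont (fun s => segT s M).
Proof.
move=> h i j; have [K K0 hK] := mbound_exists (M - 1%:M).
have t0 : 0 <= tau^-1 by rewrite invr_ge0 ltW//; case: h.
apply: (@ccont_lip _ _ _ _ (tau^-1 * K * tau^-1)) => s t s01 t01.
have -> : segT s M i j - segT t M i j = (segT s M - segT t M) i j by rewrite !mxE.
rewrite (segT_sub h)// mxE cnormM cnorm_real mulrC distrC ler_wpM2r//.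
apply: (@mbound_entry _ _ _ _ i j).
apply: mboundM; [by rewrite mulr_ge0| |exact: segT_bound h t01].
by apply: mboundM => //; exact: segT_bound h s01.
Qed.

Lemma mccont_Lmx M tau : seglow M tau -> mccont (fun s => (M - 1%:M) *m segT s M).
Proof. by move=> h; apply: mccontM; [exact: mccont_cst|exact: mccont_segT h]. Qed.

(** Commutation of [M] with [N] plays no part: multiplied by [seg s M] on the left and by [seg s N]
    on the right, both sides become [M - N], once [M - 1] has been moved past [segT s M]. *)
Lemma Lmx_integrand_sub M N tau sig s : seglow M tau -> seglow N sig -> 0 <= s <= 1 ->
  (M - 1%:M) *m segT s M - (N - 1%:M) *m segT s N = segT s M *m (M - N) *m segT s N.
Proof.
move=> h k s01; have uM := seg_unit h s01; have uN := seg_unit k s01.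
have cM : segT s M *m (M - 1%:M) = (M - 1%:M) *m segT s M.
  rewrite mulmxBl mulmxBr mul1mx mulmx1; congr (_ - _).
  by apply: invmx_comm => //; exact: seg_comm.
rewrite -cM; apply: (can_inj (mulmxK uN)); apply: (can_inj (mulKmx uM)).
rewrite mulmxBl mulmxBr -!mulmxA mulVmx// mulmx1 /segT !mulKVmx// mulmx1.
rewrite /seg mulmxDr mulmxDl !mulmxBr !mulmxBl !mul1mx !mulmx1.
rewrite mulNmx mul1mx mulmxDl mul_mx_scalar mul_scalar_mx -scalemxAr -scalemxAl.
by apply/matrixP => i j; rewrite !mxE !(rmorphB, rmorph1)/=; case: (i == j);
  rewrite ?mulr1n ?mulr0n; ring.
Qed.

Lemma Lmx_sub M N tau sig : seglow M tau -> seglow N sig ->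
  Lmx M - Lmx N = mint (fun s => segT s M *m (M - N) *m segT s N).
Proof.
move=> h k; rewrite /Lmx -mintB; [|exact: mccont_Lmx h|exact: mccont_Lmx k].
by apply: eq_mint => s s01; exact: (Lmx_integrand_sub h k).
Qed.

Lemma mccont_TXT M N X tau sig : seglow M tau -> seglow N sig ->
  mccont (fun s => segT s M *m X *m segT s N).
Proof.
move=> h k; apply: mccontM; last exact: mccont_segT k.
by apply: mccontM; [exact: mccont_segT h|exact: mccont_cst].
Qed.

Lemma mbound_TXT M N X tau sig K s : seglow M tau -> seglow N sig -> 0 <= s <= 1 ->
  0 <= K -> mbound X K -> mbound (segT s M *m X *m segT s N) (tau^-1 * K * sig^-1).
Proof.
move=> h k s01 K0 hX; have t0 : 0 <= tau^-1 by rewrite invr_ge0 ltW//; case: h.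
apply: mboundM; [by rewrite mulr_ge0| |exact: segT_bound k s01].
by apply: mboundM => //; exact: segT_bound h s01.
Qed.

Lemma Lmx_lip M N tau sig K u v : seglow M tau -> seglow N sig ->
  0 <= K -> mbound (M - N) K ->
  cnorm (dotc u (Lmx M *m v) - dotc u (Lmx N *m v)) <=
    2 * (tau^-1 * K * sig^-1 * (vnorm u * vnorm v)).
Proof.
move=> h k K0 hK; rewrite -dotcBr -mulmxBl (Lmx_sub h k).
apply: dotc_mint_le; first exact: mccont_TXT h k.
by move=> s s01; exact: mbound_TXT h k _ _ _.
Qed.

(** With [u = segT s M *m v] one has [v = (1 - s) u + s M u]. The forms of [u] against [M u] and of
    [M u] against [u] are conjugate, so their imaginary parts combine with total weight 1. Hence
    [Lmx] preserves the sign of imaginary parts. *)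
Lemma Im_Lmx_integrand M tau s v : seglow M tau -> 0 <= s <= 1 ->
  complex.Im (dotc v ((M - 1%:M) *m segT s M *m v)) =
  complex.Im (dotc (segT s M *m v) (M *m (segT s M *m v))).
Proof.
move=> h s01; have uM := seg_unit h s01.
set u := segT s M *m v; have -> : v = seg s M *m u by rewrite /u mulKVmx.
rewrite -mulmxA [segT s M *m _]mulKmx// /seg mulmxDl mul_scalar_mx -scalemxAl.
rewrite mulmxBl mul1mx dotcDl !dotcZl !dotcBr !dotcc.
rewrite (dotcC u (M *m u)); set d := dotc u _.
by rewrite !ReImE/=; ring.
Qed.

Lemma Im_Lmx_ge0 M tau v : seglow M tau ->
  (forall u, 0 <= complex.Im (dotc u (M *m u))) ->
  0 <= complex.Im (dotc v (Lmx M *m v)).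
Proof.
move=> h hM; rewrite dotc_mint; last exact: mccont_Lmx h.
rewrite /= Rintegral_ge0// => s /=; rewrite in_itv/= => s01.
by rewrite (Im_Lmx_integrand _ h).
Qed.

Lemma Im_Lmx_le0 M tau v : seglow M tau ->
  (forall u, complex.Im (dotc u (M *m u)) <= 0) ->
  complex.Im (dotc v (Lmx M *m v)) <= 0.
Proof.
move=> h hM; rewrite dotc_mint; last exact: mccont_Lmx h.
set g := fun s => _; have cg : ccont 0 1 g by apply: ccont_dotc; exact: mccont_Lmx h.
rewrite -oppr_ge0 -cImN -cintegralN//= Rintegral_ge0// => s /=; rewrite in_itv/= => s01.
by rewrite cImN oppr_ge0 /g (Im_Lmx_integrand _ h).
Qed.

Definition mqhol (S : set R[i]) (N : R[i] -> 'M[R[i]]_m) :=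
  exists (N' : R[i] -> 'M[R[i]]_m) (K : R), 0 <= K /\ forall z w, S z -> S w ->
  [/\ mbound (N z) K, mbound (N' w) K &
      mbound (N z - N w - (z - w) *: N' w) (K * cnorm (z - w) ^+ 2)].

Lemma mqhol_lip (S : set R[i]) (N : R[i] -> 'M[R[i]]_m) : mqhol S N -> exists2 L, 0 <= L &
  forall z w, S z -> S w -> mbound (N z - N w) (L * cnorm (z - w)).
Proof.
move=> [N' [K [K0 h]]]; exists (2 * K); first by rewrite mulr_ge0.
move=> z w Sz Sw; have [h1 h2 h3] := h z w Sz Sw; have [h4 _ _] := h w z Sw Sz.
have d0 : 0 <= cnorm (z - w) by exact: cnorm_ge0.
have [d1|d1] := leP 1 (cnorm (z - w)).
  by apply: mbound_le (mboundD h1 (mboundN h4)); nra.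
have -> : N z - N w = (N z - N w - (z - w) *: N' w) + (z - w) *: N' w.
  by rewrite subrK.
apply: mbound_le (mboundD h3 (mboundZ (z - w) h2)).
have e1 : K * cnorm (z - w) ^+ 2 <= K * cnorm (z - w).
  by rewrite ler_wpM2l// expr2 ler_piMl// ltW.
lra.
Qed.

Lemma TXT_expand (T T0 D X : 'M[R[i]]_m) (c : R[i]) :
  T *m D *m T0 - c *: (T0 *m X *m T0) =
  (T - T0) *m D *m T0 + T0 *m (D - c *: X) *m T0.
Proof.
by rewrite mulmxBl mulmxBl mulmxBr mulmxBl -scalemxAr -scalemxAl addrA subrK.
Qed.

(** The first-order remainder splits into the variation of the left inverse, which is a product of
    two Lipschitz factors, and the remainder of [N] itself. *)
Lemma mqhol_TXT (S : set R[i]) (N N' : R[i] -> 'M[R[i]]_m) K (L tau : R) (z w : R[i]) s : 0 <= K -> 0 <= L ->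
  (forall z w, S z -> S w -> [/\ mbound (N z) K, mbound (N' w) K &
      mbound (N z - N w - (z - w) *: N' w) (K * cnorm (z - w) ^+ 2)]) ->
  (forall z w, S z -> S w -> mbound (N z - N w) (L * cnorm (z - w))) ->
  (forall z, S z -> seglow (N z) tau) -> S z -> S w -> 0 <= s <= 1 ->
  mbound (segT s (N z) *m (N z - N w) *m segT s (N w) -
    (z - w) *: (segT s (N w) *m N' w *m segT s (N w)))
    ((tau^-1 ^+ 3 * L ^+ 2 + tau^-1 ^+ 2 * K) * cnorm (z - w) ^+ 2).
Proof.
move=> K0 L0 h hL low Sz Sw s01; have [h1 h2 h3] := h z w Sz Sw.
have t0 : 0 <= tau^-1 by rewrite invr_ge0 ltW//; case: (low z Sz).
have d0 : 0 <= cnorm (z - w) by exact: cnorm_ge0.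
have b1 := segT_bound (low z Sz) s01; have b2 := segT_bound (low w Sw) s01.
have -> : segT s (N z) *m (N z - N w) *m segT s (N w) -
    (z - w) *: (segT s (N w) *m N' w *m segT s (N w)) =
  (segT s (N z) - segT s (N w)) *m (N z - N w) *m segT s (N w) +
  segT s (N w) *m (N z - N w - (z - w) *: N' w) *m segT s (N w).
  exact: TXT_expand.
rewrite mulrDl; apply: mboundD.
  rewrite (segT_subM (low z Sz) (low w Sw))// -!scalemxAl.
  have hb := mbound_TXT (low z Sz) (low w Sw) s01 (mulr_ge0 L0 d0) (hL z w Sz Sw).
  have hb2 := mboundM _ (mboundM _ hb (hL z w Sz Sw)) b2.
  apply: mbound_le (mboundZ (- s)%:C (hb2 _ _)); rewrite ?mulr_ge0//.
  rewrite cnorm_real normrN; move/andP: s01 => [s0 s1]; rewrite ger0_norm//.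
  have -> : tau^-1 ^+ 3 * L ^+ 2 * cnorm (z - w) ^+ 2 =
    tau^-1 * (L * cnorm (z - w)) * tau^-1 * (L * cnorm (z - w)) * tau^-1 by ring.
  by apply: ler_piMl => //; rewrite !mulr_ge0.
have := mbound_TXT (low w Sw) (low w Sw) s01 _ h3; rewrite mulr_ge0 ?sqr_ge0// => /(_ isT).
by apply: mbound_le; rewrite le_eqVlt; apply/orP; left; apply/eqP; ring.
Qed.

(** The derivative is the integral of [segT s N *m N' *m segT s N], the infinitesimal form of
    [Lmx_sub]. *)
Lemma qhol_Lmx (S : set R[i]) (N : R[i] -> 'M[R[i]]_m) (tau : R) u v : mqhol S N -> (forall z, S z -> seglow (N z) tau) ->
  qhol S (fun z => dotc u (Lmx (N z) *m v)).
Proof.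
move=> hN low; have [L L0 hL] := mqhol_lip hN; case: hN => N' [K [K0 h]].
pose W := vnorm u * vnorm v; have W0 : 0 <= W by rewrite mulr_ge0 ?vnorm_ge0.
pose Q := (K + 1) * tau^-1 + tau^-1 * K * tau^-1 + (tau^-1 ^+ 3 * L ^+ 2 + tau^-1 ^+ 2 * K).
exists (fun w => dotc u (mint (fun s => segT s (N w) *m N' w *m segT s (N w)) *m v)),
  (2 * (Q * W)) => z w Sz Sw.
have [h1 h2 h3] := h z w Sz Sw.
have t0 : 0 <= tau^-1 by rewrite invr_ge0 ltW//; case: (low z Sz).
have q1 : 0 <= (K + 1) * tau^-1 by rewrite mulr_ge0 ?addr_ge0.
have q2 : 0 <= tau^-1 * K * tau^-1 by rewrite !mulr_ge0.
have q3 : 0 <= tau^-1 ^+ 3 * L ^+ 2 + tau^-1 ^+ 2 * K.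
  by rewrite addr_ge0// mulr_ge0 ?exprn_ge0.
have QW (a : R) : 0 <= a -> a <= Q -> 2 * (a * W) <= 2 * (Q * W).
  by move=> a0 aQ; rewrite ler_wpM2l// ler_wpM2r.
have cT := mccont_TXT (N' w) (low w Sw) (low w Sw).
split.
- apply: le_trans (QW _ q1 _); last by rewrite /Q; lra.
  apply: dotc_mint_le; first exact: mccont_Lmx (low z Sz).
  move=> s s01; apply: mboundM; first by rewrite addr_ge0.
    by apply: mboundD => //; apply: mboundN; exact: mbound1.
  exact: segT_bound (low z Sz) s01.
- apply: le_trans (QW _ q2 _); last by rewrite /Q; lra.
  apply: dotc_mint_le => // s s01.
  exact: mbound_TXT (low w Sw) (low w Sw) s01 K0 h2.
rewrite -dotcBr -mulmxBl (Lmx_sub (low z Sz) (low w Sw)) -dotcZr scalemxAl -dotcBr -mulmxBl.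
have cZ := mccontZ (ccont_cst (z - w)) cT.
have -> : (z - w) *: mint (fun s => segT s (N w) *m N' w *m segT s (N w)) =
   mint (fun s => (z - w) *: (segT s (N w) *m N' w *m segT s (N w))).
  apply/matrixP => i j; rewrite !mxE -cintegralZ//.
  by apply: eq_cintegral => t _; rewrite [RHS]mxE.
rewrite -mintB//; last exact: mccont_TXT (low z Sz) (low w Sw).
apply: le_trans (_ : 2 * ((tau^-1 ^+ 3 * L ^+ 2 + tau^-1 ^+ 2 * K) * cnorm (z - w) ^+ 2 * W) <= _).
  apply: dotc_mint_le.
    apply: mccontD; first exact: mccont_TXT (low z Sz) (low w Sw).
    exact: mccontN.
  by move=> s s01; exact: (mqhol_TXT K0 L0 h hL low Sz Sw s01).
have := QW _ q3 _; rewrite {1}/Q => hq.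
have : 0 <= cnorm (z - w) ^+ 2 by rewrite sqr_ge0.
have e : 2 * ((tau^-1 ^+ 3 * L ^+ 2 + tau^-1 ^+ 2 * K) * cnorm (z - w) ^+ 2 * W) =
  2 * ((tau^-1 ^+ 3 * L ^+ 2 + tau^-1 ^+ 2 * K) * W) * cnorm (z - w) ^+ 2 by ring.
by move=> d2; rewrite e ler_wpM2r//; apply: hq; lra.
Qed.

(** Serves the divided difference of the logarithm: for scalar [N z] this integral is, up to a
    constant factor, the quotient of [Lmx (N z) - Lmx M] by [N z - M], and it is holomorphic even
    where that difference is singular. *)
Lemma qhol_mint_segT (S : set R[i]) (N : R[i] -> 'M[R[i]]_m) X M (tau sig : R) u v : mqhol S N ->
  (forall z, S z -> seglow (N z) tau) -> seglow M sig ->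
  qhol S (fun z => dotc u (mint (fun s => segT s (N z) *m X *m segT s M) *m v)).
Proof.
move=> hN low lowM; have [L L0 hL] := mqhol_lip hN; case: hN => N' [K [K0 h]].
have [x x0 hX] := mbound_exists X.
pose W := vnorm u * vnorm v; have W0 : 0 <= W by rewrite mulr_ge0 ?vnorm_ge0.
have s0 : 0 <= sig^-1 by rewrite invr_ge0 ltW//; case: lowM.
pose B := x * sig^-1; have B0 : 0 <= B by rewrite mulr_ge0.
pose Q := tau^-1 + tau^-1 * K * tau^-1 + (tau^-1 ^+ 3 * L ^+ 2 + tau^-1 ^+ 2 * K).
(* The derivative of the inverse [segT s N] is [- s] times [segT s N *m N' *m segT s N]. *)
pose D w s := (- s)%:C *: (segT s (N w) *m N' w *m segT s (N w)) *m X *m segT s M.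
exists (fun w => dotc u (mint (D w) *m v)), (2 * (Q * B * W)) => z w Sz Sw.
have [h1 h2 h3] := h z w Sz Sw.
have t0 : 0 <= tau^-1 by rewrite invr_ge0 ltW//; case: (low z Sz).
have q2 : 0 <= tau^-1 * K * tau^-1 by rewrite !mulr_ge0.
have q3 : 0 <= tau^-1 ^+ 3 * L ^+ 2 + tau^-1 ^+ 2 * K.
  by rewrite addr_ge0// mulr_ge0 ?exprn_ge0.
have QW (a : R) : 0 <= a -> a <= Q -> 2 * (a * B * W) <= 2 * (Q * B * W).
  by move=> a0 aQ; rewrite ler_wpM2l// ler_wpM2r// ler_wpM2r.
have bXT (Y : 'M[R[i]]_m) (a : R) s : 0 <= s <= 1 -> 0 <= a -> mbound Y a -> mbound (Y *m X *m segT s M) (a * B).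
  move=> s01 a0 hY; rewrite mulrA; apply: mboundM; [by rewrite mulr_ge0| |exact: segT_bound lowM s01].
  exact: mboundM.
have bS (Y : 'M[R[i]]_m) (a : R) s : 0 <= s <= 1 -> 0 <= a -> mbound Y a -> mbound ((- s)%:C *: Y) a.
  move=> /andP[s0' s1] a0 hY; apply: mbound_le (mboundZ _ hY).
  by rewrite cnorm_real normrN ger0_norm// ler_piMl.
have cs : ccont (0 : R) 1 (fun s => (- s)%:C).
  by apply: (eq_ccont _ (ccontN (@ccont_id R 0 1))) => s _; rewrite rmorphN.
have cD y : S y -> mccont (D y).
  move=> Sy; apply: mccontM; last exact: mccont_segT lowM.
  apply: mccontM; last exact: mccont_cst.
  by apply: mccontZ => //; exact: mccont_TXT (low y Sy) (low y Sy).
have c0 y : S y -> mccont (fun s => segT s (N y) *m X *m segT s M).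
  by move=> Sy; exact: mccont_TXT (low y Sy) lowM.
split.
- apply: le_trans (QW _ t0 _); last by rewrite /Q; lra.
  apply: dotc_mint_le; first exact: c0.
  move=> s s01; apply: bXT => //; exact: segT_bound (low z Sz) s01.
- apply: le_trans (QW _ q2 _); last by rewrite /Q; lra.
  apply: dotc_mint_le; first exact: cD.
  move=> s s01; apply: bXT => //; apply: bS => //.
  exact: mbound_TXT (low w Sw) (low w Sw) s01 K0 h2.
rewrite -dotcBr -mulmxBl -mintB; [|exact: c0|exact: c0].
rewrite -dotcZr scalemxAl -dotcBr -mulmxBl.
have cZ := mccontZ (ccont_cst (z - w)) (cD w Sw).
have -> : (z - w) *: mint (D w) = mint (fun s => (z - w) *: D w s).
  apply/matrixP => i j; rewrite !mxE -cintegralZ//; last exact: cD.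
  by apply: eq_cintegral => t _; rewrite [RHS]mxE.
have cB : mccont (fun s => segT s (N z) *m X *m segT s M - segT s (N w) *m X *m segT s M).
  by apply: mccontD; [exact: c0|apply: mccontN; exact: c0].
rewrite -mintB//.
apply: le_trans (_ : 2 * ((tau^-1 ^+ 3 * L ^+ 2 + tau^-1 ^+ 2 * K) * cnorm (z - w) ^+ 2 * B * W) <= _).
  apply: dotc_mint_le; first by apply: mccontD => //; exact: mccontN.
  move=> s s01.
  have -> : segT s (N z) *m X *m segT s M - segT s (N w) *m X *m segT s M - (z - w) *: D w s =
    ((- s)%:C *: (segT s (N z) *m (N z - N w) *m segT s (N w) -
    (z - w) *: (segT s (N w) *m N' w *m segT s (N w)))) *m X *m segT s M.
    rewrite -!mulmxBl (segT_subM (low z Sz) (low w Sw))// /D.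
    rewrite -!scalemxAl !mulmxBl -!scalemxAl scalerBr; congr (_ - _).
    by rewrite !scalerA mulrC.
  apply: bXT => //; first by rewrite mulr_ge0 ?sqr_ge0.
  apply: bS => //; first by rewrite mulr_ge0 ?sqr_ge0.
  exact: (mqhol_TXT K0 L0 h hL low Sz Sw s01).
have : 0 <= cnorm (z - w) ^+ 2 by rewrite sqr_ge0.
have := QW _ q3 _; rewrite {1}/Q => hq d2.
have e : 2 * ((tau^-1 ^+ 3 * L ^+ 2 + tau^-1 ^+ 2 * K) * cnorm (z - w) ^+ 2 * B * W) =
  2 * ((tau^-1 ^+ 3 * L ^+ 2 + tau^-1 ^+ 2 * K) * B * W) * cnorm (z - w) ^+ 2 by ring.
by rewrite e ler_wpM2r//; apply: hq; lra.
Qed.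

End MatrixLog.

(** * The scalar logarithm *)

Section ScalarLog.
Variable R : realType.
Implicit Types (x y z : R[i]) (s t : R).
Local Notation mu := (@lebesgue_measure R).

Lemma Rintegral_FTC2 (F f : R -> R) (a b : R) : a < b ->
  (forall x : R, a <= x <= b -> is_derive x 1 F (f x)) ->
  {within `[a, b], continuous f} ->
  \int[mu]_(t in `[a, b]) f t = F b - F a.
Proof.
move=> ab dF cf.
have cF (x : R) : a <= x <= b -> {for x, continuous F}.
  move=> /dF d; apply: differentiable_continuous; apply/derivable1_diffP.
  by case: d.
rewrite /Rintegral (continuous_FTC2 (F := F) ab cf)//.
  split.
  - by move=> x; rewrite in_itv/= => /andP[ax xb]; have [|//] := dF x; rewrite !ltW.
  - by apply: cvg_at_right_filter; apply: cF; rewrite lexx ltW.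
  - by apply: cvg_at_left_filter; apply: cF; rewrite lexx ltW.
move=> x; rewrite in_itv/= => /andP[ax xb]; rewrite derive1E.
by have [|//] := dF x; rewrite !ltW.
Qed.

(** The sum is nonnegative and vanishes exactly on the closed negative half-axis, the cut of the
    principal logarithm. *)
Definition slit x := 0 < cnorm x + complex.Re x.
(** The principal argument by the half-angle formula, which is one expression for the whole slit
    plane. *)
Definition Parg x : R := 2 * atan (complex.Im x / (cnorm x + complex.Re x)).
Definition slog x : R[i] := cintegral 0 1 (fun s => (x - 1) / ((1 - s)%:C + s%:C * x)).

Lemma slit_Im x : complex.Im x != 0 -> slit x.
Proof.
move=> h; rewrite /slit; have h2 : `|complex.Re x| < cnorm x.
  rewrite -(@ltr_pXn2r _ 2) ?nnegrE ?cnorm_ge0// real_normK ?num_real// cnorm_sqr.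
  by rewrite ltrDl lt_def sqrf_eq0 h sqr_ge0.
have := ler_norm (- complex.Re x); rewrite normrN; lra.
Qed.

Lemma slit_Re x : 0 < complex.Re x -> slit x.
Proof. by move=> h; rewrite /slit; have := cnorm_ge0 x; lra. Qed.

Lemma slit_neq0 x : slit x -> x != 0.
Proof. by apply: contraTneq => ->; rewrite /slit cnorm0 addr0 ltxx. Qed.

Lemma slit_seg x s : slit x -> 0 <= s <= 1 -> slit ((1 - s)%:C + s%:C * x).
Proof.
move=> hx /andP[s0 s1]; have [s00|sn0] := eqVneq s 0.
  by apply: slit_Re; rewrite !ReImE/= s00; lra.
have sp : 0 < s by rewrite lt_def sn0.
have [i0|in0] := eqVneq (complex.Im x) 0; last first.
  by apply: slit_Im; rewrite !ReImE/= mul0r addr0 add0r mulf_neq0.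
apply: slit_Re; rewrite !ReImE/= i0.
have xp : 0 < complex.Re x.
  move: hx; rewrite /slit cnorm_sqrt i0 [0 ^+ 2]expr0n/= addr0 sqrtr_sqr.
  by have [//|h] := ltP 0 (complex.Re x); rewrite ler0_norm//; lra.
nra.
Qed.

Lemma Parg_lt x : - pi < Parg x < pi.
Proof.
rewrite /Parg; set u := _ / _; have := atan_gtNpi2 u; have := atan_ltpi2 u.
move=> h1 h2; apply/andP; split; lra.
Qed.

Lemma Parg_gt0 x : 0 < complex.Im x -> 0 < Parg x.
Proof.
move=> h; rewrite mulr_gt0// -(@atan0 R) lt_atan// divr_gt0//.
by apply: slit_Im; rewrite gt_eqF.
Qed.

Lemma Parg_lt0 x : complex.Im x < 0 -> Parg x < 0.
Proof.
move=> h; rewrite pmulr_rlt0// -(@atan0 R) lt_atan// pmulr_llt0// invr_gt0.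
by apply: slit_Im; rewrite lt_eqF.
Qed.

Lemma expi_Parg x : slit x -> x = (cnorm x)%:C * expi (Parg x).
Proof.
move=> hx; have hq := cnorm_sqr x; rewrite /Parg.
set rho := cnorm x in hq *; set X := complex.Re x in hq *; set Y := complex.Im x in hq *.
have h0 : 0 < rho + X by exact: hx.
set y := Y / (rho + X).
have yE : Y = y * (rho + X) by rewrite /y divfK// gt_eqF.
have c2 : cos (atan y) ^+ 2 * (1 + y ^+ 2) = 1.
  have h2 : 0 < 1 + y ^+ 2 by rewrite ltr_wpDr ?sqr_ge0.
  by rewrite cos_atan exprVn sqr_sqrtr ?ltW// mulVf// gt_eqF.
have s1 : sin (atan y) = y * cos (atan y).
  have cy : cos (atan y) != 0 by apply/eqP => c0; move: c2; rewrite c0 expr0n mul0r => /eqP; rewrite eq_sym oner_eq0.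
  by have := atanK y; rewrite /tan => {2}<-; rewrite divfK.
rewrite [2 * _]mulr_natl [_ *+ 2]mulr2n expiD.
have k0 : rho - X = y ^+ 2 * (rho + X).
  apply: (mulIf (lt0r_neq0 h0)); rewrite yE in hq; nra.
apply: complexP; rewrite !ReImE/= s1.
  have k1 : X = rho * (cos (atan y) ^+ 2 * (1 - y ^+ 2)).
    have -> : rho * (cos (atan y) ^+ 2 * (1 - y ^+ 2)) =
       cos (atan y) ^+ 2 * (rho - rho * y ^+ 2) by ring.
    have -> : rho - rho * y ^+ 2 = X * (1 + y ^+ 2) by move: k0; lra.
    by rewrite mulrCA c2 mulr1.
  by rewrite -/X {1}k1; ring.
rewrite -/Y.
have -> : rho * (cos (atan y) * (y * cos (atan y)) + y * cos (atan y) * cos (atan y)) +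
  0 * (cos (atan y) * cos (atan y) - y * cos (atan y) * (y * cos (atan y))) =
  y * (cos (atan y) ^+ 2 * (2 * rho)) by ring.
have -> : 2 * rho = (rho + X) * (1 + y ^+ 2) by move: k0; lra.
by rewrite [_ ^+ 2 * (_ * _)]mulrCA c2 mulr1 -yE.
Qed.

Lemma expi_inj_small (t t' : R) : `|t - t'| < 2 * pi -> expi t = expi t' -> t = t'.
Proof.
wlog tt : t t' / t' <= t.
  move=> hw h e; have [/hw ->//|tt] := leP t' t.
  by apply/esym/hw; rewrite ?ltW// distrC.
rewrite ger0_norm ?subr_ge0// => h e.
have : expi (t - t') = 1.
  by rewrite expiD expiN e mulcc cnorm_expi expr1n.
move=> /(congr1 (@complex.Re R)) /= c1.
pose d := (t - t') / 2.
have E : t - t' = d *+ 2 by rewrite -mulr_natr /d; field.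
have s0 : sin d = 0.
  apply/eqP; rewrite -sqrf_eq0; have := cos2Dsin2 d; move: c1; rewrite E cos_mulr2n mulr2n; move=> c1 c2.
  by apply/eqP; lra.
have [d0|dn0] := eqVneq d 0.
  by apply/eqP; rewrite -subr_eq0 E d0 mul0rn.
have : 0 < sin d.
  apply: sin_gt0_pi; apply/andP; split; first by rewrite lt_def dn0 divr_ge0// subr_ge0.
  by rewrite /d; lra.
by rewrite s0 ltxx.
Qed.

Lemma is_derive_eqf (F G : R -> R) (x d e : R) : (forall t, F t = G t) -> d = e ->
  is_derive x 1 F d -> is_derive x 1 G e.
Proof. by move=> /funext -> ->. Qed.

(** The algebra of differentiating the half-angle formula along a line of direction [a + 'i * b];
    the relation between [X], [Y] and [r] gives [1 + (Y / D) ^+ 2 = 2 * r / D], after which the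
    square root disappears. *)
Lemma Parg_derivative_eq (a b r X Y : R) (D := r + X) : 0 < r -> D != 0 ->
  X ^+ 2 = r ^+ 2 - Y ^+ 2 ->
  2 * ((1 + (Y * D^-1) ^+ 2)^-1 *
       (Y * (- D ^- 2 * ((2 * r)^-1 * (2 * (a * X + b * Y)) + a)) + D^-1 * b)) =
  (b * X - a * Y) / r ^+ 2.
Proof.
move=> r0 Dn XY; have rn : r != 0 by rewrite gt_eqF.
have h : 1 + (Y * D^-1) ^+ 2 = 2 * r / D.
  apply: (mulIf Dn); rewrite divfK//; apply: (mulIf Dn).
  have -> : (1 + (Y * D^-1) ^+ 2) * D * D = D ^+ 2 + Y ^+ 2 by field.
  by rewrite /D; lra.
rewrite h; have n2 : 2 * r != 0 by rewrite mulf_neq0.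
apply: (mulIf (expf_neq0 2 rn)); rewrite divfK ?expf_neq0//; apply: (mulIf Dn).
transitivity (b * r * D - Y * (a * X + b * Y) - a * Y * r).
  by field; rewrite Dn rn.
apply/eqP; rewrite -subr_eq0.
have -> : b * r * D - Y * (a * X + b * Y) - a * Y * r - (b * X - a * Y) * D =
  b * (r ^+ 2 - Y ^+ 2 - X ^+ 2) by rewrite /D; ring.
by rewrite -XY subrr mulr0.
Qed.

(** Along the segment [P] from 1 to [x] the integrand is [P' / P]. Its real part is the derivative
    of half of [ln (q s)], with [q] the squared modulus of [P], its imaginary part that of
    [Parg (P s)]; both are smooth there because the segment stays in the slit plane. *)
Lemma slogE x : slit x -> slog x = ln (cnorm x) +i* Parg x.
Proof.
move=> hx; pose a := complex.Re x - 1; pose b := complex.Im x.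
pose P s := (1 - s)%:C + s%:C * x.
pose X s := 1 + s * a; pose Y s := s * b.
have PX s : complex.Re (P s) = X s by rewrite !ReImE/= /X /a; ring.
have PY s : complex.Im (P s) = Y s by rewrite !ReImE/= /Y /b; ring.
pose q s := X s ^+ 2 + Y s ^+ 2.
have qE s : q s = cnorm (P s) ^+ 2 by rewrite cnorm_sqr PX PY.
have sP s : 0 <= s <= 1 -> slit (P s) by exact: slit_seg.
have nP s : 0 <= s <= 1 -> 0 < cnorm (P s) by move=> /sP/slit_neq0; rewrite cnorm_gt0.
have q0 s : 0 <= s <= 1 -> 0 < q s by move=> /nP h; rewrite qE exprn_gt0.
have sq s : Num.sqrt (q s) = cnorm (P s) by rewrite qE sqrtr_sqr ger0_norm ?cnorm_ge0.
have dX (s : R) : is_derive s 1 X a.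
  apply: (@is_derive_quad _ _ _ _ 0 1) => // y _.
  by rewrite mul0r /X (_ : _ - _ - _ = 0) ?normr0//; ring.
have dY (s : R) : is_derive s 1 Y b.
  apply: (@is_derive_quad _ _ _ _ 0 1) => // y _.
  by rewrite mul0r /Y (_ : _ - _ - _ = 0) ?normr0//; ring.
have dq (s : R) : is_derive s 1 q (2 * (a * X s + b * Y s)).
  apply: (@is_derive_quad _ _ _ _ (a ^+ 2 + b ^+ 2) 1) => // y _.
  rewrite ger0_norm; last first.
    have -> : q y - q s - (y - s) * (2 * (a * X s + b * Y s)) = (a ^+ 2 + b ^+ 2) * (y - s) ^+ 2.
      by rewrite /q /X /Y; ring.
    by rewrite mulr_ge0 ?sqr_ge0// addr_ge0 ?sqr_ge0.
  by rewrite le_eqVlt; apply/orP; left; apply/eqP; rewrite /q /X /Y; ring.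
have cP : ccont 0 1 P.
  apply: ccontD; last by apply: ccontM; [exact: ccont_id|exact: ccont_cst].
  apply: (eq_ccont _ (ccontD (ccont_cst 1) (ccontN (@ccont_id R 0 1)))) => s _.
  by rewrite rmorphB/= rmorph1.
have E s : 0 <= s <= 1 -> (x - 1) / P s =
    ((a * X s + b * Y s) / q s) +i* ((b * X s - a * Y s) / q s).
  move=> s01; have nz : P s != 0 by apply: slit_neq0; exact: sP.
  apply: (mulIf nz); rewrite divfK//.
  have := q0 s s01; rewrite lt0r => /andP[qn _].
  move: (P s) nz (PX s) (PY s) => p nz pX pY.
  apply: complexP; rewrite !ReImE pX pY /= -/a -/b ?subr0.
    have -> : (a * X s + b * Y s) / q s * X s - (b * X s - a * Y s) / q s * Y s =
       a * ((X s ^+ 2 + Y s ^+ 2) / q s) by ring.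
    by rewrite -/(q s) divff// mulr1.
  have -> : (a * X s + b * Y s) / q s * Y s + (b * X s - a * Y s) / q s * X s =
     b * ((X s ^+ 2 + Y s ^+ 2) / q s) by ring.
  by rewrite -/(q s) divff// mulr1.
have cR (h : R -> R) : (forall s : R, exists d, is_derive s 1 h d) -> continuous h.
  move=> dh s; have [d ds] := dh s; apply: differentiable_continuous.
  by apply/derivable1_diffP; case: ds.
have cq : continuous q by apply: cR => s; eexists; exact: dq.
have cX : continuous X by apply: cR => s; eexists; exact: dX.
have cY : continuous Y by apply: cR => s; eexists; exact: dY.
have cquo (h : R -> R) : continuous h -> {within `[0, 1], continuous (fun s => h s / q s)}.
  move=> ch; apply/continuous_in_subspaceT => s; rewrite inE/= in_itv/= => s01.
  apply: cvgM; first exact: ch.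
  by apply: cvgV; [rewrite gt_eqF// q0|exact: cq].
have lq s : 0 <= s <= 1 -> ln (q s) = 2 * ln (cnorm (P s)).
  by move=> s01; rewrite qE lnXn ?nP// mulr_natl.
have P0 : P 0 = 1 by rewrite /P subr0 mul0r addr0.
have P1 : P 1 = x by rewrite /P subrr mul1r add0r.
have I0 : 0 <= (0 : R) <= 1 by rewrite lexx ler01.
have I1 : 0 <= (1 : R) <= 1 by rewrite lexx ler01.
have eqR s : `[0%R, 1%R]%classic s -> 0 <= s <= 1 by rewrite /= in_itv.
rewrite /slog /cintegral; congr (_ +i* _).
- transitivity (\int[mu]_(s in `[0, 1]) ((a * X s + b * Y s) / q s)).
    by apply: eq_Rintegral => s; rewrite inE => /eqR s01; rewrite E.
  etransitivity; first apply: (@Rintegral_FTC2 (fun s => 2^-1 * ln (q s))) => //; last first.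
  + by cbv beta; rewrite !lq// P0 P1 cnorm1 ln1; field.
  + by apply: cquo => s; apply: cvgD; (apply: cvgM; first exact: cvg_cst); [exact: cX|exact: cY].
  + move=> s s01; have d1 := is_derive1_comp (is_derive1_ln (q0 s s01)) (dq s).
    apply: (is_derive_eqf _ _ (is_deriveZ 2^-1 d1)) => //.
    by rewrite -[_ *: _]/(_ * _); field; rewrite gt_eqF ?q0.
- transitivity (\int[mu]_(s in `[0, 1]) ((b * X s - a * Y s) / q s)).
    by apply: eq_Rintegral => s; rewrite inE => /eqR s01; rewrite E.
  etransitivity; first apply: (@Rintegral_FTC2 (fun s => 2 * atan (Y s * (Num.sqrt (q s) + X s)^-1))) => //; last first.
  + by cbv beta; rewrite !sq P0 P1 /Parg -[X 1]PX -[Y 1]PY P1 [Y 0]mul0r mul0r atan0 mulr0 subr0.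
  + by apply: cquo => s; apply: cvgB; (apply: cvgM; first exact: cvg_cst); [exact: cX|exact: cY].
  + move=> s s01; have qs := q0 s s01.
    have d1 := is_derive1_comp (is_derive1_sqrt qs) (dq s).
    pose D u := Num.sqrt (q u) + X u.
    have d2 : is_derive s 1 D ((2 * Num.sqrt (q s))^-1 * (2 * (a * X s + b * Y s)) + a).
      exact: is_deriveD d1 (dX s).
    have n2 : D s != 0 by rewrite /D sq -PX gt_eqF//; exact: sP.
    have d3 := is_deriveV n2 d2.
    have d4 := is_deriveM (dY s) d3.
    have d5 := is_derive1_comp (is_derive1_atan _) d4.
    have d6 := is_deriveZ 2 d5.
    have rq : q s = Num.sqrt (q s) ^+ 2 by rewrite sqr_sqrtr ?ltW.
    have r0 : 0 < Num.sqrt (q s) by rewrite sqrtr_gt0.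
    have XY : X s ^+ 2 = Num.sqrt (q s) ^+ 2 - Y s ^+ 2 by rewrite -rq /q addrK.
    apply: (is_derive_eqf _ _ d6) => //.
    rewrite -![_ *: _]/(_ * _) /= -[X in _ = _ / X](sqr_sqrtr (ltW qs)).
    exact: (Parg_derivative_eq _ _ r0 n2 XY).
Qed.

(** [cln] is cut along the negative imaginary axis and [slog] along the negative real one. A
    rotation by [a], compensated by the angle [t], matches them whenever the resulting angle lies in
    the range of [carg]. *)
Lemma slog_cln (a z : R[i]) (t : R) : cnorm a = 1 -> slit (a * z) ->
  expi t * a = 1 -> - (pi / 2) < Parg (a * z) + t < 3 * pi / 2 ->
  cln z = slog (a * z) + 'i * t%:C.
Proof.
move=> a1 haz ta tr; have nz : cnorm (a * z) = cnorm z by rewrite cnormM a1 mul1r.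
have zE : z = (cnorm z)%:C * expi (Parg (a * z) + t).
  have := expi_Parg haz; rewrite nz => h.
  transitivity (expi t * ((cnorm z)%:C * expi (Parg (a * z)))).
    by rewrite -h mulrA ta mul1r.
  by rewrite expiD; ring.
have z0 : cnorm z != 0 by rewrite -nz gt_eqF// cnorm_gt0 slit_neq0.
rewrite slogE// nz /cln.
have -> : carg z = Parg (a * z) + t.
  rewrite /carg; case: xgetP => [u _ [/andP[u1 u2] uE]|/(_ (Parg (a * z) + t))/(_ (conj tr zE))[]].
  move/andP: tr => [t1 t2]; apply: expi_inj_small.
    by rewrite ltr_norml; apply/andP; split; lra.
  apply: (mulfI (_ : (cnorm z)%:C != 0)); last by rewrite -uE -zE.
  by rewrite (inj_eq (@complexI R) _ 0).
by apply: complexP; rewrite !ReImE/=; ring.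
Qed.

(** Three rotations of one branch follow, by 1, -1 and [- 'i]. The first two yield the bounds 0 and
    [pi] for the imaginary part of the logarithm and its limits on the real line; the third yields
    holomorphy and the comparison on the vertical line. *)
Lemma cln_slog1 z : 0 < complex.Im z -> cln z = slog z.
Proof.
move=> h; have := @slog_cln 1 z 0; rewrite !mul1r cnorm1 expi0 mul1r => -> //.
- by rewrite mulr0 addr0.
- by apply: slit_Im; rewrite gt_eqF.
- have /andP[h1 h2] := Parg_lt z; have := Parg_gt0 h; rewrite addr0 => h3.
  by apply/andP; split; lra.
Qed.

Lemma cln_slogN1 z : 0 < complex.Im z -> cln z = slog (- z) + 'i * pi%:C.
Proof.
move=> h; rewrite -mulN1r; apply: slog_cln.
- by rewrite cnormN cnorm1.
- by apply: slit_Im; rewrite mulN1r cImN oppr_eq0 gt_eqF.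
- by rewrite /expi cospi sinpi; apply: complexP; rewrite !ReImE/=; ring.
- rewrite mulN1r; have /andP[h1 h2] := Parg_lt (- z).
  have := @Parg_lt0 (- z); rewrite cImN oppr_lt0 => /(_ h) h3.
  by have := pi_gt0 R; move=> p; apply/andP; split; lra.
Qed.

Lemma cln_slogNi z : 0 < complex.Im z -> cln z = slog (- 'i * z) + 'i * (pi / 2)%:C.
Proof.
move=> h; apply: slog_cln.
- by rewrite cnormN cnorm_i.
- by apply: slit_Re; rewrite !ReImE/=; lra.
- by rewrite /expi cos_pihalf sin_pihalf; apply: complexP; rewrite !ReImE/=; ring.
- have /andP[h1 h2] := Parg_lt (- 'i * z).
  by apply/andP; split; lra.
Qed.

End ScalarLog.

(** * The Dunford integral of the logarithm *)

Section CircleIntegrals.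
Variable R : realType.
Implicit Types (f g : R[i] -> R[i]) (w b z : R[i]) (r : R).

Lemma ccont_prod (a b : R) (I : Type) (s : seq I) (F : I -> R -> R[i]) :
  (forall k, ccont a b (F k)) -> ccont a b (fun t => \prod_(k <- s) F k t).
Proof.
move=> h; elim: s => [|k s IH].
  by apply: (eq_ccont _ (@ccont_cst _ a b 1)) => t _; rewrite big_nil.
by apply: (eq_ccont _ (ccontM (h k) IH)) => t _; rewrite big_cons.
Qed.

Lemma ccontV (a b : R) (f : R -> R[i]) : (forall t, a <= t <= b -> f t != 0) ->
  ccont a b f -> ccont a b (fun t => (f t)^-1).
Proof.
move=> nz hf x xab e e0; have fx : 0 < cnorm (f x) by rewrite cnorm_gt0 nz.
pose c := cnorm (f x) / 2; have c0 : 0 < c by rewrite divr_gt0.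
have [d1 d10 hd1] := hf x xab c c0.
have e1 : 0 < e * (c * c) by rewrite !mulr_gt0.
have [d2 d20 hd2] := hf x xab _ e1.
exists (Num.min d1 d2); first by rewrite lt_min d10.
move=> y yab; rewrite lt_min => /andP[/(hd1 y yab) h1 /(hd2 y yab) h2].
have fy : c <= cnorm (f y).
  have : cnorm (f x) <= cnorm (f x - f y) + cnorm (f y).
    by rewrite -{1}[f x](subrK (f y)) cnormD.
  by move: h1; rewrite /c; lra.
have -> : (f x)^-1 - (f y)^-1 = - (f x - f y) * ((f x)^-1 * (f y)^-1).
  by have := nz x xab; have := nz y yab => n1 n2; field; rewrite n1 n2.
rewrite cnormM cnormN cnormM !cnormV.
have cc : (cnorm (f x))^-1 * (cnorm (f y))^-1 <= c^-1 * c^-1.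
  rewrite ler_pM ?invr_ge0 ?cnorm_ge0// lef_pV2 ?posrE//.
    by rewrite /c; lra.
  exact: lt_le_trans fy.
apply: le_lt_trans (ler_wpM2l (cnorm_ge0 _) cc) _.
by rewrite -invfM ltr_pdivrMr// mulr_gt0.
Qed.

Lemma ccont_det (a b : R) n (F : R -> 'M[R[i]]_n) :
  (forall i j, ccont a b (fun t => F t i j)) -> ccont a b (fun t => \det (F t)).
Proof.
move=> h; apply: ccont_sum => s _; apply: ccontM; first exact: ccont_cst.
by apply: ccont_prod => k; exact: h.
Qed.

Lemma ccont_invmx (a b : R) n (F : R -> 'M[R[i]]_n) :
  (forall t, a <= t <= b -> F t \in unitmx) ->
  (forall i j, ccont a b (fun t => F t i j)) ->
  forall i j, ccont a b (fun t => invmx (F t) i j).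
Proof.
move=> hu h i j.
have cd : ccont a b (fun t => (\det (F t))^-1).
  by apply: ccontV; [move=> t /hu; rewrite unitmxE unitfE|exact: ccont_det].
have ca : ccont a b (fun t => \adj (F t) i j).
  apply: (@eq_ccont _ _ _ (fun t => (-1) ^+ (j + i) * \det (row' j (col' i (F t))))).
    by move=> t _; rewrite mxE.
  apply: ccontM; first exact: ccont_cst.
  apply: ccont_det => k l; apply: (eq_ccont _ (h (lift j k) (lift i l))) => t _.
  by rewrite !mxE.
apply: (eq_ccont _ (ccontM cd ca)) => t /hu ut.
by rewrite /invmx ut [RHS]mxE.
Qed.

Definition ccirc w r f := ccont 0 (2 * pi) (fun t => f (w + circle r t)).

Lemma circle_integralE w r f : circle_integral w r f =
  cintegral 0 (2 * pi) (fun t => f (w + circle r t) * ('i * circle r t)).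
Proof. by apply: eq_cintegral => t _; rewrite /circle !mulrA. Qed.

Lemma ccirc_mul w r f : ccirc w r f ->
  ccont 0 (2 * pi) (fun t => f (w + circle r t) * ('i * circle r t)).
Proof.
by move=> h; apply: ccontM => //; apply: ccont_mull; exact: ccont_circle.
Qed.

Lemma circle_integralD w r f g : ccirc w r f -> ccirc w r g ->
  circle_integral w r (fun z => f z + g z) =
  circle_integral w r f + circle_integral w r g.
Proof.
move=> hf hg; rewrite !circle_integralE -cintegralD; [|exact: ccirc_mul..].
by apply: eq_cintegral => t _; rewrite mulrDl.
Qed.

Lemma circle_integralZ w r f (c : R[i]) : ccirc w r f ->
  circle_integral w r (fun z => c * f z) = c * circle_integral w r f.
Proof.
move=> hf; rewrite !circle_integralE -cintegralZ; last exact: ccirc_mul.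
by apply: eq_cintegral => t _; rewrite mulrA.
Qed.

Lemma circle_integral_sum w r (I : Type) (s : seq I) (F : I -> R[i] -> R[i]) :
  (forall k, ccirc w r (F k)) ->
  circle_integral w r (fun z => \sum_(k <- s) F k z) =
  \sum_(k <- s) circle_integral w r (F k).
Proof.
move=> hF; under eq_bigr do rewrite circle_integralE.
rewrite circle_integralE -cintegral_sum ?mulr_ge0 ?pi_ge0//.
  by apply: eq_cintegral => t _; rewrite mulr_suml.
by move=> k; exact: ccirc_mul.
Qed.

Lemma eq_circle_integral w r f g : 0 <= r -> (forall z, cnorm (z - w) = r -> f z = g z) ->
  circle_integral w r f = circle_integral w r g.
Proof.
move=> r0 fg; rewrite !circle_integralE; apply: eq_cintegral => t _.
by rewrite fg// addrC addKr cnorm_circle.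
Qed.

Definition cdisc w r : set R[i] := [set z | cnorm (z - w) <= r].

Lemma qhol_shift w r f : qhol (cdisc w r) f ->
  qhol [set z | cnorm z <= r] (fun z => f (w + z)).
Proof.
move=> [f' [K h]]; exists (fun z => f' (w + z)), K => x y /= xr yr.
have [] := h (w + x) (w + y); rewrite /cdisc/= ?[w + _ - w]addrAC ?subrr ?add0r//.
by move=> h1 h2; rewrite opprD addrACA subrr add0r; split.
Qed.

Lemma qhol_ccirc w r f : 0 <= r -> qhol (cdisc w r) f -> ccirc w r f.
Proof.
by move=> r0 /qhol_shift h; apply: (ccont_qhol_circle r0 _ h).
Qed.

Lemma circle_integral_qhol w r f : 0 < r -> qhol (cdisc w r) f ->
  circle_integral w r f = 0.
Proof.
move=> r0 /qhol_shift hf; rewrite circle_integralE.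
have h : qhol [set z : R[i] | cnorm z <= r] (fun z => f (w + z) * ('i * z)).
  by apply: qholM => //; apply: qholZ; apply: (qhol_id (X := r)).
by rewrite (circle_mean r0 h) !mulr0.
Qed.

Lemma qhol_pole w b r n : 0 < r -> 2 * r <= cnorm (b - w) ->
  qhol (cdisc w r) (fun z => ((z - b) ^+ n)^-1).
Proof.
move=> r0 h; under eq_fun do rewrite -exprVn; apply: qholX.
apply: (qholV r0) => [z zr|].
  have : cnorm (b - w) <= cnorm (z - b) + cnorm (z - w).
    by rewrite [cnorm (z - b)]cdistC; apply: le_trans (cnormD _ _); rewrite addrA subrK.
  by move: zr; rewrite /cdisc /=; lra.
apply: qholB; last exact: qhol_cst.
apply: (qhol_id (X := r + cnorm w)) => z zr; rewrite -[z](subrK w).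
by apply: le_trans (cnormD _ _) _; rewrite lerD2r.
Qed.

Lemma ccirc_pole b r n : 0 < r -> ccirc b r (fun z => ((z - b) ^+ n)^-1).
Proof.
move=> r0; apply: (@ccontV 0 (2 * pi) (fun t => (b + circle r t - b) ^+ n)).
  move=> t _; rewrite addrC addKr expf_neq0// -cnorm_gt0 cnorm_circle ?ltW//.
elim: n => [|n IH]; first exact: ccont_cst.
under eq_fun do rewrite exprS; apply: ccontM => //.
under eq_fun do rewrite addrC addKr; exact: ccont_circle.
Qed.

(** On the circle the integrand is a constant times the conjugate of [expi t ^+ n], so the mean
    value property of [z ^+ n] at 0 gives the answer, which is nonzero for [n = 0] only. *)
Lemma circle_integral_pole b r n : 0 < r ->
  circle_integral b r (fun z => ((z - b) ^+ n.+1)^-1) =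
  (2 * pi)%:C * 'i *+ (n == 0%N).
Proof.
move=> r0; rewrite circle_integralE.
have rn : r%:C != 0 :> R[i] by rewrite (inj_eq (@complexI R) _ 0) gt_eqF.
have en t : expi t != 0 :> R[i] by rewrite -cnorm_gt0 cnorm_expi.
have E t : ((b + circle r t - b) ^+ n.+1)^-1 * ('i * circle r t) =
    'i * (r%:C ^+ n)^-1 * conjc (expi t ^+ n).
  rewrite addrC addKr; have -> : conjc (expi t ^+ n) = (expi t ^+ n)^-1.
    apply: (mulfI (expf_neq0 n (en t))); rewrite mulfV ?expf_neq0//.
    by rewrite mulcc cnormX cnorm_expi !expr1n.
  rewrite /circle exprMn exprS exprS.
  move: (en t) (expf_neq0 n (en t)) (expf_neq0 n rn) (rn).
  set e := expi t; set en' := e ^+ n; set rn' := r%:C ^+ n; set rr := r%:C.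
  by move=> e0 en0 rn0 rr0; field; rewrite e0 en0 rn0 rr0.
under eq_cintegral do rewrite E.
have h1 : qhol [set z : R[i] | cnorm z <= 1] (fun z => z ^+ n).
  by apply: qholX; apply: (qhol_id (X := 1)).
have c1 : ccont 0 (2 * pi) (fun t : R => expi t ^+ n).
  have := ccont_qhol_circle (a := 0) (b := 2 * pi) ler01 (fun _ h => h) h1.
  by apply: eq_ccont => t _; rewrite /circle mul1r.
rewrite cintegralZ; last exact: ccont_conj.
rewrite cintegral_conj//.
have -> : cintegral 0 (2 * pi) (fun t : R => expi t ^+ n) = (2 * pi)%:C * 0 ^+ n.
  have h2 := circle_mean ltr01 h1; cbv beta in h2; rewrite -h2; apply: eq_cintegral => t _.
  by rewrite /circle mul1r.
case: n {E h1 c1} => [|n]; last first.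
  rewrite expr0n mulr0 (_ : conjc 0 = 0) ?mulr0//.
  by apply: complexP; rewrite /= ?oppr0.
rewrite !expr0 invr1 !mulr1 mulr1n mulrC; congr (_ * _).
by apply: complexP => //=; rewrite oppr0.
Qed.

End CircleIntegrals.

(** * The Riesz projections sum to the identity *)

Section Riesz.
Variables (R : realType) (m : nat).
Variable M : 'M[R[i]]_m.+1.
Implicit Types (v : 'cV[R[i]]_m.+1) (w b z : R[i]).

Variables (rs : seq R[i]) (r : R).
Hypothesis rs_uniq : uniq rs.
Hypothesis rsE : forall w, (w \in rs) = (M - w%:M \notin unitmx).
Hypothesis r0 : 0 < r.
Hypothesis r_sep : forall w b, w \in rs -> b \in rs -> w != b -> 2 * r <= cnorm (b - w).

Let res z v : 'cV[R[i]]_m.+1 := invmx (z%:M - M) *m v.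

Lemma res_unit w z : w \in rs -> cnorm (z - w) = r -> z%:M - M \in unitmx.
Proof.
move=> wrs zw; have : z \notin rs.
  apply/negP => zrs; have wz : w != z.
    by apply/eqP => e; move: zw; rewrite e subrr cnorm0 => e0; move: r0; rewrite -e0 ltxx.
  by have := r_sep wrs zrs wz; rewrite zw; have := r0; lra.
by rewrite rsE negbK -opprB -scaleN1r unitmxZ// unitrN1.
Qed.

Lemma ccirc_invmx w i j : w \in rs -> ccirc w r (fun z => invmx (z%:M - M) i j).
Proof.
move=> wrs; apply: (@ccont_invmx _ 0 (2 * pi) _ (fun t => (w + circle r t)%:M - M)).
  move=> t _; apply: (res_unit wrs).
  by rewrite addrC addKr cnorm_circle ?ltW.
move=> k l; apply: (@eq_ccont _ _ _ (fun t => (w + circle r t) *+ (k == l) - M k l)).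
  by move=> t _; rewrite !mxE.
apply: ccontD; last exact: ccont_cst.
case: (k == l); last exact: ccont_cst.
by apply: ccontD; [exact: ccont_cst|exact: ccont_circle].
Qed.

Lemma ccirc_res w v i : w \in rs -> ccirc w r (fun z => res z v i 0).
Proof.
move=> wrs; apply: (@eq_ccont _ _ _ (fun t => \sum_j invmx ((w + circle r t)%:M - M) i j * v j 0)).
  by move=> t _; rewrite mxE.
apply: ccont_sum => j _; apply: ccontM; last exact: ccont_cst.
exact: ccirc_invmx.
Qed.

(** For all [v] together this says that the contour integrals of the resolvent around the
    eigenvalues add up to [2 * pi * 'i] times the identity. *)
Definition rieszP v := forall i,
  \sum_(w <- rs) circle_integral w r (fun z => res z v i 0) = (2 * pi)%:C * 'i * v i 0.

Lemma rieszPD (a b : R[i]) u v : rieszP u -> rieszP v -> rieszP (a *: u + b *: v).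
Proof.
move=> hu hv i; have -> : (a *: u + b *: v) i 0 = a * u i 0 + b * v i 0 by rewrite !mxE.
rewrite mulrDr [X in _ = X + _]mulrCA [X in _ = _ + X]mulrCA -hu -hv.
rewrite !mulr_sumr -big_split/= big_seq [RHS]big_seq; apply: eq_bigr => w wrs.
rewrite -!circle_integralZ; [|exact: ccirc_res..].
rewrite -circle_integralD; last 2 first.
- by apply: ccont_mull; exact: ccirc_res.
- by apply: ccont_mull; exact: ccirc_res.
apply: (eq_circle_integral (ltW r0)) => z _.
by rewrite /res mulmxDr -!scalemxAr !mxE.
Qed.

Let D b v : 'cV[R[i]]_m.+1 := (M - b%:M) *m v.

Lemma res_nilp b v n z : z != b -> z%:M - M \in unitmx ->
  iter n (D b) v = 0 ->
  res z v = \sum_(k < n) ((z - b) ^+ k.+1)^-1 *: iter k (D b) v.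
Proof.
move=> zb uz vn; apply: (can_inj (mulKmx uz)); rewrite mulKVmx//.
have zb0 : z - b != 0 by rewrite subr_eq0.
have E n' : (z%:M - M) *m \sum_(k < n') ((z - b) ^+ k.+1)^-1 *: iter k (D b) v =
    v - ((z - b) ^+ n')^-1 *: iter n' (D b) v.
  elim: n' => [|n' IH]; first by rewrite big_ord0 mulmx0 expr0 invr1 scale1r subrr.
  rewrite big_ord_recr/= mulmxDr IH -scalemxAr.
  have -> : z%:M - M = (z - b)%:M - (M - b%:M).
    by rewrite opprB raddfB/= addrA subrK.
  rewrite mulmxBl mul_scalar_mx scalerBr scalerA exprS invfM mulrAC mulVf// mul1r.
  by rewrite addrA subrK.
by rewrite E vn scaler0 subr0.
Qed.

(** In the finite expansion of the resolvent at [b] only the simple pole has a residue, and only the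
    circle around [b] sees it. If [b] is not an eigenvalue, then [M - b] is invertible and [v] is
    0. *)
Lemma riesz_nilp b v n : iter n (D b) v = 0 -> rieszP v.
Proof.
move=> vn; have [brs|bnrs] := boolP (b \in rs); last first.
  have uD : M - b%:M \in unitmx by move: bnrs; rewrite rsE negbK.
  have v0 : v = 0.
    elim: n vn => [//|n IH]; rewrite iterS => h; apply: IH.
    by apply: (can_inj (mulKmx uD)); rewrite mulmx0.
  move=> i; rewrite v0 mxE mulr0 big1_seq// => w /andP[_ wrs].
  transitivity (circle_integral w r (fun=> 0)).
    by apply: (eq_circle_integral (ltW r0)) => z _; rewrite /res mulmx0 mxE.
  by apply: circle_integral_qhol => //; exact: qhol_cst.
move=> i.
have cp w k : w \in rs -> ccirc w r (fun z => ((z - b) ^+ k)^-1).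
  move=> wrs; have [->|wb] := eqVneq w b; first exact: ccirc_pole.
  by apply: qhol_ccirc; [exact: ltW|apply: qhol_pole => //; exact: r_sep].
have main w : w \in rs -> circle_integral w r (fun z => res z v i 0) =
    \sum_(k < n) iter k (D b) v i 0 * ((2 * pi)%:C * 'i *+ ((w == b) && (k == 0%N :> nat))).
  move=> wrs.
  transitivity (circle_integral w r (fun z =>
      \sum_(k < n) iter k (D b) v i 0 * ((z - b) ^+ k.+1)^-1)).
    apply: (eq_circle_integral (ltW r0)) => z zw; rewrite (@res_nilp b v n)//.
    - by rewrite summxE; apply: eq_bigr => k _; rewrite mxE mulrC.
    - apply/eqP => e; have [wb|wb] := eqVneq w b.
        by move: zw; rewrite e wb subrr cnorm0 => e0; move: r0; rewrite -e0 ltxx.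
      by have := r_sep wrs brs wb; rewrite -e zw; have := r0; lra.
    - exact: res_unit zw.
  rewrite circle_integral_sum; last by move=> k; apply: ccont_mull; exact: cp.
  apply: eq_bigr => k _; rewrite circle_integralZ; last exact: cp.
  congr (_ * _); have [->|wb] := eqVneq w b; first exact: circle_integral_pole.
  by apply: circle_integral_qhol => //; apply: qhol_pole => //; exact: r_sep.
rewrite big_seq; under eq_bigr do rewrite main//; rewrite -big_seq.
rewrite (bigD1_seq b)//= [X in _ + X]big1 ?addr0; last first.
  move=> w wb; rewrite big1// => k _; rewrite (negbTE wb)/= mulr0//.
case: n vn main => [v0 _|n _ _]; first by rewrite big_ord0 (_ : v = 0)// mxE mulr0.
rewrite big_ord_recl/= eqxx/= mulr1n big1 ?addr0; first by rewrite mulrC.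
by move=> k _; rewrite mulr0n mulr0.
Qed.

Definition kills (s : seq R[i]) v :=
  horner_mx M (\prod_(b <- s) ('X - b%:P)) *m v = 0.

Lemma killsS b s v : kills (b :: s) v -> kills s (D b v).
Proof.
rewrite /kills big_cons mulrC rmorphM/= => h.
rewrite /D mulmxA -[RHS]h; congr (_ *m _).
by rewrite -mulmxE rmorphB/= horner_mx_X horner_mx_C.
Qed.

Lemma kills_perm s s' v : perm_eq s s' -> kills s v -> kills s' v.
Proof. by move=> ss; rewrite /kills (perm_big _ ss). Qed.

(* Two distinct factors [M - b] and [M - c] of the annihilating product express [v]
   by [(M - b) v] and [(M - c) v], which shorter products annihilate. *)
Lemma riesz_kills s v : kills s v -> rieszP v.
Proof.
have [n] := ubnP (size s); elim: n s v => // n IH [|b s] v /=.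
  move=> _; rewrite /kills big_nil rmorph1 mul1mx => ->.
  exact: (@riesz_nilp 0 0 0).
rewrite ltnS => sn kv; have [alls|/allPn[c cs cb]] := boolP (all (pred1 b) s).
  apply: (@riesz_nilp b v (size s).+1).
  have {kv} : kills (nseq (size s).+1 b) v.
    by rewrite -[nseq _.+1 _]/(b :: nseq (size s) b) -(all_pred1P _ _ alls).
  elim: (size s).+1 v => [|k IHk] v.
    by rewrite /kills big_nil rmorph1 mul1mx.
  by move=> /killsS/IHk; rewrite iterSr.
rewrite /= in cb.
have k1 : rieszP (D b v) by apply: (IH s) => //; exact: killsS.
have k2 : rieszP (D c v).
  apply: (IH (b :: rem c s)).
    rewrite /= size_rem// prednK//; last by case: (s) cs.
  apply: killsS; apply: kills_perm kv.
  apply/permP => p; have /permP/(_ p)/= h := perm_to_rem cs.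
  by rewrite /= h addnCA.
have -> : v = (c - b)^-1 *: D b v + (- (c - b)^-1) *: D c v.
  rewrite scaleNr -scalerBr /D -mulmxBl.
  have -> : M - b%:M - (M - c%:M) = (c - b)%:M.
    by rewrite opprB addrC addrA subrK raddfB.
  by rewrite mul_scalar_mx scalerA mulVf ?scale1r// subr_eq0.
exact: rieszPD.
Qed.

(** The characteristic polynomial splits into linear factors and, by Cayley-Hamilton, annihilates
    every vector. *)
Lemma riesz v : rieszP v.
Proof.
have [s hs] := closed_field_poly_normal (char_poly M : {poly R[i]}).
apply: (@riesz_kills s); rewrite /kills.
have := Cayley_Hamilton M; rewrite hs (monicP (char_poly_monic M)) scale1r => ->.
by rewrite mul0mx.
Qed.

Lemma riesz_invmx i j :
  \sum_(w <- rs) circle_integral w r (fun z => invmx (z%:M - M) i j) =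
  (2 * pi)%:C * 'i *+ (i == j).
Proof.
have := riesz (delta_mx j 0) i; rewrite mxE eqxx andbT mulr_natr => <-.
rewrite big_seq [RHS]big_seq; apply: eq_bigr => w _.
by apply: (eq_circle_integral (ltW r0)) => z _; rewrite /res -colE mxE.
Qed.

End Riesz.

(** * The Dunford logarithm as a segment integral *)

Section Dunford.
Variables (R : realType) (m : nat).
Implicit Types (M : 'M[R[i]]_m.+1) (v : 'cV[R[i]]_m.+1) (w b z : R[i]).

Lemma lower_Im n (M : 'M[R[i]]_n) (t : R) :
  (forall v : 'cV[R[i]]_n, t * vnorm v ^+ 2 <= `|complex.Im (dotc v (M *m v))|) ->
  forall v : 'cV[R[i]]_n, t * vnorm v <= vnorm (M *m v).
Proof.
move=> h v; have [->|v0] := eqVneq v 0; first by rewrite mulmx0 vnorm0 mulr0.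
have n0 : 0 < vnorm v by rewrite vnorm_gt0.
rewrite -(ler_pM2r n0) -mulrA -expr2; apply: le_trans (h v) _.
apply: le_trans (normIm_le _) _.
by apply: le_trans (cauchy_schwarz _ _) _; rewrite mulrC.
Qed.

Lemma seq_pos_lower (l : seq R) : (forall x, x \in l -> 0 < x) ->
  exists2 d, 0 < d & forall x, x \in l -> d <= x.
Proof.
elim: l => [_|x l IH h]; first by exists 1.
have [|d d0 hd] := IH; first by move=> y yl; apply: h; rewrite inE yl orbT.
exists (Num.min x d); first by rewrite lt_min d0 h// mem_head.
by move=> y; rewrite inE ge_min => /predU1P[->|/hd ->]; rewrite ?lexx ?orbT.
Qed.

Lemma Lmx_scalar n (x : R[i]) : Lmx (x%:M : 'M[R[i]]_n) = (slog x)%:M.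
Proof.
apply/matrixP => i j; rewrite !mxE.
have E s : ((x%:M - 1%:M) *m segT s (x%:M : 'M[R[i]]_n)) i j =
    ((x - 1) / ((1 - s)%:C + s%:C * x)) *+ (i == j).
  rewrite /segT /seg scale_scalar_mx -raddfD/= invmx_scalar -raddfB/=.
  by rewrite -scalar_mxM mxE.
under eq_cintegral do rewrite E.
case: (i == j) => //; rewrite mulr0n cintegral_cst// mulr0 //.
Qed.

Lemma mulmx_regroup n (W Z X C I : 'M[R[i]]_n) : W *m Z *m I = W ->
  (W *m Z + X) *m I + C *m I = W + (X + C) *m I.
Proof. by move=> h; rewrite mulmxDl h mulmxDl addrA. Qed.

(* [(cln z - c - Lmx (a *: M)) (z - M)^-1] is holomorphic near the spectrum of [M],
   so the Dunford integral of [cln] is the one of a constant. *)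
Lemma lnmxE M (a c : R[i]) (c0 sig : R) : 0 < c0 ->
  (forall v, c0 * vnorm v ^+ 2 <= complex.Im (dotc v (M *m v))) ->
  seglow (a *: M) sig ->
  (forall z, 0 < complex.Im z -> cln z = slog (a * z) + c) ->
  (forall d X, 0 < d -> exists tau, forall z, d <= complex.Im z -> cnorm z <= X ->
     seglow ((a * z)%:M : 'M[R[i]]_m.+1) tau) ->
  lnmx M = Lmx (a *: M) + c%:M.
Proof.
move=> c00 hM hs hcln hlow.
have [l hl] := closed_field_poly_normal (char_poly M : {poly R[i]}).
pose rs := undup l.
have eigE w : eigenvalue M w = (M - w%:M \notin unitmx).
  by rewrite /eigenvalue /eigenspace kermx_eq0 row_free_unit.
have rs_eig w : (w \in rs) = eigenvalue M w.
  rewrite mem_undup eigenvalue_root_char hl (monicP (char_poly_monic M)) scale1r.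
  by rewrite root_prod_XsubC.
have rsE w : (w \in rs) = (M - w%:M \notin unitmx) by rewrite rs_eig eigE.
(* Eigenvalues belong to the numerical range, hence lie at height at least [c0]. *)
have Imrs w : w \in rs -> c0 <= complex.Im w.
  rewrite rsE; apply: contraNT; rewrite -ltNge => wc.
  have t0 : 0 < c0 - complex.Im w by rewrite subr_gt0.
  apply: (unitmx_lower t0); apply: lower_Im => v.
  rewrite mulmxBl mul_scalar_mx dotcBr dotcZr dotcc.
  apply: le_trans (ler_norm _); rewrite !ReImE/=.
  by have := hM v; lra.
have [d d0 hd] : exists2 d, 0 < d & forall w b, w \in rs -> b \in rs -> w != b ->
    d <= cnorm (b - w).
  have [|d d0 hd] := @seq_pos_lower [seq cnorm (p.2 - p.1) | p <-
      [seq p <- [seq (w, b) | w <- rs, b <- rs] | p.1 != p.2]].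
    move=> x /mapP[p]; rewrite mem_filter => /andP[pp _] ->.
    by rewrite cnorm_gt0 subr_eq0 eq_sym.
  exists d => // w b wr br wb; apply: hd; apply/mapP; exists (w, b) => //.
  by rewrite mem_filter/= wb; apply: allpairs_f.
(* The radius is below [c0 / 2], which keeps the discs inside the domain of the logarithm, and below
   half of the smallest distance between distinct eigenvalues, which keeps them disjoint. *)
have key : \forall r \near (0 : R)^'+, Lmx (a *: M) + c%:M = dunford (@cln R) M r.
  near=> r.
  have r0 : 0 < r by near: r; exact: nbhs_right_gt.
  have r1 : r < c0 / 2 by near: r; apply: nbhs_right_lt; rewrite divr_gt0.
  have r2 : r < d / 2 by near: r; apply: nbhs_right_lt; rewrite divr_gt0.
  have sep w b : w \in rs -> b \in rs -> w != b -> 2 * r <= cnorm (b - w).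
    by move=> wr br wb; have := hd w b wr br wb; lra.
  have Imz w z : w \in rs -> cnorm (z - w) <= r -> c0 / 2 <= complex.Im z.
    move=> /Imrs wi zw; have := normIm_le (z - w); rewrite !ReImE.
    by rewrite distrC => h; have := ler_norm (complex.Im w - complex.Im z); lra.
  have c20 : 0 < c0 / 2 by rewrite divr_gt0.
  have [W WE] : exists W, forall z, W z = mint (fun s =>
      segT s ((a * z)%:M : 'M[R[i]]_m.+1) *m a%:M *m segT s (a *: M)) by eexists.
  have Wres w z : w \in rs -> cnorm (z - w) = r ->
      cln z *: invmx (z%:M - M) = W z + (Lmx (a *: M) + c%:M) *m invmx (z%:M - M).
    move=> wr zw; have iz := Imz w z wr; rewrite zw lexx in iz; have {}iz := iz isT.
    have uz := res_unit rsE r0 sep wr zw.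
    have [tau ht] := hlow (c0 / 2) (cnorm z) c20.
    have lz := ht z iz (lexx _).
    rewrite hcln ?(lt_le_trans c20)// scalerDl.
    rewrite -(mul_scalar_mx (slog _)) -(mul_scalar_mx c) -Lmx_scalar.
    (* The difference formula for [Lmx] at a scalar matrix and at [a *: M]: since [z%:M - M]
       commutes with the second inverse, it can be pulled out on the right. *)
    have -> : Lmx ((a * z)%:M : 'M[R[i]]_m.+1) = W z *m (z%:M - M) + Lmx (a *: M).
      apply/eqP; rewrite -subr_eq; apply/eqP; rewrite (Lmx_sub lz hs).
      rewrite WE -mint_mulr; last exact: mccont_TXT lz hs.
      apply: eq_mint => s s01; rewrite -!mulmxA; congr (_ *m _).
      have cc : invmx (seg s (a *: M)) *m (z%:M - M) = (z%:M - M) *m invmx (seg s (a *: M)).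
        apply: invmx_comm; first exact: seg_unit hs s01.
        rewrite mulmxBr mulmxBl mul_scalar_mx mul_mx_scalar; congr (_ - _).
        by rewrite /seg mulmxDl mulmxDr mul_scalar_mx mul_mx_scalar -!scalemxAl -!scalemxAr.
      rewrite /segT cc [in RHS]mulmxA; congr (_ *m _).
      by rewrite mul_scalar_mx scalerBr scale_scalar_mx.
    exact: (mulmx_regroup (Lmx (a *: M)) c%:M (mulmxK uz (W z))).
  have qW w i j : w \in rs -> qhol (cdisc w r) (fun z => W z i j).
    move=> wr.
    have [tau ht] := hlow (c0 / 2) (cnorm w + r) c20.
    have zX z : cdisc w r z -> cnorm z <= cnorm w + r.
      move=> zr; rewrite -[z](subrK w) addrC; apply: le_trans (cnormD _ _) _.
      by rewrite lerD2l.
    have mq : mqhol (cdisc w r) (fun z => (a * z)%:M : 'M[R[i]]_m.+1).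
      pose K := cnorm a * (cnorm w + r + 1).
      have r0' := ltW r0; have [wg ag] := (cnorm_ge0 w, cnorm_ge0 a).
      have K0 : 0 <= K by rewrite mulr_ge0// !addr_ge0.
      have sc (x : R[i]) (k : R) : cnorm x <= k -> mbound (x%:M : 'M[R[i]]_m.+1) k.
        by move=> xk v; rewrite mul_scalar_mx vnormZ ler_wpM2r ?vnorm_ge0.
      exists (fun=> a%:M), K; split=> // x y xr yr; split.
      - by apply: sc; rewrite cnormM ler_wpM2l//; have := zX x xr; lra.
      - by apply: sc; rewrite ler_peMr//; lra.
      - rewrite scale_scalar_mx -!raddfB/=; apply: sc.
        have -> : a * x - a * y - (x - y) * a = 0 by ring.
        by rewrite cnorm0 mulr_ge0 ?sqr_ge0.
    have low z : cdisc w r z -> seglow ((a * z)%:M : 'M[R[i]]_m.+1) tau.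
      by move=> zr; apply: ht; [exact: Imz wr zr|exact: zX].
    have := qhol_mint_segT a%:M (delta_mx i 0) (delta_mx j 0) mq low hs.
    apply: eq_qhol => z _; rewrite dotcE (bigD1 i)//= big1 ?addr0.
      by rewrite mxE !eqxx/= oppr0 mul1r -WE -colE mxE.
    by move=> k ki; rewrite mxE (negbTE ki)/= oppr0 mul0r.
  pose L := Lmx (a *: M) + c%:M; rewrite -/L in Wres *.
  have E w i j : w \in rs -> circle_integral w r (fun z => cln z * invmx (z%:M - M) i j) =
      \sum_k L i k * circle_integral w r (fun z => invmx (z%:M - M) k j).
    move=> wr; have ci k := ccirc_invmx rsE r0 sep k j wr.
    transitivity (circle_integral w r (fun z =>
        W z i j + \sum_k L i k * invmx (z%:M - M) k j)).
      apply: (eq_circle_integral (ltW r0)) => z zw.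
      by have := congr1 (fun X : 'M[R[i]]_m.+1 => X i j) (Wres w z wr zw); rewrite !mxE.
    rewrite circle_integralD; last 2 first.
    - by apply: qhol_ccirc; [exact: ltW|exact: qW].
    - by apply: ccont_sum => k _; apply: ccont_mull; exact: ci.
    rewrite (circle_integral_qhol r0 (qW w i j wr)) add0r.
    rewrite circle_integral_sum; last by move=> k; apply: ccont_mull; exact: ci.
    by apply: eq_bigr => k _; rewrite circle_integralZ//; exact: ci.
  apply/matrixP => i j; rewrite /dunford.
  have -> : [set w | eigenvalue M w] = [set` rs].
    by apply/seteqP; split=> w /=; rewrite rs_eig.
  rewrite -fsbig_seq ?undup_uniq// [RHS]mxE summxE.
  under eq_bigr do rewrite mxE.
  rewrite big_seq; under eq_bigr do rewrite E//; rewrite -big_seq exchange_big/=.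
  under eq_bigr do rewrite -mulr_sumr (riesz_invmx (undup_uniq l) rsE r0 sep).
  rewrite (bigD1 j)//= eqxx mulr1n big1 ?addr0.
    rewrite mulrC rmorphM/= rmorph_nat mulfK//.
    by rewrite -cnorm_gt0 !cnormM cnorm_i cnorm_real mulr1 -(rmorph_nat (real_complex R)) cnorm_real mulr_gt0 ?normr_gt0 ?gt_eqF ?pi_gt0.
  by move=> k kj; rewrite (negbTE kj) mulr0n mulr0.
(* The right neighbourhoods of 0 form a proper filter, so the eventually constant value chosen by
   [holo_calc] is unique. *)
have uniqL L : (\forall r \near (0 : R)^'+, L = dunford (@cln R) M r) -> L = Lmx (a *: M) + c%:M.
  move=> hL; have : \forall r \near (0 : R)^'+, L = Lmx (a *: M) + c%:M.
    by apply: filterS2 hL key => r -> ->.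
  by move/filter_ex => [].
rewrite /lnmx /holo_calc; case: xgetP => [L _ /= /uniqL //|/(_ (Lmx (a *: M) + c%:M))].
by move=> /(_ key).
Unshelve. all: by end_near. Qed.

End Dunford.

(** * Bounds, limits and injectivity of the logarithm *)

Section LogBounds.
Variables (R : realType) (m : nat).
Implicit Types (M N : 'M[R[i]]_m.+1) (v : 'cV[R[i]]_m.+1) (z : R[i]).

Lemma mulmx_seg s M v : seg s M *m v = (1 - s)%:C *: v + s%:C *: (M *m v).
Proof. by rewrite /seg mulmxDl mul_scalar_mx -scalemxAl. Qed.

Lemma dotc_seg s M v : dotc v (seg s M *m v) =
  ((1 - s) * vnorm v ^+ 2)%:C + s%:C * dotc v (M *m v).
Proof.
rewrite mulmx_seg dotcDr !dotcZr dotcc; congr (_ + _).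
by apply: complexP; rewrite /=; ring.
Qed.

Lemma seglow_Re M (c : R) : 0 < c ->
  (forall v, c * vnorm v ^+ 2 <= complex.Re (dotc v (M *m v))) -> seglow M (Num.min 1 c).
Proof.
move=> c0 h; split; first by rewrite lt_min ltr01.
move=> s /andP[s0 s1]; apply: lower_Re => v; rewrite dotc_seg !ReImE/= mul0r subr0.
have hv := h v; have v0 := sqr_ge0 (vnorm v).
have m1 : Num.min 1 c <= 1 by rewrite ge_min lexx.
have mc : Num.min 1 c <= c by rewrite ge_min lexx orbT.
set mm := Num.min 1 c in m1 mc *; set q := vnorm v ^+ 2 in v0 hv *.
have e1 : (1 - s) * q * mm <= (1 - s) * q by rewrite ler_piMr// mulr_ge0// subr_ge0.
have e2 : s * (mm * q) <= s * complex.Re (dotc v (M *m v)).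
  by rewrite ler_wpM2l//; apply: le_trans hv; rewrite ler_wpM2r.
have -> : mm * q = (1 - s) * q * mm + s * (mm * q) by ring.
exact: lerD.
Qed.

(** For [s] below [(2 * (1 + K))^-1] the matrix [seg s M] is so close to the identity that its lower
    bound exceeds one half; for larger [s] the imaginary part of the form, of size at least [s * c],
    takes over. *)
Lemma seglow_Im M (c K : R) : 0 < c -> 0 <= K -> mbound M K ->
  (forall v, c * vnorm v ^+ 2 <= `|complex.Im (dotc v (M *m v))|) ->
  seglow M (Num.min 2^-1 (c / (2 * (1 + K)))).
Proof.
move=> c0 K0 hK h; have K1 : 0 < 2 * (1 + K) by rewrite mulr_gt0// ltr_wpDr.
split; first by rewrite lt_min divr_gt0// invr_gt0 ltr0n.
move=> s /andP[s0 s1] v; have v0 := vnorm_ge0 v.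
have [ss|ss] := leP (2 * (1 + K))^-1 s.
  apply: le_trans (_ : c / (2 * (1 + K)) * vnorm v <= _).
    by rewrite ler_wpM2r// ge_min lexx orbT.
  apply: lower_Im => {v0}v; rewrite dotc_seg !ReImE/= add0r mul0r addr0.
  rewrite normrM (ger0_norm s0) [c / _]mulrC -mulrA ler_pM ?invr_ge0 ?(ltW K1)//.
  by rewrite mulr_ge0 ?sqr_ge0// ltW.
apply: le_trans (_ : 2^-1 * vnorm v <= _); first by rewrite ler_wpM2r// ge_min lexx.
have sK : s * (2 * (1 + K)) < 1 by rewrite -ltr_pdivlMr// mul1r.
have : vnorm ((1 - s)%:C *: v) <= vnorm (seg s M *m v) + vnorm (s%:C *: (M *m v)).
  rewrite -[(1 - s)%:C *: v](addrK (s%:C *: (M *m v))) -mulmx_seg.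
  exact: vnormB.
rewrite !vnormZ !cnorm_real (ger0_norm s0) ger0_norm ?subr_ge0// => h1.
have h2 : s * vnorm (M *m v) <= s * (K * vnorm v) by rewrite ler_wpM2l.
nra.
Qed.

Lemma dotc_scalar (x : R[i]) v : dotc v (x%:M *m v) = x * (vnorm v ^+ 2)%:C.
Proof. by rewrite mul_scalar_mx dotcZr dotcc. Qed.

Lemma mbound_scalar n (x : R[i]) (k : R) : cnorm x <= k -> mbound (x%:M : 'M[R[i]]_n) k.
Proof. by move=> xk v; rewrite mul_scalar_mx vnormZ ler_wpM2r ?vnorm_ge0. Qed.

Lemma dotcZmx (a : R[i]) M v : dotc v ((a *: M) *m v) = a * dotc v (M *m v).
Proof. by rewrite -scalemxAl dotcZr. Qed.

Section OneMatrix.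
Variables (M : 'M[R[i]]_m.+1) (c K : R).
Hypothesis (c0 : 0 < c) (K0 : 0 <= K) (hK : mbound M K).
Hypothesis hM : forall v, c * vnorm v ^+ 2 <= complex.Im (dotc v (M *m v)).

Lemma seglow_pm (a : R) : `|a| = 1 -> exists sig, seglow (a%:C *: M) sig.
Proof.
move=> a1; eexists; apply: (seglow_Im c0 K0).
  move=> v; rewrite -scalemxAl vnormZ cnorm_real a1 mul1r; exact: hK.
move=> v; rewrite dotcZmx !ReImE/= mul0r addr0 normrM a1 mul1r.
by apply: le_trans (hM v) _; exact: ler_norm.
Qed.

Lemma seglow_scalar_pm (a d X : R) : `|a| = 1 -> 0 < d -> exists tau, forall z,
  d <= complex.Im z -> cnorm z <= X -> seglow ((a%:C * z)%:M : 'M[R[i]]_m.+1) tau.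
Proof.
move=> a1 d0; exists (Num.min 2^-1 (d / (2 * (1 + `|X|)))) => z dz zX.
apply: seglow_Im => //.
  apply: mbound_scalar; rewrite cnormM cnorm_real a1 mul1r.
  by apply: le_trans zX _; exact: ler_norm.
move=> v; rewrite dotc_scalar !ReImE/= !mul0r !addr0 ?add0r mulr0 add0r.
rewrite normrM normrM a1 mul1r (@ger0_norm _ (vnorm v ^+ 2)) ?sqr_ge0// ler_wpM2r ?sqr_ge0//.
by apply: le_trans dz _; exact: ler_norm.
Qed.

Lemma lnmx_1 : lnmx M = Lmx M.
Proof.
have [sig hs] := seglow_pm (normr1 R).
rewrite (lnmxE c0 hM hs (c := 0)).
- by rewrite scale1r raddf0 addr0.
- by move=> z z0; rewrite mul1r addr0; exact: cln_slog1.
- by move=> d X; exact: seglow_scalar_pm (normr1 R).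
Qed.

Lemma lnmx_N1 : lnmx M = Lmx (- M) + ('i * pi%:C)%:M.
Proof.
have n1 : `|-1 : R| = 1 by rewrite normrN normr1.
have [sig hs] := seglow_pm n1.
rewrite (lnmxE c0 hM hs (c := 'i * pi%:C)).
- by rewrite rmorphN1 scaleN1r.
- by move=> z z0; rewrite rmorphN1 mulN1r; exact: cln_slogN1.
- by move=> d X; exact: seglow_scalar_pm n1.
Qed.

Lemma seglow_Ni : seglow ((- 'i) *: M) (Num.min 1 c).
Proof.
apply: seglow_Re => // v; rewrite dotcZmx !ReImE/=.
by have := hM v; lra.
Qed.

Lemma lnmx_Ni : lnmx M = Lmx ((- 'i) *: M) + ('i * (pi / 2)%:C)%:M.
Proof.
rewrite (lnmxE c0 hM seglow_Ni (c := 'i * (pi / 2)%:C))//.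
- by move=> z z0; exact: cln_slogNi.
- move=> d X d0; exists (Num.min 1 d) => z dz _; apply: seglow_Re => // v.
  rewrite dotc_scalar !ReImE/=; have := sqr_ge0 (vnorm v); nra.
Qed.

(** The logarithm equals both [Lmx M], with nonnegative imaginary part, and [Lmx (- M)] plus
    ['i * pi], where the imaginary part of [Lmx (- M)] is nonpositive. *)
Lemma Im_lnmx_bounds v :
  0 <= complex.Im (dotc v (lnmx M *m v)) <= pi * vnorm v ^+ 2.
Proof.
apply/andP; split.
  rewrite lnmx_1; have [sig] := seglow_pm (normr1 R).
  rewrite scale1r => hs; apply: (Im_Lmx_ge0 _ hs) => u.
  by apply: le_trans (hM u); rewrite mulr_ge0 ?sqr_ge0// ltW.
have n1 : `|-1 : R| = 1 by rewrite normrN normr1.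
have [sig] := seglow_pm n1; rewrite rmorphN1 scaleN1r => hs.
rewrite lnmx_N1 mulmxDl dotcDr dotc_scalar !ReImE/=.
have : complex.Im (dotc v (Lmx (- M) *m v)) <= 0.
  apply: (Im_Lmx_le0 _ hs) => u; rewrite mulNmx dotcNr cImN oppr_le0.
  by apply: le_trans (hM u); rewrite mulr_ge0 ?sqr_ge0// ltW.
lra.
Qed.

End OneMatrix.

(** The imaginary part of the form of [Lmx M0] has both signs, hence is 0. For large [n] the real
    part of [F n] is at least [c / 2], and on such matrices [Lmx] is Lipschitz. *)
Lemma Im_Lmx_limit (F : nat -> 'M[R[i]]_m.+1) M0 (c : R) v : 0 < c ->
  (forall u, complex.Im (dotc u (M0 *m u)) = 0) ->
  (forall u, c * vnorm u ^+ 2 <= complex.Re (dotc u (M0 *m u))) ->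
  (forall e, 0 < e -> \forall n \near \oo, mbound (F n - M0) e) ->
  complex.Im (dotc v (Lmx (F n) *m v)) @[n --> \oo] --> 0.
Proof.
move=> c0 im0 re0 cv; have c20 : 0 < c / 2 by rewrite divr_gt0.
have s0 := seglow_Re c0 re0.
have L0 : complex.Im (dotc v (Lmx M0 *m v)) = 0.
  apply/eqP; rewrite eq_le (Im_Lmx_ge0 _ s0) ?(Im_Lmx_le0 _ s0)// => u; by rewrite im0.
apply/cvgrPdist_le => e e0; rewrite -L0.
pose t := Num.min 1 (c / 2); have t0 : 0 < t by rewrite lt_min ltr01.
have st : 0 < Num.min 1 c by rewrite lt_min ltr01.
pose Q := 2 * (t^-1 * (Num.min 1 c)^-1 * (vnorm v * vnorm v)) + 1.
have Q0 : 0 < Q by rewrite /Q ltr_wpDl// mulr_ge0// !mulr_ge0 ?vnorm_ge0// invr_ge0 ltW.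
pose d := Num.min (c / 2) (e / Q); have d0 : 0 < d by rewrite lt_min c20 divr_gt0.
apply: filterS (cv d d0) => n hn.
have sn : seglow (F n) t.
  apply: seglow_Re => // u.
  have : `|complex.Re (dotc u ((F n - M0) *m u))| <= d * (vnorm u * vnorm u).
    by apply: le_trans (normRe_le _) _; exact: dotc_bound.
  rewrite mulmxBl dotcBr !ReImE ler_norml => /andP[h1 _].
  have h2 := re0 u; have h3 : d <= c / 2 by rewrite ge_min lexx.
  have h4 : d * (vnorm u * vnorm u) <= c / 2 * (vnorm u * vnorm u).
    by rewrite ler_wpM2r// mulr_ge0 ?vnorm_ge0.
  rewrite expr2 in h2 *; lra.
rewrite distrC -cImN -cImD; apply: le_trans (normIm_le _) _.
apply: le_trans (Lmx_lip v v sn s0 (ltW d0) hn) _.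
have de : d * Q <= e by rewrite -ler_pdivlMr// ge_min lexx orbT.
apply: le_trans de; rewrite /Q.
have -> : 2 * (t^-1 * d * (Num.min 1 c)^-1 * (vnorm v * vnorm v)) =
  d * (2 * (t^-1 * (Num.min 1 c)^-1 * (vnorm v * vnorm v))) by ring.
by rewrite ler_wpM2l ?(ltW d0)// lerDl.
Qed.

Lemma pos_min1 (c : R) : 0 < c -> exists2 mc : R, 0 < mc & mc <= 1 /\ mc <= c.
Proof. by exists (Num.min 1 c); rewrite ?lt_min ?ltr01// !ge_min !lexx orbT. Qed.

Lemma pos_prod (a b : R) : 0 < a -> 0 < b -> exists2 k, 0 < k & k = a * b.
Proof. by move=> a0 b0; exists (a * b) => //; exact: mulr_gt0. Qed.

Lemma Rintegral01_ge (f : R -> R[i]) (k : R) : ccont 0 1 f ->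
  (forall s, 0 <= s <= 1 -> k <= complex.Re (f s)) ->
  k <= \int[@lebesgue_measure R]_(s in `[0, 1]) complex.Re (f s).
Proof.
move=> cf fk.
have -> : k = \int[@lebesgue_measure R]_(s in `[0, 1]) (cst k s).
  by rewrite Rintegral_cst//= lebesgue_measure_itv/= lte_fin ltr01/= oppr0 addr0 mulr1.
apply: le_Rintegral => //.
- exact: (ccont_int_Re (ccont_cst k%:C)).
- exact: ccont_int_Re cf.
Qed.

(** For [y = seg s N *m w] this bounds from below the real part of the form of [segT s N] at [y].
    The form is first estimated by the square of the norm of [w]; since [seg s N] is bounded by
    [2 + K], that norm is at least the norm of [y] divided by [2 + K]. *)
Lemma Re_seg_ge N (c K mc s : R) w : 0 < mc -> mc <= 1 -> mc <= c -> 0 <= K ->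
  mbound N K -> (forall v, c * vnorm v ^+ 2 <= complex.Re (dotc v (N *m v))) ->
  0 <= s <= 1 ->
  mc / (2 + K) ^+ 2 * vnorm (seg s N *m w) ^+ 2 <= complex.Re (dotc (seg s N *m w) w).
Proof.
move=> mc0 m1 mcc K0 hK hN /andP[s0 s1].
have K2 : 0 < 2 + K by lra.
have yw : vnorm (seg s N *m w) <= (2 + K) * vnorm w.
  rewrite mulmx_seg; apply: le_trans (vnormD _ _) _; rewrite !vnormZ !cnorm_real.
  rewrite (ger0_norm s0) ger0_norm ?subr_ge0//.
  have := hK w; have := vnorm_ge0 w; have := vnorm_ge0 (N *m w).
  move=> a1 a2 a3; have : s * vnorm (N *m w) <= vnorm (N *m w) by rewrite ler_piMl.
  have : (1 - s) * vnorm w <= vnorm w by rewrite ler_piMl// lerBlDr lerDl.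
  lra.
have h1 : mc * vnorm w ^+ 2 <= complex.Re (dotc (seg s N *m w) w).
  rewrite dotcC dotc_seg !ReImE/= mul0r subr0.
  have hw := hN w.
  have q0 := sqr_ge0 (vnorm w); set q := vnorm w ^+ 2 in q0 hw *.
  have e1 : (1 - s) * q * mc <= (1 - s) * q by rewrite ler_piMr// mulr_ge0// subr_ge0.
  have e2 : s * (mc * q) <= s * complex.Re (dotc w (N *m w)).
    by rewrite ler_wpM2l//; apply: le_trans hw; rewrite ler_wpM2r.
  have -> : mc * q = (1 - s) * q * mc + s * (mc * q) by ring.
  exact: lerD.
apply: le_trans h1; rewrite -mulrA ler_wpM2l ?(ltW mc0)// ler_pdivrMl ?exprn_gt0//.
rewrite -exprMn lerXn2r ?nnegrE ?vnorm_ge0// mulr_ge0 ?vnorm_ge0//; lra.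
Qed.

(* With [y = (N - n) u], the integrand of [<y, (Lmx N - Lmx n) u>] has a real part
   bounded below by a multiple of [|y| ^ 2]. *)
Lemma Lmx_inj_scalar N (n c : R) : 0 < n -> 0 < c ->
  (forall v, c * vnorm v ^+ 2 <= complex.Re (dotc v (N *m v))) ->
  Lmx N = Lmx (n%:C%:M) -> N = n%:C%:M.
Proof.
move=> n0 c0 hN hL.
have [mc mc0 [m1 mcc]] := pos_min1 c0.
have sN := seglow_Re c0 hN.
have sn : seglow (n%:C%:M : 'M[R[i]]_m.+1) (Num.min 1 n).
  apply: (seglow_Re n0) => v; rewrite (dotc_scalar n%:C v).
  by rewrite cReM/= mulr0 subr0.
have [K K0 hK] := mbound_exists N.
pose t s := ((1 - s) + s * n)^-1.
pose mn := Num.min 1 n.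
have segn s : seg s (n%:C%:M : 'M[R[i]]_m.+1) = ((1 - s) + s * n)%:C%:M.
  by rewrite /seg scale_scalar_mx -raddfD/= -rmorphM -rmorphD.
have Tn s : segT s (n%:C%:M : 'M[R[i]]_m.+1) = (t s)%:C%:M.
  have E : ((1 - s + s * n)%:C)^-1 = (t s)%:C :> R[i] by rewrite /t fmorphV.
  by rewrite /segT segn invmx_scalar E.
clear segn; move: (n%:C%:M) sn Tn hL => S sn Tn hL.
apply/eqP; rewrite -subr_eq0; apply/eqP/dotc_polar => u0.
suff -> : (N - S) *m u0 = 0 by rewrite dotc0r.
pose y := (N - S) *m u0.
have /eqP : dotc y ((Lmx N - Lmx S) *m u0) = 0 by rewrite hL subrr mul0mx dotc0r.
have cT := mccont_TXT (N - S) sN sn.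
rewrite (Lmx_sub sN sn) (dotc_mint _ _ cT) => /eqP/(congr1 (@complex.Re R)) /= I0.
have cI := ccont_dotc y u0 cT.
(* The inverse on the scalar side is the number [t s], whose denominator is a convex combination of
   1 and [n], hence positive and at most [1 + n]. *)
have t_ge s : 0 <= s <= 1 -> (1 + n)^-1 <= t s.
  move=> /andP[s0 s1]; rewrite lef_pV2 ?posrE; [nra|lra|].
  have [->|sn1] := eqVneq s 1; first lra.
  have : s < 1 by rewrite lt_neqAle sn1.
  by have := mulr_ge0 s0 (ltW n0); lra.
have K2 : 0 < 2 + K by lra.
have n1 : 0 < (1 + n)^-1 by rewrite invr_gt0; lra.
have q1 : 0 < mc / (2 + K) ^+ 2 by exact: divr_gt0 mc0 (exprn_gt0 2 K2).
have [k k0 kE] := pos_prod n1 q1.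
have low s : 0 <= s <= 1 -> k * vnorm y ^+ 2 <= complex.Re
    (dotc y (segT s N *m (N - S) *m segT s S *m u0)).
  move=> s01; have uN := seg_unit sN s01.
  rewrite Tn -!mulmxA mul_scalar_mx -2!scalemxAr -/y dotcZr.
  set w := segT s N *m y; have yE : y = seg s N *m w by rewrite /w mulKVmx.
  rewrite cReM/= mul0r subr0 {1}kE -mulrA; apply: ler_pM.
  - exact: ltW.
  - by apply: mulr_ge0; [exact: ltW | exact: sqr_ge0].
  - exact: t_ge.
  - have := @Re_seg_ge N c K mc s w mc0 m1 mcc K0 hK hN s01; rewrite -yE; exact.
have : k * vnorm y ^+ 2 <= 0.
  rewrite -[leRHS]I0; exact: (Rintegral01_ge cI low).
rewrite (pmulr_rle0 _ k0) => y0; apply/eqP; rewrite -vnorm_eq0 -sqrf_eq0 eq_le y0.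
exact: sqr_ge0.
Qed.

End LogBounds.

(** * Matrix-valued Nevanlinna functions *)

Section Herglotz.
Variables (R : realType) (m : nat).
Implicit Types (M : 'M[R[i]]_m.+1) (v : 'cV[R[i]]_m.+1) (z : R[i]).
Implicit Types N G : R[i] -> 'M[R[i]]_m.+1.
Local Notation mu := (@lebesgue_measure R).

Definition posIm (S : set R[i]) N := exists2 c : R, 0 < c &
  forall z, S z -> forall v, c * vnorm v ^+ 2 <= complex.Im (dotc v (N z *m v)).

(** Matrix-valued Nevanlinna functions, with a lower bound for the imaginary part uniform on each
    box: this provides the common [seglow] constant that the logarithm needs in order to be
    holomorphic. *)
Definition nev N := forall e X : R, 0 < e ->
  mqhol (upper_box e X) N /\ posIm (upper_box e X) N.

Definition posImmx M := exists c K : R, [/\ 0 < c, 0 <= K, mbound M K &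
  forall v, c * vnorm v ^+ 2 <= complex.Im (dotc v (M *m v))].

Lemma nev_posImmx N z : nev N -> 0 < complex.Im z -> posImmx (N z).
Proof.
move=> hN z0; have [[N' [K [K0 h]]] [c c0 hc]] := hN _ (cnorm z) z0.
have Sz : upper_box (complex.Im z) (cnorm z) z by split.
by exists c, K; split=> //; [have [] := h z z Sz Sz | exact: hc].
Qed.

Lemma mqholZ S N (a : R[i]) : mqhol S N -> mqhol S (fun z => a *: N z).
Proof.
move=> [N' [K [K0 h]]]; exists (fun z => a *: N' z), (cnorm a * K).
have a0 := cnorm_ge0 a.
split; first exact: mulr_ge0.
move=> z w Sz Sw; have [h1 h2 h3] := h z w Sz Sw.
split; [exact: mboundZ | exact: mboundZ |].
by rewrite scalerA [(z - w) * a]mulrC -scalerA -!scalerBr -mulrA; exact: mboundZ.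
Qed.

(** After rotation by [- 'i] the values have real part bounded below on every box, so the principal
    logarithm applies with uniform constants. *)
Lemma nev_hol N v : nev N -> holU (fun z => dotc v (lnmx (N z) *m v)).
Proof.
move=> hN e X e0; have [mq [c c0 hc]] := hN e X e0.
have := qholD (qhol_Lmx v v (mqholZ (- 'i) mq) (fun z Sz => seglow_Ni c0 (hc z Sz)))
  (qhol_cst (upper_box e X) (dotc v ((('i * (pi / 2)%:C)%:M : 'M[R[i]]_m.+1) *m v))).
apply: eq_qhol => z Sz; rewrite (lnmx_Ni c0 (hc z Sz)) mulmxDl dotcDr.
by [].
Qed.

Lemma nev_bounds N v z : nev N -> 0 < complex.Im z ->
  0 <= complex.Im (dotc v (lnmx (N z) *m v)) <= pi * vnorm v ^+ 2.
Proof.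
by move=> hN /(nev_posImmx hN)[c [K [c0 K0 hK hc]]]; exact: (Im_lnmx_bounds c0 K0 hK hc).
Qed.

Lemma nev_scalar (E : R) : nev (fun z => (z - E%:C)%:M).
Proof.
move=> e X e0; split; last first.
  exists e => // z [ez _] v; rewrite dotc_scalar !ReImE/= oppr0 mulr0 add0r addr0.
  by rewrite ler_wpM2r// sqr_ge0.
exists (fun=> 1%:M), (`|X| + `|E| + 1); split; first by rewrite !addr_ge0.
move=> z w [_ zX] _; split.
- apply: mbound_scalar; apply: le_trans (cnormB _ _) _; rewrite cnorm_real.
  have := ler_norm X; lra.
- by apply: mbound_le (@mbound1 R m.+1); have := normr_ge0 X; have := normr_ge0 E; lra.
- rewrite -raddfB/= scalemx1 -raddfB/=.
  have -> : z - E%:C - (w - E%:C) - (z - w) = 0 by ring.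
  by apply: mbound_scalar; rewrite cnorm0 mulr_ge0 ?sqr_ge0// !addr_ge0.
Qed.

Definition mcvg (F : nat -> 'M[R[i]]_m.+1) M := forall e : R, 0 < e ->
  \forall n \near \oo, mbound (F n - M) e.

Definition posreal M := (forall u, complex.Im (dotc u (M *m u)) = 0) /\
  exists2 c : R, 0 < c & forall u, c * vnorm u ^+ 2 <= complex.Re (dotc u (M *m u)).

Lemma lnmx_lim0 (F : nat -> 'M[R[i]]_m.+1) M v : (forall n, posImmx (F n)) ->
  posreal M -> mcvg F M -> complex.Im (dotc v (lnmx (F n) *m v)) @[n --> \oo] --> (0 : R).
Proof.
move=> gF [M0 [c c0 cM]] FM.
rewrite [X in X @ _ --> _](_ : _ = fun n => complex.Im (dotc v (Lmx (F n) *m v))).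
  exact: Im_Lmx_limit c0 M0 cM FM.
apply/funext => n; have [c' [K [? K0 hK hc]]] := gF n.
by rewrite (@lnmx_1 _ _ _ c' K).
Qed.

Lemma lnmx_limpi (F : nat -> 'M[R[i]]_m.+1) M v : (forall n, posImmx (F n)) ->
  posreal M -> mcvg (fun n => - F n) M ->
  complex.Im (dotc v (lnmx (F n) *m v)) @[n --> \oo] --> (pi * vnorm v ^+ 2 : R).
Proof.
move=> gF [M0 [c c0 cM]] FM.
rewrite [X in X @ _ --> _](_ : _ = fun n => complex.Im (dotc v (Lmx (- F n) *m v)) + pi * vnorm v ^+ 2).
  rewrite -[X in _ --> X]add0r; apply: cvgD; last exact: cvg_cst.
  exact: Im_Lmx_limit c0 M0 cM FM.
apply/funext => n; have [c' [K [? K0 hK hc]]] := gF n.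
rewrite (@lnmx_N1 _ _ _ c' K)// mulmxDl dotcDr dotc_scalar !ReImE/=; congr (_ + _); ring.
Qed.

Lemma inv_near (e : R) : 0 < e -> \forall n \near \oo, n.+1%:R^-1 <= e.
Proof.
move=> e0; have /cvgrPdist_le/(_ e e0) := @cvg_harmonic R.
by apply: filterS => n; rewrite sub0r normrN ger0_norm// invr_ge0.
Qed.

Lemma posreal_scalar (a : R) : 0 < a -> posreal a%:C%:M.
Proof.
move=> a0; split=> [u|]; first by rewrite dotc_scalar !ReImE/= mulr0 mul0r addr0.
by exists a => // u; rewrite dotc_scalar !ReImE/= mulr0 subr0.
Qed.

Lemma scalar_lim (E x : R) v : x != E ->
  complex.Im (dotc v (lnmx ((x +i* n.+1%:R^-1 - E%:C)%:M : 'M[R[i]]_m.+1) *m v)) @[n --> \oo]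
  --> (if x < E then pi * vnorm v ^+ 2 else 0 : R).
Proof.
move=> xE.
have gF n : posImmx ((x +i* n.+1%:R^-1 - E%:C)%:M).
  by apply: (nev_posImmx (nev_scalar E)) => /=; rewrite invr_gt0.
have cF (a : R) : a = 1 \/ a = -1 ->
    mcvg (fun n => a%:C *: (x +i* n.+1%:R^-1 - E%:C)%:M) (a * (x - E))%:C%:M.
  move=> a1 e e0; apply: filterS (inv_near e0) => n ne; rewrite scale_scalar_mx -raddfB/=.
  apply: mbound_scalar.
  have -> : a%:C * (x +i* n.+1%:R^-1 - E%:C) - (a * (x - E))%:C = a%:C * (0 +i* n.+1%:R^-1).
    by apply: complexP => /=; ring.
  have aa : `|a| = 1 by case: a1 => ->; rewrite ?normrN normr1.
  rewrite cnormM cnorm_real aa mul1r.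
  by apply: le_trans (cnorm_le_ReIm _) _; rewrite /= normr0 add0r ger0_norm// invr_ge0.
have [xlE|xgE] := ltP x E.
  have p : 0 < -1 * (x - E) by rewrite mulN1r oppr_gt0 subr_lt0.
  pose F n : 'M[R[i]]_m.+1 := (x +i* n.+1%:R^-1 - E%:C)%:M.
  apply: (@lnmx_limpi F (-1 * (x - E))%:C%:M v gF (posreal_scalar p)) => e e0.
  apply: filterS (cF (-1) (or_intror erefl) e e0) => n; by rewrite rmorphN1 scaleN1r.
have p : 0 < 1 * (x - E) by rewrite mul1r subr_gt0 lt_neqAle eq_sym xE.
pose F n : 'M[R[i]]_m.+1 := (x +i* n.+1%:R^-1 - E%:C)%:M.
apply: (@lnmx_lim0 F (1 * (x - E))%:C%:M v gF (posreal_scalar p)) => e e0.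
by apply: filterS (cF 1 (or_introl erefl) e e0) => n; rewrite rmorph1 scale1r.
Qed.

End Herglotz.

(** * Logarithms of close matrices with small real part *)

Section LmxClose.
Variables (R : realType) (m : nat).
Implicit Types (M N S : 'M[R[i]]_m.+1) (v : 'cV[R[i]]_m.+1).
Local Notation mu := (@lebesgue_measure R).

Lemma is_derive_ratio (d x : R) : 1 - x + x * d != 0 ->
  is_derive x 1 (fun s : R => s / (1 - s + s * d)) ((1 - x + x * d)^-1 ^+ 2).
Proof.
move=> P0; have dP : is_derive x 1 (fun s : R => 1 - s + s * d) (d - 1).
  have -> : (fun s : R => 1 - s + s * d) = (cst 1 - id) + d \*: id.
    by apply/funext => s /=; rewrite [s * d]mulrC.
  by apply: is_derive_eq; rewrite -[_ *: _]/(_ * _); ring.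
have dV := @is_deriveV R (fun s => 1 - s + s * d) x _ 1 P0 dP.
apply: (is_derive_eq (is_deriveM (is_derive_id x 1) dV)).
rewrite /= -![_ *: _]/(_ * _); field; exact: P0.
Qed.

Lemma Rintegral_ratio (W d : R) : 0 < d ->
  \int[mu]_(s in `[0, 1]) (W * (1 - s + s * d)^-1 ^+ 2) = W / d /\
  {within `[0, 1], continuous (fun s : R => W * (1 - s + s * d)^-1 ^+ 2)}.
Proof.
move=> d0; have P0 (s : R) : 0 <= s <= 1 -> 1 - s + s * d != 0.
  move=> /andP[s0 s1]; apply: lt0r_neq0; have [->|sn1] := eqVneq s 1; first lra.
  have : s < 1 by rewrite lt_neqAle sn1.
  by have := mulr_ge0 s0 (ltW d0); lra.
have cg : {within `[0, 1], continuous (fun s : R => W * (1 - s + s * d)^-1 ^+ 2)}.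
  apply: continuous_in_subspaceT => x /set_mem /=; rewrite in_itv/= => /P0 Px.
  have cP : {for x, continuous (fun s : R => 1 - s + s * d)}.
    apply: cvgD; first by apply: cvgB; [exact: cvg_cst | exact: cvg_id].
    by apply: cvgM; [exact: cvg_id | exact: cvg_cst].
  by apply: cvgM; [exact: cvg_cst | apply: cvgM; exact: cvgV].
split=> //; rewrite (Rintegral_FTC2 ltr01 _ cg (F := W \*: (fun s => s / (1 - s + s * d)))) /=.
  by rewrite mul0r scaler0 !subr0 subrr add0r !mul1r.
by move=> x /P0 Px; have dx := is_derive_ratio Px; apply: is_derive_eq.
Qed.

Lemma Re_seg_pos M (d s : R) v : 0 <= s <= 1 ->
  (forall u, d * vnorm u ^+ 2 <= complex.Re (dotc u (M *m u))) ->
  (1 - s + s * d) * vnorm v ^+ 2 <= complex.Re (dotc v (seg s M *m v)).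
Proof.
move=> /andP[s0 s1] hM; rewrite dotc_seg !ReImE/= mul0r subr0 mulrDl -mulrA.
by rewrite lerD2l ler_wpM2l.
Qed.

(* The pointwise bound [(1 - s + s d)^-1 ^ 2] integrates to [1 / d]; its supremum
   [1 / d ^ 2] would be too weak to let [d] tend to [0] with [K = O(d ^ 2)]. *)
Lemma Lmx_close N S (d K : R) v : 0 < d -> 0 <= K ->
  (forall u, d * vnorm u ^+ 2 <= complex.Re (dotc u (N *m u))) ->
  (forall u, d * vnorm u ^+ 2 <= complex.Re (dotc u (S *m u))) ->
  mbound (N - S) K ->
  `|complex.Re (dotc v ((Lmx N - Lmx S) *m v))| <= K / d * vnorm v ^+ 2.
Proof.
move=> d0 K0 hN hS hNS.
have sN := seglow_Re d0 hN; have sS := seglow_Re d0 hS.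
have cT := mccont_TXT (N - S) sN sS.
have cI := ccont_dotc v v cT.
rewrite (Lmx_sub sN sS) (dotc_mint _ _ cT) /=.
have [I1 cg] := Rintegral_ratio (K * vnorm v ^+ 2) d0.
have b s : 0 <= s <= 1 -> `|complex.Re (dotc v (segT s N *m (N - S) *m segT s S *m v))| <=
    K * vnorm v ^+ 2 * (1 - s + s * d)^-1 ^+ 2.
  move=> s01; have P0 : 0 < 1 - s + s * d.
    case/andP: s01 => s0 s1; have [->|sn1] := eqVneq s 1; first lra.
    have : s < 1 by rewrite lt_neqAle sn1.
    by have := mulr_ge0 s0 (ltW d0); lra.
  have bT M : (forall u, d * vnorm u ^+ 2 <= complex.Re (dotc u (M *m u))) ->
      mbound (segT s M) (1 - s + s * d)^-1.
    by move=> hM; apply: (mbound_inv P0); apply: lower_Re => u; exact: Re_seg_pos.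
  apply: le_trans (normRe_le _) _; have Pi : 0 <= (1 - s + s * d)^-1 by rewrite invr_ge0 ltW.
  have := dotc_bound v v (mboundM (mulr_ge0 Pi K0) (mboundM Pi (bT N hN) hNS) (bT S hS)).
  by congr (_ <= _); rewrite expr2; ring.
have ih := ccont_int_Re cI.
have ig : mu.-integrable `[0, 1] (EFin \o (fun s : R => K * vnorm v ^+ 2 * (1 - s + s * d)^-1 ^+ 2)).
  by apply: continuous_compact_integrable => //; exact: segment_compact.
have -> : K / d * vnorm v ^+ 2 = K * vnorm v ^+ 2 / d by ring.
rewrite -I1; apply: le_trans (le_normr_Rintegral _ ih) _ => //.
apply: le_Rintegral => //; first exact: integrable_norm ih.
Qed.

End LmxClose.

(** * Determination of a reflectionless Nevanlinna function *)

Section NevanlinnaReflectionless.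
Variables (R : realType) (m : nat).
Implicit Types (M N S : 'M[R[i]]_m.+1) (v : 'cV[R[i]]_m.+1).
Local Notation mu := (@lebesgue_measure R).

Lemma linear_quad_zero (x K d : R) : 0 < d ->
  (forall t, 0 < t <= d -> t * `|x| <= K * t ^+ 2) -> x = 0.
Proof.
move=> d0 h; apply/eqP; rewrite -normr_eq0 eq_le normr_ge0 andbT leNgt; apply/negP => x0.
have K1 : 0 < 2 * (`|K| + 1) by rewrite mulr_gt0// ltr_wpDl.
have [t [t0 td tx]] : exists t, [/\ 0 < t, t <= d & t * (2 * (`|K| + 1)) <= `|x|].
  exists (Num.min d (`|x| / (2 * (`|K| + 1)))); split.
  - by rewrite lt_min d0 divr_gt0.
  - by rewrite ge_min lexx.
  - by rewrite -ler_pdivlMr// ge_min lexx orbT.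
have := h t; rewrite t0 td => /(_ isT); have := ler_norm K; nra.
Qed.

(** A Cauchy-Riemann argument: as the imaginary part vanishes along horizontal segments, the
    derivative is real. Along a vertical line the real part therefore has no first-order
    variation. *)
Lemma holU_real_const (f : R[i] -> R[i]) (x a b : R) : holU f ->
  (forall z, 0 < complex.Im z -> complex.Im (f z) = 0) -> 0 < a -> a <= b ->
  f (x +i* a) = f (x +i* b).
Proof.
move=> hf f0 a0 ab; apply: complexP; last by rewrite !f0//= (lt_le_trans a0).
have [f' [K h]] := hf a (`|x| + 1 + `|b|) a0.
have box (t y : R) : 0 <= t <= 1 -> a <= y <= b -> upper_box a (`|x| + 1 + `|b|) ((x + t) +i* y).
  move=> /andP[t0 t1] /andP[ay yb]; split=> //.
  apply: le_trans (cnorm_le_ReIm _) _ => /=; have := ler_normD x t; have := ler_norm b.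
  rewrite (ger0_norm t0) (ger0_norm (_ : 0 <= y)); lra.
apply: (@quad_const _ (fun y => complex.Re (f (x +i* y))) a b K) => // y z yab zab.
have yB := box 0 y _ yab; have zB := box 0 z _ zab; rewrite addr0 lexx ler01 in yB zB.
have {}yB := yB isT; have {}zB := zB isT.
have d0 : complex.Im (f' (x +i* y)) = 0.
  apply: (@linear_quad_zero _ K 1) => // t /andP[t0 t1].
  have t01 : 0 <= t <= 1 by rewrite (ltW t0).
  have [_ _] := h _ _ (box t y t01 yab) yB.
  have -> : (x + t) +i* y - (x +i* y) = t%:C by apply: complexP => /=; ring.
  rewrite cnorm_real (ger0_norm (ltW t0)); apply: le_trans.
  apply: le_trans (normIm_le _); rewrite !ReImE !f0/=.
  - by rewrite mul0r addr0 subrr sub0r normrN normrM (gtr0_norm t0).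
  - by apply: lt_le_trans a0 _; case/andP: yab.
  - by apply: lt_le_trans a0 _; case/andP: yab.
have [_ _] := h _ _ zB yB.
have -> : (x +i* z) - (x +i* y) = 0 +i* (z - y) by apply: complexP => /=; ring.
have -> : cnorm (0 +i* (z - y)) ^+ 2 = (z - y) ^+ 2 by rewrite cnorm_sqr/= expr0n/= add0r.
apply: le_trans; apply: le_trans (normRe_le _).
by rewrite !ReImE/= d0 mulr0 mul0r subr0 subr0.
Qed.

Lemma Im_half (a b d : R[i]) (w : R) :
  complex.Im (a + (2^-1%:C * b + 2^-1%:C * d) - 'i * w%:C) =
  complex.Im a + (2^-1 * complex.Im b + 2^-1 * complex.Im d) - w.
Proof. by rewrite !ReImE/= !mul0r !addr0 !mul1r add0r. Qed.

Lemma half_bound (a b d p : R) : 0 <= d <= p -> 0 <= b <= p -> 0 <= a <= p ->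
  `|a + (2^-1 * b + 2^-1 * d) - p| <= p.
Proof. by rewrite ler_norml; lra. Qed.

Lemma Lmx_Ni_scalar (a b e : R) :
  Lmx ((- 'i) *: ((a +i* b - e%:C)%:M : 'M[R[i]]_m.+1)) = (slog (b +i* (e - a)))%:M.
Proof.
rewrite scale_scalar_mx Lmx_scalar; congr (slog _)%:M.
by apply: complexP => /=; ring.
Qed.

Lemma dotcDmx v M N : dotc v ((M + N) *m v) = dotc v (M *m v) + dotc v (N *m v).
Proof. by rewrite mulmxDl dotcDr. Qed.

Lemma dotcBmx v M N : dotc v ((M - N) *m v) = dotc v (M *m v) - dotc v (N *m v).
Proof. by rewrite mulmxBl dotcBr. Qed.

(** The three rotations by [- 'i] contribute [p / 2] with weights 1, one half and one half; the
    total [p] is cancelled by the last term, and the scalar logarithms merge into [s3]. *)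
Lemma log_balance v L (s1 s2 s3 : R[i]) (p : R) : s1 + s2 = - (s3 * 2) ->
  dotc v ((L + ('i * (p / 2)%:C)%:M) *m v) +
  (2^-1%:C * dotc v ((s1%:M + ('i * (p / 2)%:C)%:M) *m v) +
   2^-1%:C * dotc v ((s2%:M + ('i * (p / 2)%:C)%:M) *m v)) - 'i * (p * vnorm v ^+ 2)%:C =
  dotc v ((L - s3%:M) *m v).
Proof.
move=> hs; set h := 'i * (p / 2)%:C.
move: (dotc_scalar s1 v) (dotc_scalar s2 v) (dotc_scalar s3 v) (dotc_scalar h v).
move: (s1%:M) (s2%:M) (s3%:M) (h%:M) => M1 M2 M3 Mh e1 e2 e3 eh.
rewrite dotcBmx !dotcDmx e1 e2 e3 eh /h.
move: (dotc v (L *m v)) (vnorm v ^+ 2) => d q.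
have -> : s1 = - (s3 * 2) - s2 by rewrite -hs addrK.
have h2 : 2^-1%:C = 2^-1 :> R[i] by rewrite fmorphV/= rmorph_nat.
by rewrite !rmorphM/= h2; field.
Qed.

Lemma exists_large (y a k Q e Y' : R) : 0 < y -> 0 <= a -> 0 <= k -> 0 <= Q -> 0 < e ->
  exists t, [/\ y <= t, Y' <= t, 2 * a <= t, 2 * k <= t & Q <= e * t /\ 1 <= t].
Proof.
move=> y0 a0 k0 Q0 e0; exists (y + `|Y'| + 2 * a + 2 * k + Q / e + 1).
have q0 : 0 <= Q / e by rewrite divr_ge0// ltW.
have := normr_ge0 Y'; have := ler_norm Y'.
have qe : e * (Q / e) = Q by rewrite mulrC divfK// lt0r_neq0.
move: (Q / e) q0 qe (`|Y'|) => q q0 <- Y1 h1 h2.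
by rewrite ler_pM2l//; split; try lra; split; lra.
Qed.

Variables (G : R[i] -> 'M[R[i]]_m.+1) (Em Ep K Y : R).
Hypothesis hE : Em < Ep.
Hypothesis hG : nev G.
Hypothesis hlo : forall x, x < Em ->
  exists2 M, posreal M & mcvg (fun n => G (x +i* n.+1%:R^-1)) M.
Hypothesis hhi : forall x, Ep < x ->
  exists2 M, posreal M & mcvg (fun n => - G (x +i* n.+1%:R^-1)) M.
Hypothesis hint : forall v, \forall x \ae mu, Em < x < Ep ->
  complex.Im (dotc v (lnmx (G (x +i* n.+1%:R^-1)) *m v)) @[n --> \oo] -->
  (pi / 2 * vnorm v ^+ 2 : R).
Let c0 := (Em + Ep) / 2.
Let c := (Ep - Em) / 4.
Hypothesis K0 : 0 <= K.
Hypothesis hinf : forall y, Y <= y ->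
  mbound (G (c0 +i* y) - ('i * (y^-1)%:C)%:M) (K / y ^+ 2).

(* On the three parts of the real line, [Im ln G] has the boundary values of
   [pi - (Im ln (z - Em) + Im ln (z - Ep)) / 2]. *)
Definition reflf v z : R[i] := dotc v (lnmx (G z) *m v) +
  (2^-1%:C * dotc v (lnmx ((z - Em%:C)%:M) *m v) +
   2^-1%:C * dotc v (lnmx ((z - Ep%:C)%:M) *m v)) - 'i * (pi * vnorm v ^+ 2)%:C.

Lemma reflf_holU v : holU (reflf v).
Proof.
move=> e X e0; apply: qholB; last exact: qhol_cst.
by apply: qholD; [|apply: qholD; apply: qholZ]; apply: nev_hol => //; exact: nev_scalar.
Qed.

Lemma Im_reflf v z : complex.Im (reflf v z) = complex.Im (dotc v (lnmx (G z) *m v)) +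
  (2^-1 * complex.Im (dotc v (lnmx ((z - Em%:C)%:M) *m v)) +
   2^-1 * complex.Im (dotc v (lnmx ((z - Ep%:C)%:M) *m v))) - pi * vnorm v ^+ 2.
Proof. exact: Im_half. Qed.

Lemma ae_neq (a : R) : \forall x \ae mu, x != a.
Proof.
exists [set a]; split; first exact: measurable_set1.
  by rewrite lebesgue_measure_set1.
by move=> x /= /negP; rewrite negbK => /eqP.
Qed.

Lemma reflf_Im0 v z : 0 < complex.Im z -> complex.Im (reflf v z) = 0.
Proof.
move: z; apply: (boundary_Im_zero (K := pi * vnorm v ^+ 2)); first exact: reflf_holU.
  move=> z z0; rewrite Im_reflf.
  have := nev_bounds v hG z0; have := nev_bounds v (nev_scalar m Em) z0.
  have := nev_bounds v (nev_scalar m Ep) z0.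
  exact: half_bound.
have FF : Filter (almost_everywhere mu) := ae_filter_ringOfSetsType mu.
apply: ae_mono (filterI (ae_neq Em) (filterI (ae_neq Ep) (hint v))) => x [xm [xp hx]].
under eq_fun do rewrite Im_reflf.
have lm := @scalar_lim R m Em x v xm; have lp := @scalar_lim R m Ep x v xp.
have gG n : posImmx (G (x +i* n.+1%:R^-1)) by apply: nev_posImmx => //=; rewrite invr_gt0.
have cv L : complex.Im (dotc v (lnmx (G (x +i* n.+1%:R^-1)) *m v)) @[n --> \oo] --> L ->
  L + (2^-1 * (if x < Em then pi * vnorm v ^+ 2 else 0) +
     2^-1 * (if x < Ep then pi * vnorm v ^+ 2 else 0)) - pi * vnorm v ^+ 2 = 0 ->
  complex.Im (dotc v (lnmx (G (x +i* n.+1%:R^-1)) *m v)) +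
  (2^-1 * complex.Im (dotc v (lnmx ((x +i* n.+1%:R^-1 - Em%:C)%:M) *m v)) +
   2^-1 * complex.Im (dotc v (lnmx ((x +i* n.+1%:R^-1 - Ep%:C)%:M) *m v))) - pi * vnorm v ^+ 2
   @[n --> \oo] --> (0 : R).
  move=> hL <-; apply: cvgB; last exact: cvg_cst.
  by apply: cvgD => //; apply: cvgD; apply: cvgM => //; exact: cvg_cst.
have [x1|x1] := ltP x Em.
  have [M pM cM] := hlo x1; apply: (cv _ (lnmx_lim0 v gG pM cM)).
  by rewrite x1 (lt_trans x1 hE); field.
have {}x1 : Em < x by rewrite lt_neqAle eq_sym xm.
have [x2|x2] := ltP x Ep.
  apply: (cv _ (hx _)); first by rewrite x1.
  by rewrite ltNge (ltW x1) x2/=; field.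
have {}x2 : Ep < x by rewrite lt_neqAle eq_sym xp.
have [M pM cM] := hhi x2.
have hl := @lnmx_limpi R m (fun n => G (x +i* n.+1%:R^-1)) M v gG pM cM; apply: (cv _ hl).
by rewrite ltNge (ltW x1) ltNge (ltW x2)/=; ring.
Qed.

(** The modulus of [(z - Em) * (z - Ep)] at [z = c0 +i* y] is [y ^+ 2 + 4 * c ^+ 2]; this is its
    inverse square root. *)
Let cnu (y : R) := (Num.sqrt (y ^+ 2 + 4 * c ^+ 2))^-1.

(** On the vertical line through the centre, the two rotated linear factors are the conjugate
    numbers [y - 2 * c * 'i] and [y + 2 * c * 'i]: their arguments cancel and their moduli agree. *)
Lemma reflf_vertical v (y : R) : 0 < y ->
  reflf v (c0 +i* y) = dotc v ((Lmx ((- 'i) *: G (c0 +i* y)) - Lmx (cnu y)%:C%:M) *m v).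
Proof.
move=> y0; have z0 : 0 < complex.Im (c0 +i* y) by [].
have q0 : 0 < y ^+ 2 + 4 * c ^+ 2.
  by rewrite ltr_pwDl ?exprn_gt0// mulr_ge0// sqr_ge0.
have [d [k [d0 k0 hk hd]]] := nev_posImmx hG z0.
have [dm [km [dm0 km0 hkm hdm]]] := nev_posImmx (nev_scalar m Em) z0.
have [dp [kp [dp0 kp0 hkp hdp]]] := nev_posImmx (nev_scalar m Ep) z0.
rewrite /reflf (lnmx_Ni d0 hd) (lnmx_Ni dm0 hdm) (lnmx_Ni dp0 hdp).
rewrite (Lmx_Ni_scalar c0 y Em) (Lmx_Ni_scalar c0 y Ep) Lmx_scalar.
apply: log_balance.
have -> : Em - c0 = - (2 * c) by rewrite /c0 /c; field.
have -> : Ep - c0 = 2 * c by rewrite /c0 /c; field.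
have nE (s : R) : s ^+ 2 = 1 -> cnorm (y +i* (s * (2 * c))) = Num.sqrt (y ^+ 2 + 4 * c ^+ 2).
  by move=> s1; rewrite cnorm_sqrt/= exprMn s1 mul1r exprMn -natrX.
have n1 := nE 1 (expr1n _ _); have n2 := nE (-1) (sqrr_sign _ 1).
rewrite mul1r in n1; rewrite mulN1r in n2.
have sq0 : 0 < Num.sqrt (y ^+ 2 + 4 * c ^+ 2) by rewrite sqrtr_gt0.
rewrite slogE; last exact: slit_Re.
rewrite slogE; last exact: slit_Re.
rewrite slogE; last by apply: slit_Re; rewrite /= invr_gt0.
rewrite /Parg n1 n2/= mulNr atanN mul0r atan0 mulr0 mulrN.
have -> : cnorm (cnu y)%:C = (Num.sqrt (y ^+ 2 + 4 * c ^+ 2))^-1.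
  by rewrite cnorm_real ger0_norm// invr_ge0 sqrtr_ge0.
rewrite lnV ?posrE//; apply: complexP => /=; ring.
Qed.

(** The root lies between [y] and [y + 2 * |c|], and the latter is at most [2 * y]. *)
Lemma sqrt_expansion (y : R) : 0 < y -> 2 * `|c| <= y ->
  [/\ 0 < cnu y, y^-1 / 2 <= cnu y & `|y^-1 - cnu y| <= 2 * `|c| / y ^+ 2].
Proof.
move=> y0 cy; rewrite /cnu.
have a0 := normr_ge0 c.
have -> : y ^+ 2 + 4 * c ^+ 2 = y ^+ 2 + 4 * `|c| ^+ 2 by rewrite real_normK// num_real.
move: (`|c|) a0 cy => a a0 ay.
have q0 : 0 < y ^+ 2 + 4 * a ^+ 2 by nra.
pose s := Num.sqrt (y ^+ 2 + 4 * a ^+ 2).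
have s0 : 0 < s by rewrite sqrtr_gt0.
have s2 : s ^+ 2 = y ^+ 2 + 4 * a ^+ 2 by rewrite sqr_sqrtr// ltW.
rewrite -/s; clearbody s; have ys : y <= s by nra.
have sy : s <= y + 2 * a by nra.
split; first by rewrite invr_gt0.
  by rewrite -invfM lef_pV2 ?posrE//; [lra | lra].
have -> : y^-1 - s^-1 = (s - y) / (y * s) by field; rewrite !lt0r_neq0.
rewrite ger0_norm; last by rewrite divr_ge0 ?subr_ge0// mulr_ge0// ltW.
apply: ler_pM; rewrite ?subr_ge0 ?invr_ge0//.
- by rewrite mulr_ge0// ltW.
- lra.
- by rewrite lef_pV2 ?posrE ?exprn_gt0 ?mulr_gt0// expr2 ler_pM2l.
Qed.

(** The value does not depend on the height, so it can be computed at a large [t]. There the two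
    matrices differ by [O(t ^- 2)] while their real parts are at least [t^-1 / 2], and [Lmx_close]
    leaves [Q / t]. *)
Lemma reflf_zero v (y : R) : 0 < y -> reflf v (c0 +i* y) = 0.
Proof.
move=> y0; apply/eqP; rewrite -cnorm_eq0 eq_le cnorm_ge0 andbT.
pose Q := (K + 2 * `|c|) * 2 * vnorm v ^+ 2.
have Q0 : 0 <= Q := mulr_ge0 (mulr_ge0 (addr_ge0 K0 (mulr_ge0 (ler0n _ _) (normr_ge0 c))) (ler0n _ _)) (sqr_ge0 _).
apply/ler_addgt0Pr => e e0; rewrite add0r.
have [t [yt Yt ct Kt [Qt t1]]] := @exists_large y `|c| K Q e Y y0 (normr_ge0 c) K0 Q0 e0.
have t0 : 0 < t by lra.
rewrite (holU_real_const c0 (reflf_holU v) (fun z => @reflf_Im0 v z) y0 yt).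
have hi := reflf_Im0 v (t0 : 0 < complex.Im (c0 +i* t)).
apply: le_trans (cnorm_le_ReIm _) _; rewrite hi normr0 addr0 reflf_vertical//.
have [n0 nlow nclose] := sqrt_expansion t0 ct.
have hb := hinf Yt.
have iE : (- 'i) *: G (c0 +i* t) - (t^-1)%:C%:M = (- 'i) *: (G (c0 +i* t) - ('i * (t^-1)%:C)%:M).
  rewrite scalerBr scale_scalar_mx; congr (_ - _%:M).
  by apply: complexP => /=; ring.
have hb2 : mbound ((- 'i) *: G (c0 +i* t) - (t^-1)%:C%:M) (K / t ^+ 2).
  rewrite iE -[_ / _]mul1r; have := @mboundZ _ _ _ _ (- 'i) hb.
  by rewrite cnormN cnorm_i.
have hb3 : mbound ((- 'i) *: G (c0 +i* t) - (cnu t)%:C%:M) ((K + 2 * `|c|) / t ^+ 2).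
  have := mboundD hb2 (mbound_scalar (n := m.+1) (x := (t^-1)%:C - (cnu t)%:C) (k := 2 * `|c| / t ^+ 2) _).
  rewrite raddfB/= addrA subrK -mulrDl; apply.
  by rewrite -rmorphB/= cnorm_real.
have d0 : 0 < t^-1 / 2 by rewrite divr_gt0// invr_gt0.
(* At heights [t] at least [2 * K] the deviation from [t^-1] is at most half of [t^-1], which
   preserves the lower bound of the real part. *)
have tK : K / t ^+ 2 <= t^-1 / 2.
  rewrite ler_pdivrMr ?exprn_gt0// expr2 mulrA [t^-1 / 2]mulrC -[_ * t^-1 * t]mulrA.
  rewrite mulVf ?lt0r_neq0// mulr1; lra.
apply: le_trans (Lmx_close v d0 _ _ _ hb3) _.
- by rewrite divr_ge0 ?sqr_ge0// addr_ge0// mulr_ge0.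
- move=> u; have := dotc_bound u u hb2; have q0 := sqr_ge0 (vnorm u).
  move=> /(le_trans (normRe_le _)); rewrite dotcBmx dotc_scalar cReD cReN -expr2.
  rewrite cReM/= mul0r subr0 ler_norml => /andP[h1 _].
  have := ler_wpM2r q0 tK; lra.
- move=> u; rewrite dotc_scalar cReM/= mul0r subr0.
  by rewrite ler_wpM2r ?sqr_ge0.
have -> : (K + 2 * `|c|) / t ^+ 2 / (t^-1 / 2) * vnorm v ^+ 2 = Q / t.
  by rewrite /Q; field; rewrite lt0r_neq0.
by rewrite ler_pdivrMr.
Qed.

Theorem nev_reflectionless (y : R) : 0 < y ->
  G (c0 +i* y) = ('i * (Num.sqrt (y ^+ 2 + 4 * c ^+ 2))^-1%:C)%:M.
Proof.
move=> y0.
have [d [k [d0 k0 hk hd]]] := nev_posImmx hG (y0 : 0 < complex.Im (c0 +i* y)).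
have n0 : 0 < cnu y.
  by rewrite /cnu invr_gt0 sqrtr_gt0 ltr_pwDl ?exprn_gt0// mulr_ge0// sqr_ge0.
have hL : Lmx ((- 'i) *: G (c0 +i* y)) = Lmx (cnu y)%:C%:M.
  apply/eqP; rewrite -subr_eq0; apply/eqP/dotc_polar => v.
  by rewrite -reflf_vertical// reflf_zero.
have hN u : d * vnorm u ^+ 2 <= complex.Re (dotc u (((- 'i) *: G (c0 +i* y)) *m u)).
  by rewrite dotcZmx !ReImE/=; have := hd u; lra.
have := Lmx_inj_scalar n0 d0 hN hL.
move=> /(congr1 (fun M => 'i *: M)); rewrite scalerA scale_scalar_mx mulrN -expr2.
by rewrite sqr_i opprK scale1r.
Qed.

End NevanlinnaReflectionless.

(** * Square-summable sequences *)

Section SquareSummable.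
Variables (R : realType) (m : nat).
Local Notation vs := (int -> 'cV[R[i]]_m).
Implicit Types (u v w : vs) (a b : int -> R) (n : nat).

(** As [Negz j] is [- (j + 1)], the sum extends over the sites from [- n] to [n - 1]; the boundary
    terms of [isum_telescope] reflect this asymmetry. *)
Definition isum n a : R := \sum_(0 <= j < n) (a j%:Z + a (Negz j)).

(** The enumeration 0, -1, 1, -2, 2 and so on, whose first [2 n] terms are the sites of [isum n]. It
    turns the unordered sum over the integers into a series. *)
Definition zigzag n : int := if odd n then Negz n./2 else Posz n./2.

Lemma zigzag_bij : set_bij [set: nat] [set: int] zigzag.
Proof.
split=> //.
- move=> p q _ _; rewrite /zigzag => h; rewrite -[p]odd_double_half -[q]odd_double_half.
  by move: h; case: (odd p); case: (odd q) => //= -[->].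
- move=> [k|k] _ /=; [exists k.*2 | exists k.*2.+1] => //; rewrite /zigzag /=.
    by rewrite odd_double doubleK.
  by rewrite odd_double/= uphalf_double.
Qed.

Lemma isum_zigzag n a : \sum_(0 <= j < n.*2) a (zigzag j) = isum n a.
Proof.
elim: n => [|n IH]; first by rewrite /isum !big_geq.
rewrite doubleS !big_nat_recr//= IH /isum big_nat_recr//= -addrA; congr (_ + (_ + _)).
  by rewrite /zigzag odd_double doubleK.
by rewrite /zigzag /= odd_double/= uphalf_double.
Qed.

Lemma isumS n a : isum n.+1 a = isum n a + (a n%:Z + a (Negz n)).
Proof. by rewrite /isum big_nat_recr. Qed.

Lemma eq_isum n a b : (forall k, a k = b k) -> isum n a = isum n b.
Proof. by move=> h; apply: eq_bigr => j _; rewrite !h. Qed.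

Lemma isumD n a b : isum n (fun k => a k + b k) = isum n a + isum n b.
Proof. by rewrite /isum -big_split/=; apply: eq_bigr => j _; ring. Qed.

Lemma isumZ n (c : R) a : isum n (fun k => c * a k) = c * isum n a.
Proof. by rewrite /isum mulr_sumr; apply: eq_bigr => j _; ring. Qed.

Lemma isumB n a b : isum n (fun k => a k - b k) = isum n a - isum n b.
Proof. by rewrite -mulN1r -isumZ -isumD; apply: eq_isum => k; rewrite mulN1r. Qed.

Lemma isum_le n a b : (forall k, a k <= b k) -> isum n a <= isum n b.
Proof. by move=> h; apply: ler_sum => j _; exact: lerD. Qed.

Lemma isum_telescope n a : isum n (fun k => a k - a (k - 1)) = a (n%:Z - 1) - a (- n%:Z - 1).
Proof.
elim: n => [|n IH]; first by rewrite /isum big_geq// oppr0 subrr.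
rewrite isumS IH.
have -> : n.+1%:Z - 1 = n%:Z by rewrite -addn1 PoszD addrK.
have -> : Negz n = - n%:Z - 1 by rewrite NegzE -addn1 PoszD opprD.
have -> : - n.+1%:Z = - n%:Z - 1 by rewrite -addn1 PoszD opprD.
by ring.
Qed.

Definition sqn u k : R := vnorm (u k) ^+ 2.
Definition nsq u : R := fine (l2sum u).

Lemma l2sum_series u : l2sum u = \big[+%E/0%E]_(0 <= i <oo) (sqn u (zigzag i))%:E.
Proof.
rewrite /l2sum (reindex_esum _ _ _ _ zigzag_bij) nneseries_esumT// => n.
by rewrite lee_fin sqr_ge0.
Qed.

Lemma isum_le_l2sum u n : ((isum n (sqn u))%:E <= l2sum u)%E.
Proof.
rewrite l2sum_series -isum_zigzag -sumEFin.
by apply: nneseries_lim_ge => i _ _; rewrite lee_fin sqr_ge0.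
Qed.

Lemma l2sum_le u (M : R) : (forall n, isum n (sqn u) <= M) -> (l2sum u <= M%:E)%E.
Proof.
move=> h; rewrite l2sum_series; apply: lime_le.
  by apply: is_cvg_nneseries => i _ _; rewrite lee_fin sqr_ge0.
apply: nearW => n; rewrite sumEFin lee_fin; apply: le_trans (h n).
rewrite -isum_zigzag -addnn (big_cat_nat _ (leq_addr n n))//=.
by rewrite lerDl sumr_ge0// => i _; rewrite sqr_ge0.
Qed.

Lemma l2sum_fin u : l2 u -> l2sum u = (nsq u)%:E.
Proof.
move=> hu; rewrite /nsq fineK// ge0_fin_numE//.
by apply: le_trans (isum_le_l2sum u 0); rewrite /isum big_geq.
Qed.

Lemma isum_le_nsq u n : l2 u -> isum n (sqn u) <= nsq u.
Proof. by move=> hu; rewrite -lee_fin -l2sum_fin//; exact: isum_le_l2sum. Qed.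

Lemma l2_bounded u (M : R) : (forall n, isum n (sqn u) <= M) -> l2 u /\ nsq u <= M.
Proof.
move=> h; have hl := l2sum_le h; have hu : l2 u := le_lt_trans hl (ltry M).
by split=> //; rewrite -lee_fin -l2sum_fin.
Qed.

Lemma nsq_ge0 u : l2 u -> 0 <= nsq u.
Proof. by move=> hu; apply: le_trans (isum_le_nsq 0 hu); rewrite /isum big_geq. Qed.

Lemma isum_mono u : {homo (fun n => isum n (sqn u)) : p q / (p <= q)%N >-> p <= q}.
Proof.
move=> p q pq; rewrite /isum (big_cat_nat _ pq)//= lerDl sumr_ge0// => i _.
by rewrite addr_ge0// sqr_ge0.
Qed.

Lemma isum_cvg u : l2 u -> isum n (sqn u) @[n --> \oo] --> nsq u.
Proof.
move=> hu; have cv : cvgn (fun n => isum n (sqn u)).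
  apply: nondecreasing_is_cvgn; first exact: isum_mono.
  by exists (nsq u) => _ [n _ <-]; exact: isum_le_nsq.
suff -> : nsq u = limn (fun n => isum n (sqn u)) by [].
apply/eqP; rewrite eq_le; apply/andP; split.
  apply: (l2_bounded _).2 => n; apply: nondecreasing_cvgn_le => //; exact: isum_mono.
by apply: limr_le => //; apply: nearW => n; exact: isum_le_nsq.
Qed.

Lemma sqn_le_nsq u k : l2 u -> sqn u k <= nsq u.
Proof.
move=> hu; have p n : 0 <= isum n (sqn u) by apply: sumr_ge0 => j _; rewrite addr_ge0// sqr_ge0.
case: k => n; apply: le_trans (isum_le_nsq n.+1 hu); rewrite isumS.
  have := p n; have : 0 <= sqn u (Negz n) by exact: sqr_ge0.
  lra.
have := p n; have : 0 <= sqn u n%:Z by exact: sqr_ge0.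
lra.
Qed.

Lemma sqn_lim u : l2 u -> sqn u n%:Z + sqn u (Negz n) @[n --> \oo] --> (0 : R).
Proof.
move=> hu; have h := isum_cvg hu.
have h2 : isum n.+1 (sqn u) @[n --> \oo] --> nsq u by rewrite (cvg_shiftS (fun n => isum n (sqn u))).
have -> : (fun n => sqn u n%:Z + sqn u (Negz n)) = (fun n => isum n.+1 (sqn u) - isum n (sqn u)).
  by apply/funext => n; rewrite isumS; ring.
by rewrite -(subrr (nsq u)); exact: cvgB.
Qed.

Lemma l2D u v : l2 u -> l2 v -> l2 (fun k => u k + v k).
Proof.
move=> hu hv; apply: (l2_bounded (M := 2 * nsq u + 2 * nsq v) _).1 => n.
apply: le_trans (_ : 2 * isum n (sqn u) + 2 * isum n (sqn v) <= _).
  by rewrite -!isumZ -isumD; apply: isum_le => k; exact: vnorm_sqrD.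
by rewrite lerD// ler_pM2l//; exact: isum_le_nsq.
Qed.

Lemma sqnZ c u k : sqn (fun k => c *: u k) k = cnorm c ^+ 2 * sqn u k.
Proof. by rewrite /sqn vnormZ exprMn. Qed.

Lemma l2_nsqZ c u : l2 u -> l2 (fun k => c *: u k) /\ nsq (fun k => c *: u k) = cnorm c ^+ 2 * nsq u.
Proof.
move=> hu; have e n : isum n (sqn (fun k => c *: u k)) = cnorm c ^+ 2 * isum n (sqn u).
  by rewrite -isumZ; apply: eq_isum => k; exact: sqnZ.
have hc : l2 (fun k => c *: u k).
  apply: (l2_bounded (M := cnorm c ^+ 2 * nsq u) _).1 => n; rewrite e.
  by rewrite ler_wpM2l ?sqr_ge0//; exact: isum_le_nsq.
split=> //; have := isum_cvg hc; under eq_fun do rewrite e.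
move=> h1; 
have h2 : cnorm c ^+ 2 * isum n (sqn u) @[n --> \oo] --> cnorm c ^+ 2 * nsq u.
  by apply: cvgM; [exact: cvg_cst | exact: isum_cvg].
exact: (cvg_unique _ h1 h2).
Qed.

Lemma l2Z c u : l2 u -> l2 (fun k => c *: u k).
Proof. by move=> hu; case: (l2_nsqZ c hu). Qed.

Definition rdot u v k : R := complex.Re (dotc (u k) (v k)).
(* The real part of the scalar product, defined by polarization. *)
Definition pair u v : R := (nsq (fun k => u k + v k) - nsq u - nsq v) / 2.

Lemma sqnD u v k : sqn (fun k => u k + v k) k = sqn u k + sqn v k + 2 * rdot u v k.
Proof.
have := dotcc (u k + v k); rewrite dotcDl !dotcDr (dotcC (u k) (v k)) !dotcc.
move=> /(congr1 (@complex.Re R)) /=; rewrite /sqn /rdot => <-.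
by rewrite !ReImE/=; ring.
Qed.

Lemma pair_cvg u v : l2 u -> l2 v -> isum n (rdot u v) @[n --> \oo] --> pair u v.
Proof.
move=> hu hv; rewrite /pair.
have -> : (fun n => isum n (rdot u v)) =
    (fun n => (isum n (sqn (fun k => u k + v k)) - isum n (sqn u) - isum n (sqn v)) / 2).
  by apply/funext => n; rewrite (eq_isum n (sqnD u v)) 2!isumD isumZ; field.
by apply: cvgM; [apply: cvgB; [apply: cvgB|]|exact: cvg_cst]; apply: isum_cvg => //; exact: l2D.
Qed.

(** The working tool for [pair]: identities between real scalar products reduce to identities
    between terms of the partial sums. *)
Lemma pair_unique u v (x : R) : l2 u -> l2 v -> isum n (rdot u v) @[n --> \oo] --> x -> pair u v = x.
Proof. by move=> hu hv hx; apply: (cvg_unique _ (pair_cvg hu hv) hx). Qed.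

Lemma pairuu u : l2 u -> pair u u = nsq u.
Proof.
move=> hu; apply: pair_unique => //.
have -> : (fun n => isum n (rdot u u)) = (fun n => isum n (sqn u)).
  by apply/funext => n; apply: eq_isum => k; rewrite /rdot dotcc.
exact: isum_cvg.
Qed.

Lemma pairC u v : pair u v = pair v u.
Proof.
rewrite /pair; have -> : (fun k => u k + v k) = (fun k => v k + u k).
  by apply/funext => k; rewrite addrC.
by ring.
Qed.

Lemma pairDr u v w : l2 u -> l2 v -> l2 w -> pair u (fun k => v k + w k) = pair u v + pair u w.
Proof.
move=> hu hv hw; apply: pair_unique => //; first exact: l2D.
have -> : (fun n => isum n (rdot u (fun k => v k + w k))) =
    (fun n => isum n (rdot u v) + isum n (rdot u w)).
  apply/funext => n; rewrite -isumD; apply: eq_isum => k.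
  by rewrite /rdot dotcDr cReD.
by apply: cvgD; exact: pair_cvg.
Qed.

Lemma pairZr u v (c : R) : l2 u -> l2 v -> pair u (fun k => c%:C *: v k) = c * pair u v.
Proof.
move=> hu hv; apply: pair_unique => //; first exact: l2Z.
have -> : (fun n => isum n (rdot u (fun k => c%:C *: v k))) = (fun n => c * isum n (rdot u v)).
  apply/funext => n; rewrite -isumZ; apply: eq_isum => k.
  by rewrite /rdot dotcZr cReM/= mul0r subr0.
by apply: cvgM; [exact: cvg_cst | exact: pair_cvg].
Qed.

Lemma pairDl u v w : l2 u -> l2 v -> l2 w -> pair (fun k => v k + w k) u = pair v u + pair w u.
Proof. by move=> hu hv hw; rewrite pairC pairDr// !(pairC u). Qed.

Lemma pairZl u v (c : R) : l2 u -> l2 v -> pair (fun k => c%:C *: v k) u = c * pair v u.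
Proof. by move=> hu hv; rewrite pairC pairZr// pairC. Qed.

Lemma pair_i u v : l2 u -> l2 v -> pair u (fun k => 'i *: v k) = - pair (fun k => 'i *: u k) v.
Proof.
move=> hu hv; apply: pair_unique => //; first exact: l2Z.
have -> : (fun n => isum n (rdot u (fun k => 'i *: v k))) =
    (fun n => - isum n (rdot (fun k => 'i *: u k) v)).
  apply/funext => n; rewrite -mulN1r -isumZ; apply: eq_isum => k.
  by rewrite /rdot dotcZr dotcZl !ReImE/=; ring.
by apply: cvgN; apply: pair_cvg => //; exact: l2Z.
Qed.

Lemma nsqD u v : l2 u -> l2 v -> nsq (fun k => u k + v k) = nsq u + 2 * pair u v + nsq v.
Proof. by move=> hu hv; rewrite /pair; field. Qed.

Lemma pair_CS u v : l2 u -> l2 v -> pair u v ^+ 2 <= nsq u * nsq v.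
Proof.
move=> hu hv.
have h (t : R) : 0 <= nsq u + 2 * (t * pair u v) + t ^+ 2 * nsq v.
  rewrite -pairZr//; have [hz e] := l2_nsqZ t%:C hv.
  rewrite -[t ^+ 2]real_normK ?num_real// -cnorm_real -e -nsqD//.
  by apply: nsq_ge0; exact: l2D.
have u0 := nsq_ge0 hu; have v0 := nsq_ge0 hv.
move: (nsq u) (nsq v) (pair u v) h u0 v0 => x y p h x0 y0.
have [y00|yn0] := eqVneq y 0.
  have [->|p0] := eqVneq p 0; first by rewrite expr0n mulr_ge0.
  (* With [y = 0] the expression is affine in the parameter; at this point its value is -1. *)
  have := h (- (x + 1) / p / 2); rewrite y00 mulr0 addr0.
  have -> : 2 * (- (x + 1) / p / 2 * p) = - (x + 1) by field.
  lra.
have yp : 0 < y by rewrite lt_def yn0.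
(* The minimizer of the quadratic polynomial. *)
have := h (- p / y).
have -> : x + 2 * (- p / y * p) + (- p / y) ^+ 2 * y = (x * y - p ^+ 2) / y by field.
by rewrite pmulr_lge0 ?invr_gt0// subr_ge0.
Qed.

Lemma l2normE u : l2norm u = Num.sqrt (nsq u). Proof. by []. Qed.

Lemma l2norm_ge0 u : 0 <= l2norm u. Proof. exact: sqrtr_ge0. Qed.

Lemma l2norm_sqr u : l2 u -> l2norm u ^+ 2 = nsq u.
Proof. by move=> hu; rewrite sqr_sqrtr ?nsq_ge0. Qed.

Lemma l2normZ c u : l2 u -> l2norm (fun k => c *: u k) = cnorm c * l2norm u.
Proof.
move=> hu; rewrite !l2normE (l2_nsqZ c hu).2 sqrtrM ?sqr_ge0// sqrtr_sqr.
by rewrite ger0_norm ?cnorm_ge0.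
Qed.

Lemma pair_le u v : l2 u -> l2 v -> `|pair u v| <= l2norm u * l2norm v.
Proof.
move=> hu hv; rewrite -(@ler_pXn2r _ 2) ?nnegrE ?mulr_ge0 ?l2norm_ge0//.
by rewrite exprMn !l2norm_sqr// real_normK ?num_real//; exact: pair_CS.
Qed.

Lemma l2normD u v : l2 u -> l2 v -> l2norm (fun k => u k + v k) <= l2norm u + l2norm v.
Proof.
move=> hu hv; rewrite -(@ler_pXn2r _ 2) ?nnegrE ?addr_ge0 ?l2norm_ge0//.
rewrite l2norm_sqr ?nsqD//; last exact: l2D.
rewrite -(l2norm_sqr hu) -(l2norm_sqr hv).
have := pair_le hu hv; have := ler_norm (pair u v); nra.
Qed.

Lemma vnorm_le_l2norm u k : l2 u -> vnorm (u k) <= l2norm u.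
Proof.
move=> hu; rewrite -(@ler_pXn2r _ 2) ?nnegrE ?l2norm_ge0 ?vnorm_ge0//.
by rewrite l2norm_sqr//; exact: sqn_le_nsq.
Qed.

End SquareSummable.

(** * The Jacobi operator and its resolvent *)

Section JacobiOperator.
Variables (R : realType) (m : nat).
Local Notation vs := (int -> 'cV[R[i]]_m).
Implicit Types (u v w f g : vs) (n : nat) (z : R[i]).

(** The window [p] may differ from [n] because a shift moves the range of summation. *)
Lemma l2_mono u f (K : R) : l2 u -> 0 <= K ->
  (forall n, exists p, isum n (sqn f) <= K ^+ 2 * isum p (sqn u)) ->
  l2 f /\ l2norm f <= K * l2norm u.
Proof.
move=> hu K0 h; have [|hf hn] := @l2_bounded _ _ f (K ^+ 2 * nsq u).
  move=> n; have [p hp] := h n; apply: le_trans hp _.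
  by rewrite ler_wpM2l ?sqr_ge0//; exact: isum_le_nsq.
split=> //; rewrite -(@ler_pXn2r _ 2) ?nnegrE ?mulr_ge0 ?l2norm_ge0//.
by rewrite exprMn !l2norm_sqr.
Qed.

Lemma l2_shiftp u : l2 u -> l2 (shiftp u) /\ l2norm (shiftp u) <= l2norm u.
Proof.
move=> hu; rewrite -[l2norm u]mul1r; apply: l2_mono => // n; exists n.+1.
rewrite expr1n mul1r isumS.
have := isum_telescope n (fun k => sqn u (k + 1)).
have -> : isum n (fun k => sqn u (k + 1) - sqn u (k - 1 + 1)) =
    isum n (sqn (shiftp u)) - isum n (sqn u).
  by rewrite -isumB; apply: eq_isum => k; rewrite subrK.
rewrite !subrK => h; have : 0 <= sqn u (- n%:Z) by exact: sqr_ge0.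
have : 0 <= sqn u (Negz n) by exact: sqr_ge0.
lra.
Qed.

Lemma l2_shiftm u : l2 u -> l2 (shiftm u) /\ l2norm (shiftm u) <= l2norm u.
Proof.
move=> hu; rewrite -[l2norm u]mul1r; apply: l2_mono => // n; exists n.+1.
rewrite expr1n mul1r isumS.
have := isum_telescope n (sqn u).
rewrite isumB -/(shiftm (sqn u)) -[shiftm (sqn u)]/(sqn (shiftm u)).
have -> : Negz n = - n%:Z - 1 by rewrite NegzE -addn1 PoszD opprD.
move=> h; have : 0 <= sqn u (n%:Z - 1) by exact: sqr_ge0.
have : 0 <= sqn u n%:Z by exact: sqr_ge0.
lra.
Qed.

Lemma l2_mul (M : int -> 'M[R[i]]_m) (K : R) u : 0 <= K -> (forall k, mbound (M k) K) ->
  l2 u -> l2 (fun k => M k *m u k) /\ l2norm (fun k => M k *m u k) <= K * l2norm u.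
Proof.
move=> K0 hM hu; apply: l2_mono => // n; exists n; rewrite -isumZ; apply: isum_le => k.
rewrite /sqn -exprMn lerXn2r ?nnegrE ?vnorm_ge0 ?mulr_ge0 ?vnorm_ge0//; exact: hM.
Qed.

Variables (A B : int -> 'M[R[i]]_m) (C : R).
Hypothesis (C0 : 0 <= C).
Hypothesis (sA : forall k, selfadjmx (A k)) (sB : forall k, selfadjmx (B k)).
Hypothesis (bA : forall k, mbound (A k) C) (bB : forall k, mbound (B k) C).

Local Notation H := (jacobi A B).

Lemma l2_jacobi u : l2 u -> l2 (H u) /\ l2norm (H u) <= 3 * C * l2norm u.
Proof.
move=> hu; have [p1 p2] := l2_shiftp hu; have [m1 m2] := l2_shiftm hu.
have [a1 a2] := l2_mul C0 bA p1.
have [b1 b2] := l2_mul C0 (fun k => bA (k - 1)) m1.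
have [d1 d2] := l2_mul C0 bB hu.
have ab := l2D a1 b1; split; first exact: l2D ab d1.
apply: le_trans (l2normD ab d1) _.
have -> : 3 * C * l2norm u = C * l2norm u + C * l2norm u + C * l2norm u by ring.
apply: lerD d2; apply: le_trans (l2normD a1 b1) _; apply: lerD.
  exact: le_trans a2 (ler_wpM2l C0 p2).
exact: le_trans b2 (ler_wpM2l C0 m2).
Qed.

Lemma jacobiD u v : H (fun k => u k + v k) = (fun k => H u k + H v k).
Proof.
apply/funext => k; rewrite /jacobi /shiftp /shiftm !mulmxDr.
by rewrite [RHS]addrACA; congr (_ + _); rewrite addrACA.
Qed.

Lemma jacobiZ (c : R[i]) u : H (fun k => c *: u k) = (fun k => c *: H u k).
Proof.
apply/funext => k; rewrite /jacobi /shiftp /shiftm !scalerDr.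
by rewrite -!scalemxAr.
Qed.

(* The difference of the partial sums telescopes to boundary terms. *)
Lemma jacobi_sym u v : l2 u -> l2 v -> pair u (H v) = pair (H u) v.
Proof.
move=> hu hv; have [hHu _] := l2_jacobi hu; have [hHv _] := l2_jacobi hv.
(* The real part of the discrete Wronskian of [u] and [v]; the terms with [B] cancel because [B k]
   is self-adjoint. *)
pose w k := complex.Re (dotc (u k) (A k *m v (k + 1)) - dotc (A k *m u (k + 1)) (v k)).
have wE k : rdot u (H v) k - rdot (H u) v k = w k - w (k - 1).
  rewrite /rdot /jacobi /w /shiftp /shiftm subrK !(dotcDr, dotcDl).
  rewrite (dotc_selfadj _ _ (sB k)) (dotc_selfadj (u k) _ (sA (k - 1))).
  rewrite (dotc_selfadj (u (k - 1)) _ (sA (k - 1))).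
  by do 5! move: (dotc _ _) => ?; rewrite !ReImE; ring.
pose s k := sqn u k + sqn v k.
have wb k : `|w k| <= C * (s k + s (k + 1)).
  apply: le_trans (normRe_le _) _; apply: le_trans (cnormB _ _) _.
  have h1 := dotc_bound (u k) (v (k + 1)) (bA k).
  have h2 : cnorm (dotc (A k *m u (k + 1)) (v k)) <= C * (vnorm (u (k + 1)) * vnorm (v k)).
    by rewrite -(dotc_selfadj _ _ (sA k)); exact: dotc_bound.
  apply: le_trans (lerD h1 h2) _; rewrite -mulrDr ler_wpM2l// /s /sqn.
  have := sqr_ge0 (vnorm (u k) - vnorm (v (k + 1))).
  have := sqr_ge0 (vnorm (u (k + 1)) - vnorm (v k)).
  have := sqr_ge0 (vnorm (u k) + vnorm (v (k + 1))).
  have := sqr_ge0 (vnorm (u (k + 1)) + vnorm (v k)).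
  nra.
apply/eqP; rewrite -subr_eq0; apply/eqP.
have c1 : isum n (fun k => rdot u (H v) k - rdot (H u) v k) @[n --> \oo] -->
    pair u (H v) - pair (H u) v.
  have -> : (fun n => isum n (fun k => rdot u (H v) k - rdot (H u) v k)) =
      (fun n => isum n (rdot u (H v)) - isum n (rdot (H u) v)).
    by apply/funext => n; rewrite isumB.
  by apply: cvgB; exact: pair_cvg.
have c2 : isum n.+1 (fun k => rdot u (H v) k - rdot (H u) v k) @[n --> \oo] -->
    pair u (H v) - pair (H u) v.
  by rewrite (cvg_shiftS (fun n => isum n (fun k => rdot u (H v) k - rdot (H u) v k))).
pose S n : R := s n%:Z + s (Negz n).
have cS : S n @[n --> \oo] --> (0 : R).
  have -> : S = (fun n => (sqn u n%:Z + sqn u (Negz n)) + (sqn v n%:Z + sqn v (Negz n))).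
    by apply/funext => n; rewrite /S /s; ring.
  by rewrite -[X in _ --> X](addr0 0); apply: cvgD; exact: sqn_lim.
have cS1 : S n.+1 @[n --> \oo] --> (0 : R) by rewrite (cvg_shiftS S).
have cb : C * (S n + S n.+1) @[n --> \oo] --> (0 : R).
  rewrite -[X in _ --> X](mulr0 C) -[X in _ --> C * X](addr0 0).
  by apply: cvgM; [exact: cvg_cst | exact: cvgD].
apply: (cvg_unique _ c2) => //; apply/cvgrPdist_le => e e0.
have /cvgrPdist_le/(_ e e0) := cb; apply: filterS => n.
rewrite !sub0r !normrN; apply: le_trans; apply: le_trans (ler_norm _).
rewrite (eq_isum _ wE) isum_telescope.
have -> : n.+1%:Z - 1 = n%:Z by rewrite -addn1 PoszD addrK.
have -> : - n.+1%:Z - 1 = Negz n.+1 by rewrite NegzE -[n.+2]addn1 PoszD opprD.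
apply: le_trans (ler_normB _ _) _; have := wb n%:Z; have := wb (Negz n.+1).
have -> : Negz n.+1 + 1 = Negz n by rewrite !NegzE -[n.+2]addn1 PoszD opprD subrK.
have -> : n%:Z + 1 = n.+1%:Z by rewrite -PoszD addn1.
rewrite /S; lra.
Qed.

End JacobiOperator.

(** * The resolvent and the forms of the diagonal Green's matrix *)

Section Resolvent.
Variables (R : realType) (m : nat).
Local Notation vs := (int -> 'cV[R[i]]_m).
Implicit Types (u f g : vs) (v w : 'cV[R[i]]_m) (n : nat) (z : R[i]).

Variables (A B : int -> 'M[R[i]]_m) (C : R).
Hypothesis (C0 : 0 <= C).
Hypothesis (sA : forall k, selfadjmx (A k)) (sB : forall k, selfadjmx (B k)).
Hypothesis (bA : forall k, mbound (A k) C) (bB : forall k, mbound (B k) C).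

Local Notation H := (jacobi A B).
Local Notation T := (jacobi_sub A B).
Local Notation rs := (resolvent A B).
Local Notation res := (resolvent_set A B).

Let l2H u : l2 u -> l2 (H u). Proof. by move=> /(l2_jacobi C0 bA bB)[]. Qed.

Lemma subE z u : T z u = (fun k => H u k + (- z) *: u k).
Proof. by apply/funext => k; rewrite /jacobi_sub scaleNr. Qed.

Lemma l2_sub z u : l2 u -> l2 (T z u).
Proof. by move=> hu; rewrite subE; apply: l2D; [exact: l2H | exact: l2Z]. Qed.

Lemma l2norm_sub z u : l2 u -> l2norm (T z u) <= (3 * C + cnorm z) * l2norm u.
Proof.
move=> hu; rewrite subE mulrDl; apply: le_trans (l2normD (l2H hu) (l2Z _ hu)) _.
rewrite l2normZ// cnormN lerD2r; exact: (l2_jacobi C0 bA bB hu).2.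
Qed.

Lemma subD z u f : T z (fun k => u k + f k) = (fun k => T z u k + T z f k).
Proof.
by rewrite !subE jacobiD; apply/funext => k; rewrite scalerDr addrACA.
Qed.

Lemma subZ z (c : R[i]) u : T z (fun k => c *: u k) = (fun k => c *: T z u k).
Proof.
by apply/funext => k; rewrite /jacobi_sub jacobiZ scalerBr !scalerA (mulrC c).
Qed.

Lemma sub_shift z z' u : T z u = (fun k => T z' u k + (z' - z) *: u k).
Proof. by apply/funext => k; rewrite /jacobi_sub scalerBl addrA subrK. Qed.

Lemma resolventP z f : res z -> l2 f -> l2 (rs z f) /\ T z (rs z f) = f.
Proof.
move=> [h _] /h[u [hu _]]; rewrite /resolvent; case: xgetP => [y _ //|].
by move=> /(_ u).
Qed.

Lemma resolventK z u : res z -> l2 u -> rs z (T z u) = u.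
Proof.
move=> hz hu; have hT := l2_sub z hu; have [h1 h2] := resolventP hz hT.
case: (hz) => /(_ _ hT)[y [_ uy]] _.
by rewrite -(uy _ (conj h1 h2)) (uy u (conj hu erefl)).
Qed.

Lemma resolventD z f g : res z -> l2 f -> l2 g ->
  rs z (fun k => f k + g k) = (fun k => rs z f k + rs z g k).
Proof.
move=> hz hf hg; have [f1 f2] := resolventP hz hf; have [g1 g2] := resolventP hz hg.
have {1}<- : T z (fun k => rs z f k + rs z g k) = (fun k => f k + g k) by rewrite subD f2 g2.
by rewrite resolventK//; exact: l2D.
Qed.

Lemma resolventZ z (c : R[i]) f : res z -> l2 f ->
  rs z (fun k => c *: f k) = (fun k => c *: rs z f k).
Proof.
move=> hz hf; have [f1 f2] := resolventP hz hf.
have {1}<- : T z (fun k => c *: rs z f k) = (fun k => c *: f k) by rewrite subZ f2.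
by rewrite resolventK//; exact: l2Z.
Qed.

Lemma resolvent_identity z z' f : res z -> res z' -> l2 f ->
  rs z f = (fun k => rs z' f k + (z - z') *: rs z (rs z' f) k).
Proof.
move=> hz hz' hf; have [f1 f2] := resolventP hz' hf; have [g1 g2] := resolventP hz f1.
have h2 := l2Z (z - z') g1.
have {1}<- : T z (fun k => rs z' f k + (z - z') *: rs z (rs z' f) k) = f.
  rewrite subD subZ g2 (sub_shift z z') f2; apply/funext => k.
  by rewrite -addrA -scalerDl addrA subrK subrr scale0r addr0.
by rewrite resolventK//; exact: l2D.
Qed.

Lemma resolvent_diff z z' f k : res z -> res z' -> l2 f ->
  rs z f k - rs z' f k = (z - z') *: rs z (rs z' f) k.
Proof. by move=> hz hz' hf; rewrite {1}(resolvent_identity hz hz' hf) addrC addKr. Qed.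

Lemma resolvent_bounded z : res z -> exists2 K : R, 0 < K &
  forall u, l2 u -> l2norm u <= K * l2norm (T z u).
Proof.
move=> [_ [K hK]]; exists (`|K| + 1); first by rewrite ltr_wpDl.
move=> u hu; apply: le_trans (hK u hu) _; apply: ler_wpM2r; first exact: l2norm_ge0.
by have := ler_norm K; lra.
Qed.

(** [H] is symmetric for the real scalar product and commutes with ['i], whereas multiplication by
    ['i] is antisymmetric: the number is its own opposite. *)
Lemma pair_iH u : l2 u -> pair (fun k => 'i *: u k) (H u) = 0.
Proof.
move=> hu; have h := jacobi_sym C0 sA sB bA bB (l2Z 'i hu) hu.
by rewrite jacobiZ (pairC _ u) (pair_i hu (l2H hu)) in h; lra.
Qed.

Lemma pair_iZ z u : l2 u -> pair (fun k => 'i *: u k) (fun k => z *: u k) = complex.Im z * nsq u.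
Proof.
move=> hu; apply: pair_unique; [exact: l2Z|exact: l2Z|].
have -> : (fun n => isum n (rdot (fun k => 'i *: u k) (fun k => z *: u k))) =
    (fun n => complex.Im z * isum n (sqn u)).
  apply/funext => n; rewrite -isumZ; apply: eq_isum => k.
  by rewrite /rdot dotcZl dotcZr dotcc !ReImE/= /sqn; ring.
by apply: cvgM; [exact: cvg_cst | exact: isum_cvg].
Qed.

Lemma pair_i_sub z u : l2 u -> pair (fun k => 'i *: u k) (T z u) = - (complex.Im z * nsq u).
Proof.
move=> hu; rewrite subE pairDr ?pair_iH//; [|exact: l2Z|exact: l2H|exact: l2Z].
by rewrite add0r pair_iZ// cImN mulNr.
Qed.

(** Pairing [T z u] with ['i u] isolates the imaginary part of [z], and Cauchy-Schwarz concludes. *)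
Lemma sub_lower z u : l2 u -> `|complex.Im z| * l2norm u <= l2norm (T z u).
Proof.
move=> hu; have [u0|u0] := eqVneq (l2norm u) 0; first by rewrite u0 mulr0 l2norm_ge0.
have up : 0 < l2norm u by rewrite lt_def u0 l2norm_ge0.
rewrite -(ler_pM2r up); apply: le_trans (_ : `|pair (fun k => 'i *: u k) (T z u)| <= _).
  by rewrite pair_i_sub// normrN normrM -(l2norm_sqr hu) (ger0_norm (sqr_ge0 _)) expr2 mulrA.
apply: le_trans (pair_le (l2Z 'i hu) (l2_sub z hu)) _.
by rewrite l2normZ// cnorm_i mul1r mulrC.
Qed.

Definition spike (k : int) (v : 'cV[R[i]]_m) : vs := fun j => if j == k then v else 0.

Definition near0 n (k : int) : bool := match k with Posz p => (p < n)%N | Negz p => (p < n)%N end.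

Lemma isum_single n k (a : int -> R) : (forall j, j != k -> a j = 0) ->
  isum n a = if near0 n k then a k else 0.
Proof.
move=> ak; elim: n => [|n IH]; first by rewrite /isum big_geq//; case: k {ak}.
rewrite isumS IH; case: k ak {IH} => p ak; rewrite /near0 ltnS.
  rewrite (ak (Negz n))// addr0; case: (ltngtP p n) => [pn|np|->].
  - by rewrite (ak (Posz n)) ?addr0//; apply/eqP => -[e]; move: pn; rewrite e ltnn.
  - by rewrite (ak (Posz n)) ?addr0//; apply/eqP => -[e]; move: np; rewrite e ltnn.
  - by rewrite add0r.
rewrite (ak (Posz n))// add0r; case: (ltngtP p n) => [pn|np|->].
- by rewrite (ak (Negz n)) ?addr0//; apply/eqP => -[e]; move: pn; rewrite e ltnn.
- by rewrite (ak (Negz n)) ?addr0//; apply/eqP => -[e]; move: np; rewrite e ltnn.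
- by rewrite add0r.
Qed.

Lemma isum_single_cvg k (a : int -> R) : (forall j, j != k -> a j = 0) ->
  isum n a @[n --> \oo] --> a k.
Proof.
move=> ak; apply: cvg_near_cst.
exists (absz k).+1 => // n /= kn; rewrite (isum_single n ak).
suff -> : near0 n k by [].
by case: k {ak} kn => p //= kn; exact: leq_trans kn.
Qed.

Lemma l2_spike k v : l2 (spike k v) /\ l2norm (spike k v) = vnorm v.
Proof.
have a0 j : j != k -> sqn (spike k v) j = 0.
  by move=> /negbTE jk; rewrite /sqn /spike jk vnorm0 expr0n.
have ak : sqn (spike k v) k = vnorm v ^+ 2 by rewrite /sqn /spike eqxx.
have h : l2 (spike k v).
  apply: (l2_bounded (M := vnorm v ^+ 2) _).1 => n; rewrite (isum_single n a0) ak.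
  by case: ifP => // _; exact: sqr_ge0.
split=> //; have := isum_single_cvg a0; rewrite ak => h1.
rewrite l2normE (cvg_unique _ (isum_cvg h) h1)//.
by rewrite sqrtr_sqr ger0_norm// vnorm_ge0.
Qed.

Lemma pair_spike k v u : l2 u -> pair (spike k v) u = complex.Re (dotc v (u k)).
Proof.
move=> hu; have [h _] := l2_spike k v; apply: pair_unique => //.
have a0 j : j != k -> rdot (spike k v) u j = 0.
  by move=> /negbTE jk; rewrite /rdot /spike jk dotc0l.
by have := isum_single_cvg a0; rewrite {2}/rdot /spike eqxx.
Qed.

Lemma spikeD k v w : spike k (v + w) = (fun j => spike k v j + spike k w j).
Proof. by apply/funext => j; rewrite /spike; case: ifP; rewrite ?addr0. Qed.

Lemma spikeZ k c v : spike k (c *: v) = (fun j => c *: spike k v j).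
Proof. by apply/funext => j; rewrite /spike; case: ifP; rewrite ?scaler0. Qed.

(** Stated for any linear [F] because it serves both the resolvent and its square, the latter being
    the derivative of the former. *)
Lemma compressionE (F : vs -> vs) k v :
  (forall f g, l2 f -> l2 g -> F (fun k => f k + g k) = (fun k => F f k + F g k)) ->
  (forall (c : R[i]) f, l2 f -> F (fun k => c *: f k) = (fun k => c *: F f k)) ->
  (\matrix_(i < m, j < m) F (@delta_seq R m k j) k i 0) *m v = F (spike k v) k.
Proof.
move=> FD FZ; pose h w := F (spike k w) k.
have hD w x : h (w + x) = h w + h x.
  by rewrite /h spikeD FD//; exact: (l2_spike _ _).1.
have hZ c w : h (c *: w) = c *: h w by rewrite /h spikeZ FZ//; exact: (l2_spike _ _).1.
have h0 : h 0 = 0 by have := hZ 0 0; rewrite !scale0r.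
rewrite -/(h v) [in RHS](_ : v = \sum_j v j 0 *: delta_mx j 0); last first.
  by rewrite [LHS]matrix_sum_delta; apply: eq_bigr => j _; rewrite big_ord1.
rewrite (big_morph h hD h0); apply/colP => a; rewrite mxE summxE; apply: eq_bigr => j _.
by rewrite hZ !mxE mulrC.
Qed.

Lemma greenE z k v : res z -> green A B z k *m v = rs z (spike k v) k.
Proof.
move=> hz; rewrite /green /Green compressionE//.
- by move=> f g hf hg; exact: resolventD.
- by move=> c f hf; exact: resolventZ.
Qed.

Lemma green_sub z z' k v : res z -> res z' ->
  (green A B z k - green A B z' k) *m v = (z - z') *: rs z (rs z' (spike k v)) k.
Proof.
move=> hz hz'; rewrite mulmxBl (greenE k v hz) (greenE k v hz').
by apply: resolvent_diff => //; exact: (l2_spike k v).1.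
Qed.

Section Forms.
Variables (z : R[i]) (k : int) (v : 'cV[R[i]]_m).
Hypothesis hz : res z.
Let u := rs z (spike k v).

(** The spike is [T z u], so the form of the Green's matrix is the scalar product of [T z u] with
    [u], whose imaginary part only sees [z]. *)
Lemma green_Im : complex.Im (dotc v (green A B z k *m v)) = complex.Im z * nsq u.
Proof.
rewrite greenE// -/u; have [hs _] := l2_spike k v; have [hu uE] := resolventP hz hs.
have := pair_spike k v (l2Z 'i hu); rewrite pairC -{2}uE pair_i_sub//.
by rewrite dotcZr !ReImE/= !mul0r !mul1r sub0r => /oppr_inj.
Qed.

Lemma green_Re : complex.Re (dotc v (green A B z k *m v)) = pair (T z u) u.
Proof.
rewrite greenE// -/u; have [hs _] := l2_spike k v; have [hu uE] := resolventP hz hs.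
by rewrite uE pair_spike.
Qed.

(** The norm of [v] is that of [T z u], and [T z] is bounded by [3 * C + cnorm z]; the added 1 keeps
    the constant invertible. *)
Lemma green_lower : (3 * C + cnorm z + 1)^-1 ^+ 2 * vnorm v ^+ 2 <= nsq u.
Proof.
have [hs sE] := l2_spike k v; have [hu uE] := resolventP hz hs.
have := l2norm_sub z hu; rewrite uE sE => h.
have L0 : 0 < 3 * C + cnorm z + 1 by rewrite ltr_wpDl// addr_ge0 ?cnorm_ge0// mulr_ge0.
rewrite -exprMn -(l2norm_sqr hu) lerXn2r ?nnegrE ?l2norm_ge0//.
  by rewrite mulr_ge0 ?vnorm_ge0// invr_ge0 ltW.
rewrite ler_pdivrMl//; apply: le_trans h _; by rewrite ler_wpM2r ?l2norm_ge0// lerDl.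
Qed.

End Forms.

End Resolvent.

(** An absorption argument for the resolvent near a real point of the resolvent set: the
    perturbation [y * a] enters with a factor at most one half and is moved to the left side. *)
Lemma perturbation_bound (R : realType) (K y a b s r : R) : 0 < K -> y <= (2 * K)^-1 ->
  0 <= a -> a <= K * s -> s <= r + y * a -> r <= K * b -> a <= 2 * K * (K * b).
Proof.
move=> K0 yK a0 h1 h2 h3.
have h4 : K * (y * a) <= 2^-1 * a.
  rewrite mulrA ler_wpM2r//; move: yK; rewrite -[leRHS]mul1r ler_pdivlMr ?mulr_gt0//; lra.
have h5 := ler_wpM2l (ltW K0) (le_trans h2 (lerD h3 (lexx (y * a)))).
lra.
Qed.

(** * Numerical range, analyticity and boundary values of the Green's matrix *)

Section GreenMatrix.
Variables (R : realType) (m : nat).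
Local Notation vs := (int -> 'cV[R[i]]_m.+1).
Implicit Types (u f g : vs) (v w : 'cV[R[i]]_m.+1) (n : nat) (z : R[i]).

Variables (A B : int -> 'M[R[i]]_m.+1) (C : R).
Hypothesis (C0 : 0 <= C).
Hypothesis (sA : forall k, selfadjmx (A k)) (sB : forall k, selfadjmx (B k)).
Hypothesis (bA : forall k, mbound (A k) C) (bB : forall k, mbound (B k) C).

Local Notation H := (jacobi A B).
Local Notation T := (jacobi_sub A B).
Local Notation rs := (resolvent A B).
Local Notation res := (resolvent_set A B).

Lemma pair_sub_real (x : R) u f : l2 u -> l2 f ->
  pair (T x%:C u) f = pair (H u) f - x * pair u f.
Proof.
move=> hu hf; have [hH _] := l2_jacobi C0 bA bB hu.
rewrite subE -rmorphN/= pairDl//; last exact: l2Z.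
by rewrite pairZl// mulNr.
Qed.

Lemma sub_real_sym (x : R) u f : l2 u -> l2 f -> pair (T x%:C u) f = pair u (T x%:C f).
Proof.
move=> hu hf; rewrite (pairC u) !pair_sub_real// (pairC f u); congr (_ - _).
by rewrite -(jacobi_sym C0 sA sB bA bB hu hf) pairC.
Qed.

(* A positive bounded symmetric operator [P] satisfies [|Pu|^2 <= |P| (Pu, u)];
   hence the infimum of the numerical range is not in the resolvent set. *)
Lemma sub_sqr_le (s x : R) u : s ^+ 2 = 1 ->
  (forall f, l2 f -> 0 <= s * pair (T x%:C f) f) -> l2 u ->
  nsq (T x%:C u) <= (3 * C + `|x| + 1) * (s * pair (T x%:C u) u).
Proof.
move=> s1 pos hu; have [L [L0 Lx]] : exists L : R, 0 < L /\ L = 3 * C + `|x| + 1.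
  by exists (3 * C + `|x| + 1); split=> //; rewrite ltr_wpDl// addr_ge0// mulr_ge0.
rewrite -Lx; have ab : `|s| = 1.
  by apply/eqP; rewrite -(@eqrXn2 _ 2)// real_normK ?num_real// s1 expr1n.
pose t := T x%:C u; have ht : l2 t := l2_sub C0 bA bB _ hu.
pose tt := T x%:C t; have htt : l2 tt := l2_sub C0 bA bB _ ht.
have hz := l2Z (- (s / L))%:C ht; have hzz := l2Z (- (s / L))%:C htt.
(* Positivity is tested on [u - (s / L) T u]; expanding and bounding the term of second order by [L]
   gives the claim. *)
have := pos _ (l2D hu hz).
rewrite subD subZ -/t -/tt pairDl ?pairDr//; try exact: l2D.
rewrite !pairZl// !pairZr// (_ : pair tt u = pair t t); last exact: sub_real_sym.
rewrite pairuu// -/t.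
have h1 : s * pair tt t <= L * nsq t.
  apply: le_trans (ler_norm _) _; rewrite normrM ab mul1r.
  apply: le_trans (pair_le htt ht) _; rewrite -(l2norm_sqr ht) expr2 mulrA.
  rewrite ler_wpM2r ?l2norm_ge0//; apply: le_trans (l2norm_sub C0 bA bB _ ht) _.
  by rewrite ler_wpM2r ?l2norm_ge0// Lx cnorm_real lerDl.
move: (nsq t) (pair t u) (pair tt t) h1 => a b c h1 h2.
have h3 : s * (b + - (s / L) * a + (- (s / L) * (a + - (s / L) * c))) =
    s * b - 2 * (a / L) * s ^+ 2 + s ^+ 2 * (s * c / L ^+ 2).
  by field; rewrite lt0r_neq0.
have h4 : s * c / L ^+ 2 <= a / L.
  rewrite ler_pdivrMr ?exprn_gt0//; apply: le_trans h1 _.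
  by rewrite expr2 mulrA divfK ?lt0r_neq0// mulrC.
have h5 : a / L <= s * b.
  rewrite s1 in h3.
  have : 0 <= s * b - 2 * (a / L) * 1 + 1 * (s * c / L ^+ 2).
    by rewrite -h3; move: h2; congr (0 <= _); ring.
  lra.
by rewrite ler_pdivrMr// mulrC in h5.
Qed.

(** Let [x0] be the largest lower bound of the form of [s H]. If it were below [E], then [s * x0]
    would be in the resolvent set with some inverse bound [K], and [sub_sqr_le] would make
    [x0 + (K ^+ 2 * L)^-1] a lower bound too. The sign [s] covers both ends of the spectrum. *)
Lemma numeric_range (s E : R) : s ^+ 2 = 1 -> (forall x, x < E -> res (s * x)%:C) ->
  forall u, l2 u -> E * nsq u <= s * pair (H u) u.
Proof.
move=> s1 hres u0 hu0; rewrite leNgt; apply/negP => hlt.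
have ab : `|s| = 1.
  by apply/eqP; rewrite -(@eqrXn2 _ 2)// real_normK ?num_real// s1 expr1n.
have qb u : l2 u -> `|s * pair (H u) u| <= 3 * C * nsq u.
  move=> hu; have [h1 h2] := l2_jacobi C0 bA bB hu.
  rewrite normrM ab mul1r; apply: le_trans (pair_le h1 hu) _.
  by rewrite -(l2norm_sqr hu) expr2 mulrA ler_wpM2r ?l2norm_ge0.
have n0 : 0 < nsq u0.
  rewrite lt_def nsq_ge0// andbT; apply/eqP => n0.
  by have := qb _ hu0; rewrite n0 mulr0 normr_le0 => /eqP e; rewrite n0 mulr0 e ltxx in hlt.
pose S : set R := [set x | forall u, l2 u -> x * nsq u <= s * pair (H u) u].
have Sub x : S x -> x <= s * pair (H u0) u0 / nsq u0.
  by move=> /(_ _ hu0); rewrite ler_pdivlMr.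
have S0 : S (- (3 * C)).
  by move=> u hu; have := qb u hu; rewrite ler_norml mulNr => /andP[].
have hS : has_sup S by split; [exists (- (3 * C)) | exists (s * pair (H u0) u0 / nsq u0)].
have SE : sup S < E.
  apply: le_lt_trans (_ : s * pair (H u0) u0 / nsq u0 < E); last by rewrite ltr_pdivrMr.
  by apply: sup_le_ub; [exists (- (3 * C)) | exact: Sub].
have Ssup : S (sup S).
  move=> u hu; have [u00|un0] := eqVneq (nsq u) 0.
    by have := S0 u hu; rewrite u00 !mulr0.
  have up : 0 < nsq u by rewrite lt_def un0 nsq_ge0.
  rewrite -ler_pdivlMr//; apply: sup_le_ub; first by exists (- (3 * C)).
  by move=> x /(_ u hu); rewrite ler_pdivlMr.
move: (sup S) (sup_upper_bound hS) SE Ssup => x0 ubS SE Ssup.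
have ss : s * (s * x0) = x0 by rewrite mulrA -expr2 s1 mul1r.
have pos f : l2 f -> 0 <= s * pair (T (s * x0)%:C f) f.
  move=> hf; rewrite pair_sub_real// pairuu//.
  have -> : s * (pair (H f) f - s * x0 * nsq f) = s * pair (H f) f - s * (s * x0) * nsq f by ring.
  by rewrite ss subr_ge0; exact: Ssup.
have [K K0 hK] := resolvent_bounded (hres _ SE).
have [L [L0 Lx]] : exists L : R, 0 < L /\ L = 3 * C + `|s * x0| + 1.
  by exists (3 * C + `|s * x0| + 1); split=> //; rewrite ltr_wpDl// addr_ge0// mulr_ge0.
have Q0 : 0 < K ^+ 2 * L := mulr_gt0 (exprn_gt0 2 K0) L0.
suff : S (x0 + (K ^+ 2 * L)^-1).
  by move=> /ubS; rewrite gerDl invr_le0 leNgt Q0.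
move=> u hu; have ht := l2_sub C0 bA bB (s * x0)%:C hu.
have h1 := sub_sqr_le s1 pos hu; rewrite -Lx in h1.
have h2 : nsq u <= K ^+ 2 * nsq (T (s * x0)%:C u).
  rewrite -(l2norm_sqr hu) -(l2norm_sqr ht) -exprMn.
  by rewrite lerXn2r ?nnegrE ?mulr_ge0 ?l2norm_ge0 ?(ltW K0)//; exact: hK.
have h3 : nsq u <= K ^+ 2 * L * (s * pair (T (s * x0)%:C u) u).
  by apply: le_trans h2 _; rewrite -mulrA ler_wpM2l ?sqr_ge0.
have e3 : s * pair (T (s * x0)%:C u) u = s * pair (H u) u - x0 * nsq u.
  rewrite pair_sub_real// pairuu//.
  have -> : s * (pair (H u) u - s * x0 * nsq u) = s * pair (H u) u - s * (s * x0) * nsq u by ring.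
  by rewrite ss.
rewrite e3 in h3; rewrite mulrDl -lerBrDl ler_pdivrMl//.
Qed.

Lemma resolvent_upper (e : R) z f : 0 < e -> e <= complex.Im z -> res z -> l2 f ->
  l2norm (rs z f) <= e^-1 * l2norm f.
Proof.
move=> e0 ez hz hf; have [h1 h2] := resolventP hz hf.
rewrite ler_pdivlMl// -{2}h2; apply: le_trans (sub_lower C0 sA sB bA bB z h1).
by rewrite ler_wpM2r ?l2norm_ge0//; apply: le_trans ez (ler_norm _).
Qed.

Definition compression (F : vs -> vs) (k : int) : 'M[R[i]]_m.+1 :=
  \matrix_(i < m.+1, j < m.+1) F (@delta_seq R m.+1 k j) k i 0.

(** The derivative of the resolvent is its square; two uses of the resolvent identity leave
    [(z - w) ^+ 2] times a product of three resolvents. The powers of [e^-1] bound one, two and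
    three factors. *)
Lemma mqhol_green (k : int) (e X : R) : 0 < e -> (forall z, complex.Im z != 0 -> res z) ->
  mqhol (upper_box e X) (fun z => green A B z k).
Proof.
move=> e0 hr; have e1 : 0 <= e^-1 by rewrite invr_ge0 ltW.
have hb z : upper_box e X z -> res z.
  by move=> [ez _]; apply: hr; rewrite lt0r_neq0// (lt_le_trans e0).
exists (fun z => compression (fun f => rs z (rs z f)) k), (e^-1 + e^-1 ^+ 2 + e^-1 ^+ 3).
split; first by rewrite !addr_ge0// exprn_ge0.
move=> z w Sz Sw; have hz := hb _ Sz; have hw := hb _ Sw; case: Sz Sw => ez _ [ew _].
have cE v : compression (fun f => rs w (rs w f)) k *m v = rs w (rs w (spike k v)) k.
  apply: (@compressionE R m.+1 (fun f => rs w (rs w f))).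
  - move=> f g hf hg; have [hf1 _] := resolventP hw hf; have [hg1 _] := resolventP hw hg.
    by rewrite !(resolventD C0 bA bB).
  - move=> c f hf; have [hf1 _] := resolventP hw hf.
    by rewrite !(resolventZ C0 bA bB).
split=> v; have [hs sE] := l2_spike k v; have v0 := vnorm_ge0 v.
- have [h1 _] := resolventP hz hs.
  rewrite (greenE C0 bA bB)//; apply: le_trans (vnorm_le_l2norm k h1) _.
  apply: le_trans (resolvent_upper e0 ez hz hs) _; rewrite sE ler_wpM2r//.
  by rewrite -addrA lerDl addr_ge0// exprn_ge0.
- have [h1 _] := resolventP hw hs; have [h2 _] := resolventP hw h1.
  rewrite cE; apply: le_trans (vnorm_le_l2norm k h2) _.
  apply: le_trans (resolvent_upper e0 ew hw h1) _.
  apply: le_trans (ler_wpM2l e1 (resolvent_upper e0 ew hw hs)) _.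
  rewrite sE mulrA -expr2 ler_wpM2r// addrAC lerDr addr_ge0// exprn_ge0//.
- have [h1 _] := resolventP hw hs; have [h2 _] := resolventP hw h1.
  have [h3 _] := resolventP hz h1; have [h4 _] := resolventP hz h2.
  rewrite mulmxBl -scalemxAl cE (green_sub C0 bA bB)// -scalerBr.
  rewrite (resolvent_diff C0 bA bB)// scalerA -expr2.
  rewrite vnormZ cnormX; apply: le_trans (_ : cnorm (z - w) ^+ 2 * (e^-1 ^+ 3 * vnorm v) <= _).
    rewrite ler_wpM2l ?sqr_ge0//; apply: le_trans (vnorm_le_l2norm k h4) _.
    apply: le_trans (resolvent_upper e0 ez hz h2) _; rewrite exprS -mulrA ler_wpM2l//.
    apply: le_trans (resolvent_upper e0 ew hw h1) _; rewrite expr2 -mulrA ler_wpM2l//.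
    by apply: le_trans (resolvent_upper e0 ew hw hs) _; rewrite sE.
  rewrite -mulrA [leRHS]mulrCA; apply: ler_wpM2l; first exact: sqr_ge0.
  apply: ler_wpM2r => //.
  by rewrite lerDr addr_ge0// exprn_ge0.
Qed.

Lemma nev_green (k : int) : (forall z, complex.Im z != 0 -> res z) ->
  nev (fun z => green A B z k).
Proof.
move=> hr e X e0; split; first exact: mqhol_green.
have L0 : 0 < 3 * C + `|X| + 1 by rewrite ltr_wpDl// addr_ge0// mulr_ge0.
exists (e * (3 * C + `|X| + 1)^-1 ^+ 2).
  by apply: mulr_gt0 => //; apply: exprn_gt0; rewrite invr_gt0.
move=> z [ez zX] v; have hz : res z by apply: hr; rewrite lt0r_neq0// (lt_le_trans e0).
have hl := green_lower C0 bA bB k v hz.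
rewrite (green_Im C0 sA sB bA bB)// -mulrA; apply: ler_pM => //; first exact: ltW.
  by rewrite mulr_ge0 ?sqr_ge0// exprn_ge0// invr_ge0 ltW.
apply: le_trans hl; rewrite ler_wpM2r ?sqr_ge0// lerXn2r ?nnegrE ?invr_ge0//.
- by rewrite ltW.
- by rewrite addr_ge0// addr_ge0 ?cnorm_ge0// mulr_ge0.
have z0 := cnorm_ge0 z.
rewrite lef_pV2 ?posrE//; last by rewrite ltr_wpDl// addr_ge0// mulr_ge0.
by rewrite lerD2r lerD2l (le_trans zX) ?ler_norm.
Qed.

(** At a real point the form of the Green's matrix is the form of [H - x] at the solution [u], which
    the numerical range bounds below; [s = 1] is for the left of the band and [s = -1] for the
    right. *)
Lemma posreal_green (s x E : R) (k : int) : s ^+ 2 = 1 -> res x%:C -> s * x < E ->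
  (forall u, l2 u -> E * nsq u <= s * pair (H u) u) ->
  posreal (s%:C *: green A B x%:C k).
Proof.
move=> s1 hx xE hE; split.
  by move=> u; rewrite dotcZmx !ReImE/= (green_Im C0 sA sB bA bB)// mul0r mul0r mulr0 addr0.
have L0 : 0 < 3 * C + cnorm x%:C + 1.
  by rewrite ltr_wpDl// addr_ge0 ?cnorm_ge0// mulr_ge0.
exists ((E - s * x) * (3 * C + cnorm x%:C + 1)^-1 ^+ 2).
  by apply: mulr_gt0; [rewrite subr_gt0 | apply: exprn_gt0; rewrite invr_gt0].
move=> v; rewrite dotcZmx cReM/= mul0r subr0 (green_Re C0 bA bB)//.
have [hs _] := l2_spike k v; have [hu _] := resolventP hx hs.
rewrite pair_sub_real// pairuu// mulrBr.
apply: le_trans (_ : (E - s * x) * nsq (rs x%:C (spike k v)) <= _).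
  rewrite -[leLHS]mulrA; apply: ler_wpM2l; first by rewrite subr_ge0 ltW.
  exact: (green_lower C0 bA bB).
by rewrite mulrBl (mulrA s x) lerD2r; exact: hE.
Qed.

(** The difference is ['i * y] times a product of two resolvents, one of them at [x +i* y]; the
    bound by [y^-1] being useless here, that one is controlled through the inverse bound at [x]. *)
Lemma mcvg_green (x : R) (k : int) : (forall z, complex.Im z != 0 -> res z) -> res x%:C ->
  mcvg (fun n => green A B (x +i* n.+1%:R^-1) k) (green A B x%:C k).
Proof.
move=> hr hx e e0; have [K K0 hK] := resolvent_bounded hx.
(* The first bound permits the absorption, the second makes [y * (2 * K * K)] at most [e]. *)
have d0 : 0 < Num.min ((2 * K)^-1) (e / (2 * K * K)).
  by rewrite lt_min invr_gt0 divr_gt0// !mulr_gt0.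
apply: filterS (inv_near d0) => n; set y := n.+1%:R^-1; rewrite le_min => /andP[y1 y2].
have y0 : 0 < y by rewrite invr_gt0.
clearbody y => v; set z := x +i* y.
have hz : res z by apply: hr; rewrite /= lt0r_neq0.
have [hs sE] := l2_spike k v; have [h1 _] := resolventP hx hs.
have [h2 e2] := resolventP hz h1.
have zx : z - x%:C = 'i * y%:C by apply: complexP => /=; ring.
rewrite (green_sub C0 bA bB k v hz hx) vnormZ zx cnormM cnorm_i mul1r cnorm_real (gtr0_norm y0).
apply: le_trans (ler_wpM2l (ltW y0) (vnorm_le_l2norm k h2)) _.
have b1 : l2norm (rs x%:C (spike k v)) <= K * vnorm v.
  by have := hK _ h1; rewrite (resolventP hx hs).2 sE.
have b2 : l2norm (rs z (rs x%:C (spike k v))) <= 2 * K * (K * vnorm v).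
  have := hK _ h2; rewrite (sub_shift A B x%:C z) e2 => h3.
  have h4 := l2normD h1 (l2Z (z - x%:C) h2).
  rewrite l2normZ// zx cnormM cnorm_i mul1r cnorm_real (gtr0_norm y0) in h4.
  rewrite zx in h3; exact: perturbation_bound K0 y1 (l2norm_ge0 _) h3 h4 b1.
apply: le_trans (ler_wpM2l (ltW y0) b2) _; rewrite !mulrA ler_wpM2r ?vnorm_ge0//.
by rewrite -!mulrA -ler_pdivlMr ?mulr_gt0// !mulrA.
Qed.

End GreenMatrix.

(** * Boundary values and the spectrum *)

Section Boundary.
Variables (R : realType) (m : nat).
Implicit Types (u f g : int -> 'cV[R[i]]_m.+1) (v w : 'cV[R[i]]_m.+1) (n : nat) (z : R[i]).
Variables (A B : int -> 'M[R[i]]_m.+1).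

Lemma Immx_form (L : 'M[R[i]]_m.+1) v : complex.Im (dotc v (L *m v)) = complex.Re (dotc v (Immx L *m v)).
Proof.
rewrite /Immx -scalemxAl dotcZr mulmxBl dotcBr [dotc v (adjmx L *m v)]dotcC -dotc_adj.
move: (dotc v (L *m v)) => [a b].
have -> : (2 * 'i)^-1 = - 'i / 2 :> R[i].
  by rewrite invfM invCi mulrC.
have -> : - 'i / 2 = (- 2^-1)%:C * 'i :> R[i].
  by rewrite rmorphN/= fmorphV/= rmorph_nat mulNr mulrC mulNr.
rewrite !ReImE/=; lra.
Qed.

(* On a family without a limit, [lim] returns [point], here the zero matrix; the
   value [1 / 2] therefore forces convergence. *)
Lemma Xi_cvg (x : R) (k : int) : Xi A B x k = (2^-1)%:M ->
  (pi^-1)%:C *: Immx (lnmx (green A B (x +i* e) k)) @[e --> (0 : R)^'+] --> ((2^-1)%:M : 'M[R[i]]_m.+1).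
Proof.
rewrite /Xi => h; set F := (X in X @ _ --> _).
have cF : cvg (F e @[e --> (0 : R)^'+]).
  apply: contrapT => /dvgP; rewrite h => /matrixP/(_ ord0 ord0).
  rewrite mxE eqxx => e.
  have : (2^-1 : R[i]) != 0 by rewrite invr_neq0// pnatr_eq0.
  have p0 : (point : 'M[R[i]]_m.+1) ord0 ord0 = 0 by rewrite mxE.
  by move: e; rewrite p0 mulr1n => -> /eqP.
by rewrite -h.
Qed.

Lemma right_seq (P : set R) : (\forall e \near (0 : R)^'+, P e) ->
  \forall n \near \oo, P n.+1%:R^-1.
Proof.
move=> [d /= d0 hd]; have d2 : 0 < d / 2 by rewrite divr_gt0.
apply: filterS (inv_near d2) => n nd; apply: hd; last by rewrite /= invr_gt0.
rewrite /= sub0r normrN ger0_norm ?invr_ge0//; apply: le_lt_trans nd _.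
by rewrite ltr_pdivrMr// ltr_pMr// ltr1n.
Qed.

Lemma mx_cvg_seq (F : R -> 'M[R[i]]_m.+1) (M : 'M[R[i]]_m.+1) : F e @[e --> (0 : R)^'+] --> M ->
  forall e : R, 0 < e -> \forall n \near \oo, forall i j, cnorm (F n.+1%:R^-1 i j - M i j) <= e.
Proof.
move=> cF e e0.
have e1 : 0 < e%:C by rewrite ltcR.
have nb : \forall x \near (0 : R)^'+, ball M e%:C (F x) := cvg_ball cF e1.
 apply: filterS (right_seq (nb _)) => n [_ h] i j.
have := h i j; rewrite /ball /= distrC => /ltW.
by rewrite /cnorm lecE => /andP[_].
Qed.

Lemma sum_const2 (n : nat) (x : R) : \sum_(i < n) \sum_(j < n) x = n%:R * n%:R * x.
Proof.
under eq_bigr do rewrite sumr_const card_ord -mulr_natl.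
by rewrite sumr_const card_ord -[LHS]mulr_natl mulrA.
Qed.

Lemma half_form (L : 'M[R[i]]_m.+1) v :
  complex.Re (dotc v (L *m v)) - pi / 2 * vnorm v ^+ 2 =
  pi * complex.Re (dotc v (((pi^-1)%:C *: L - (2^-1)%:M) *m v)) :> R.
Proof.
rewrite (dotcBmx v (_ *: L)) (dotcZmx _ L) (dotc_scalar 2^-1 v).
have -> : (2^-1 : R[i]) = (2^-1)%:C by rewrite fmorphV/= rmorph_nat.
move: (dotc v (L *m v)) (vnorm v ^+ 2) => [a b] q.
have p0 : (pi : R) != 0 := lt0r_neq0 (@pi_gt0 R).
rewrite /= !mul0r !subr0 mulrBr mulrA divff// mul1r; congr (_ - _).
by rewrite mulrA.
Qed.

(** The one-sided matrix limit is restricted to the heights [1 / (n + 1)] and converted from entries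
    to a form; [Q] accounts for the number of entries. *)
Lemma Xi_form (x : R) (k : int) v : Xi A B x k = (2^-1)%:M ->
  complex.Im (dotc v (lnmx (green A B (x +i* n.+1%:R^-1) k) *m v)) @[n --> \oo] -->
  (pi / 2 * vnorm v ^+ 2 : R).
Proof.
move=> /Xi_cvg/mx_cvg_seq h; apply/cvgrPdist_le => e e0.
pose Q := pi * (m.+1%:R * m.+1%:R) * (vnorm v * vnorm v) + 1 : R.
have p0 := @pi_gt0 R.
have Q0 : 0 < Q by rewrite ltr_wpDl// !mulr_ge0 ?vnorm_ge0// ltW.
have eQ : 0 < e / Q by rewrite divr_gt0.
apply: filterS (h _ eQ) => n; rewrite Immx_form.
set L := Immx _ => hL.
have E := half_form L v.
rewrite distrC E normrM (gtr0_norm p0).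
have hb := mbound_entries ((pi^-1)%:C *: L - (2^-1)%:M).
have := dotc_bound v v hb => /(le_trans (normRe_le _)) h1.
apply: le_trans (ler_wpM2l (ltW p0) h1) _.
have h2 : \sum_i \sum_j cnorm (((pi^-1)%:C *: L - (2^-1)%:M) i j) <= m.+1%:R * m.+1%:R * (e / Q).
  apply: le_trans (_ : \sum_(i < m.+1) \sum_(j < m.+1) (e / Q) <= _).
    apply: ler_sum => i _; apply: ler_sum => j _; have := hL i j.
    by rewrite !mxE.
  by rewrite sum_const2.
have vv : 0 <= vnorm v * vnorm v by rewrite mulr_ge0 ?vnorm_ge0.
apply: le_trans (ler_wpM2l (ltW p0) (ler_wpM2r vv h2)) _.
have -> : pi * (m.+1%:R * m.+1%:R * (e / Q) * (vnorm v * vnorm v)) = (Q - 1) * (e / Q).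
  by rewrite /Q addrK; ring.
by rewrite mulrBl mul1r mulrC divfK ?lt0r_neq0// gerBl ltW.
Qed.

End Boundary.

Section SpectrumInterval.
Variables (R : realType) (m : nat) (A B : int -> 'M[R[i]]_m) (Em Ep : R).
Hypothesis hspec : spectrum A B = [set x%:C | x in `[Em, Ep]].

Lemma resolvent_nonreal z : complex.Im z != 0 -> resolvent_set A B z.
Proof.
move=> z0; apply: contrapT => nz; have : spectrum A B z by [].
by rewrite hspec => -[x _ xz]; rewrite -xz /= eqxx in z0.
Qed.

Lemma resolvent_real x : ~~ (Em <= x <= Ep) -> resolvent_set A B x%:C.
Proof.
move=> xE; apply: contrapT => nz; have : spectrum A B x%:C by [].
rewrite hspec => -[y /= yE yx]; by move: yE xE; rewrite in_itv/=; case: yx => -> ->.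
Qed.

(** Every neighbourhood of [x] contains a further point [x + d] of the band, so [x] is not isolated
    in the spectrum. *)
Lemma ess_spectrum_interval x : Em < x < Ep -> ess_spectrum A B x%:C.
Proof.
move=> /andP[x1 x2].
have inS y : Em <= y <= Ep -> spectrum A B y%:C.
  by move=> yE; rewrite hspec; exists y => //=; rewrite in_itv.
split; first by apply: inS; rewrite !ltW.
case=> -[_ [V /nbhs_ballP[e /= e0 eV] VS]] _ _.
pose d := Num.min (complex.Re e / 2) ((Ep - x) / 2).
have er : 0 < complex.Re e by move: e0; rewrite ltcE => /andP[].
have d0 : 0 < d by rewrite lt_min !divr_gt0// subr_gt0.
have d1 : d < complex.Re e.
  by apply: le_lt_trans (_ : complex.Re e / 2 < _); [rewrite ge_min lexx | lra].
have d2 : d <= (Ep - x) / 2 by rewrite ge_min lexx orbT.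
clearbody d; have : [set x%:C] (x + d)%:C.
  rewrite -VS; split; last by apply: inS; apply/andP; split; lra.
  apply: eV; rewrite /ball /= -rmorphB/= opprD addNKr rmorphN/= normrN.
  rewrite normc_def/= expr0n/= addr0 sqrtr_sqr (gtr0_norm d0) ltcE/= d1 andbT.
  by move: e0; rewrite ltcE => /andP[/eqP/= ->].
by move=> /(congr1 (@complex.Re R)) /= h; lra.
Qed.

End SpectrumInterval.

(** * The Neumann expansion at infinity *)

Section Neumann.
Variables (R : realType) (m : nat).
Implicit Types (u f g : int -> 'cV[R[i]]_m) (v w : 'cV[R[i]]_m) (n : nat) (z : R[i]).
Variables (A B : int -> 'M[R[i]]_m) (C c0 : R).
Hypothesis (C0 : 0 <= C).
Hypothesis (sA : forall k, selfadjmx (A k)) (sB : forall k, selfadjmx (B k)).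
Hypothesis (bA : forall k, mbound (A k) C) (bB : forall k, mbound (B k) C).

Local Notation T0 := (jacobi_sub A B c0%:C).
Let L := 3 * C + `|c0|.

Lemma L_ge0 : 0 <= L. Proof. by rewrite addr_ge0// mulr_ge0. Qed.

Lemma iter_subD n u f : iter n T0 (fun k => u k + f k) = (fun k => iter n T0 u k + iter n T0 f k).
Proof. by elim: n => //= n ->; rewrite subD. Qed.

Lemma iter_subZ n (c : R[i]) u : iter n T0 (fun k => c *: u k) = (fun k => c *: iter n T0 u k).
Proof. by elim: n => //= n ->; rewrite subZ. Qed.

Lemma l2_iter_sub n u : l2 u -> l2 (iter n T0 u) /\ l2norm (iter n T0 u) <= L ^+ n * l2norm u.
Proof.
move=> hu; elim: n => [|n [h1 h2]] /=; first by rewrite mul1r.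
split; first exact: (l2_sub C0 bA bB).
apply: le_trans (l2norm_sub C0 bA bB _ h1) _; rewrite cnorm_real exprS -mulrA.
by apply: ler_wpM2l => //; exact: L_ge0.
Qed.

Variables (y : R) (k : int) (v : 'cV[R[i]]_m).
Hypothesis (y0 : 0 < y) (hz : resolvent_set A B (c0 +i* y)).
Let a : R[i] := 'i * (y^-1)%:C.

(* [u = (H - z)^-1 f] satisfies [u = a f - a (H - c0) u] with [a = i / y]. *)
Lemma neumann_green n :
  vnorm (green A B (c0 +i* y) k *m v -
    \sum_(j < n) (a * (- a) ^+ j) *: iter j T0 (spike k v) k) <= L ^+ n / y ^+ n.+1 * vnorm v.
Proof.
have [hs sE] := l2_spike k v; have [hu uE] := resolventP hz hs.
rewrite (greenE C0 bA bB)//; set u := resolvent _ _ _ _ in hu uE *.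
have yn : y != 0 by rewrite lt0r_neq0.
have e1 : u = (fun j => a *: spike k v j + (- a) *: T0 u j).
  apply/funext => j; rewrite scaleNr -scalerBr -{1}uE (sub_shift A B _ c0%:C).
  rewrite addrC addKr scalerA.
  have -> : a * (c0%:C - (c0 +i* y)) = 1.
    rewrite /a; apply: complexP => /=; field; exact: yn.
  by rewrite scale1r.
have e2 j : iter j T0 u = (fun l => a *: iter j T0 (spike k v) l + (- a) *: iter j.+1 T0 u l).
  by rewrite {1}e1 iter_subD !iter_subZ -iterSr.
have e3 : u k - \sum_(j < n) (a * (- a) ^+ j) *: iter j T0 (spike k v) k = (- a) ^+ n *: iter n T0 u k.
  elim: n => [|n IH]; first by rewrite big_ord0 subr0 scale1r.
  have ek : iter n T0 u k = a *: iter n T0 (spike k v) k + (- a) *: iter n.+1 T0 u k by rewrite {1}e2.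
  rewrite big_ord_recr opprD addrA IH {1}ek scalerDr !scalerA exprSr [a * _]mulrC.
  by rewrite addrC addKr.
have [h1 h2] := l2_iter_sub n hu.
rewrite e3 vnormZ cnormX cnormN cnormM cnorm_i mul1r cnorm_real ger0_norm ?invr_ge0 ?(ltW y0)//.
have bu : l2norm u <= y^-1 * vnorm v.
  rewrite -sE -uE ler_pdivlMl//; apply: le_trans (sub_lower C0 sA sB bA bB _ hu).
  by rewrite /= (gtr0_norm y0).
have yi : 0 <= y^-1 by rewrite invr_ge0 ltW.
apply: le_trans (ler_wpM2l (exprn_ge0 n yi) (vnorm_le_l2norm k h1)) _.
apply: le_trans (ler_wpM2l (exprn_ge0 n yi) h2) _.
apply: le_trans (ler_wpM2l (exprn_ge0 n yi) (ler_wpM2l (exprn_ge0 n L_ge0) bu)) _.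
have -> : L ^+ n / y ^+ n.+1 * vnorm v = y^-1 ^+ n * (L ^+ n * (y^-1 * vnorm v)).
  by rewrite exprS invfM exprVn; ring.
by [].
Qed.

End Neumann.

(** * Moments of the Jacobi operator *)

Section Moments.
Variables (R : realType) (m : nat).
Implicit Types (v w : 'cV[R[i]]_m.+1) (M N : 'M[R[i]]_m.+1).

Lemma opnorm_bound (p : nat) (M : 'M[R[i]]_p) : 0 <= opnorm M /\ mbound M (opnorm M).
Proof.
have [K K0 hK] := mbound_exists M.
pose S := [set vnorm (M *m v) | v in [set v : 'cV[R[i]]_p | vnorm v <= 1]].
have S0 : S 0 by exists 0; rewrite /= ?mulmx0 vnorm0// ler01.
have ub : has_sup S.
  split; [by exists 0 | exists K => _ [v /= v1 <-]].
  by apply: le_trans (hK v) _; rewrite ler_piMr.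
have o0 : 0 <= opnorm M by exact: (sup_upper_bound ub).
split=> // v; have [->|v0] := eqVneq v 0; first by rewrite mulmx0 vnorm0 mulr0.
have vp : 0 < vnorm v by rewrite vnorm_gt0.
have : S (vnorm (M *m ((vnorm v)^-1%:C *: v))).
  exists ((vnorm v)^-1%:C *: v) => //=.
  by rewrite vnormZ cnorm_real ger0_norm ?invr_ge0 ?(ltW vp)// mulVf ?lt0r_neq0.
move=> /(sup_upper_bound ub); rewrite -scalemxAr vnormZ cnorm_real ger0_norm ?invr_ge0 ?(ltW vp)//.
by rewrite ler_pdivrMl// mulrC.
Qed.

(** The constant coefficient is [O(t)], hence 0; after division by [t] the induction applies to the
    remaining ones. *)
Lemma vec_poly_zero (n : nat) (x : nat -> 'cV[R[i]]_m.+1) (K : R) :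
  (forall t : R, 0 < t <= 1 -> vnorm (\sum_(j < n) (t ^+ j)%:C *: x j) <= K * t ^+ n) ->
  forall j, (j < n)%N -> x j = 0.
Proof.
elim: n x => // n IH x h.
have x0 : x 0%N = 0.
  apply/eqP; rewrite -vnorm_eq0; apply/eqP.
  apply: (@linear_quad_zero _ _ (`|K| + \sum_(j < n) vnorm (x j.+1)) 1) => // t /andP[t0 t1].
  rewrite ger0_norm ?vnorm_ge0// expr2 mulrCA; apply: ler_wpM2l; first exact: ltW.
  have := h t; rewrite t0 t1 big_ord_recl expr0 scale1r => /(_ isT) h1.
  have h2 := vnormB (x 0%N + \sum_(j < n) (t ^+ (lift ord0 j))%:C *: x (lift ord0 j))
    (\sum_(j < n) (t ^+ (lift ord0 j))%:C *: x (lift ord0 j)).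
  rewrite addrK in h2; apply: le_trans h2 _; rewrite mulrDl; apply: lerD.
    apply: le_trans h1 _; rewrite exprS mulrCA mulrC; apply: ler_wpM2r; first exact: ltW.
    apply: le_trans (ler_norm _) _; rewrite normrM ler_piMr//.
    by rewrite ger0_norm ?exprn_ge0 ?(ltW t0)// exprn_ile1// ltW.
  apply: le_trans (vnorm_sum _ _ _) _; rewrite mulr_suml; apply: ler_sum => j _.
  rewrite vnormZ cnorm_real ger0_norm ?exprn_ge0 ?(ltW t0)// mulrC ler_wpM2l ?vnorm_ge0//.
  by rewrite exprS ler_piMr ?(ltW t0)// exprn_ile1// ltW.
move=> [|j] //; rewrite ltnS; apply: (IH (fun j => x j.+1)) => t /andP[t0 t1].
have := h t; rewrite t0 t1 big_ord_recl x0 scaler0 add0r => /(_ isT).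
have -> : \sum_(i < n) (t ^+ (lift ord0 i))%:C *: x (lift ord0 i) =
    t%:C *: \sum_(i < n) (t ^+ i)%:C *: x i.+1.
  by rewrite scaler_sumr; apply: eq_bigr => i _; rewrite scalerA -rmorphM -exprS.
rewrite vnormZ cnorm_real (gtr0_norm t0) exprS mulrCA.
by rewrite ler_pM2l.
Qed.

(** With [x = c ^+ 2 * t ^+ 2] the root is [t * (1 + 4 * x) ^ (- 1/2)] and [1 - 2 x + 6 x ^+ 2] is
    its Taylor polynomial. The error is read off the difference of the squares, where
    [P ^+ 2 * (1 + 4 * x)] equals 1 up to order [x ^+ 3]. *)
Lemma inv_sqrt_series (c : R) : exists2 K : R, 0 <= K & forall t, 0 < t <= 1 ->
  `|(Num.sqrt (t^-1 ^+ 2 + 4 * c ^+ 2))^-1 - (t - 2 * c ^+ 2 * t ^+ 3 + 6 * c ^+ 4 * t ^+ 5)|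
    <= K * t ^+ 6.
Proof.
have q0 := sqr_ge0 c; set q := c ^+ 2 in q0 *.
have -> : c ^+ 4 = q ^+ 2 by rewrite -exprM.
clearbody q; have w0 : 0 <= 40 + 60 * q + 144 * q ^+ 2 by have := sqr_ge0 q; lra.
exists (6 / 5 * q ^+ 3 * (40 + 60 * q + 144 * q ^+ 2)).
  by apply: mulr_ge0 w0; apply: mulr_ge0 (exprn_ge0 3 q0); lra.
move=> t /andP[t0 t1].
pose s := Num.sqrt (t^-1 ^+ 2 + 4 * q).
have ti : 0 < t^-1 by rewrite invr_gt0.
have p0 : 0 < t^-1 ^+ 2 + 4 * q by rewrite ltr_pwDl ?exprn_gt0// mulr_ge0.
have s0 : 0 < s by rewrite sqrtr_gt0.
have s2 : s ^+ 2 = t^-1 ^+ 2 + 4 * q by rewrite sqr_sqrtr// ltW.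
rewrite -/s; clearbody s.
have tn : t != 0 by rewrite lt0r_neq0.
have [x [x0 xq xE]] : exists x, [/\ 0 <= x, x <= q & x = q * t ^+ 2].
  exists (q * t ^+ 2); split=> //; first by rewrite mulr_ge0 ?sqr_ge0.
  by rewrite ler_piMr// exprn_ile1// ltW.
have [u [u0 uE]] : exists u, 0 < u /\ u = s^-1 by exists s^-1; rewrite invr_gt0.
rewrite -uE; have u2 : u ^+ 2 * (1 + 4 * x) = t ^+ 2.
  have -> : 1 + 4 * x = t ^+ 2 * s ^+ 2 by rewrite s2 xE; field.
  rewrite uE; field; exact: lt0r_neq0.
have -> : t - 2 * q * t ^+ 3 + 6 * q ^+ 2 * t ^+ 5 = t * (1 - 2 * x + 6 * x ^+ 2).
  by rewrite xE; ring.
have -> : 6 / 5 * q ^+ 3 * (40 + 60 * q + 144 * q ^+ 2) * t ^+ 6 =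
    6 / 5 * (x ^+ 3 * (40 + 60 * q + 144 * q ^+ 2)) by rewrite xE; ring.
(* The minimum 5/6 is attained at 1/6; its inverse is the factor 6/5 of the constant. *)
pose P := 1 - 2 * x + 6 * x ^+ 2; have P0 : 5 / 6 <= P.
  by have := sqr_ge0 (x - 1 / 6); rewrite /P; lra.
rewrite -/P; have e1 : (u - t * P) * (u + t * P) * (1 + 4 * x) =
    - (t ^+ 2 * (x ^+ 3 * (40 - 60 * x + 144 * x ^+ 2))).
  have -> : (u - t * P) * (u + t * P) * (1 + 4 * x) =
     u ^+ 2 * (1 + 4 * x) - t ^+ 2 * P ^+ 2 * (1 + 4 * x) by ring.
  by rewrite u2 /P; ring.
clearbody P.
have e2 : `|u - t * P| * ((u + t * P) * (1 + 4 * x)) <=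
    t * (x ^+ 3 * (40 + 60 * q + 144 * q ^+ 2)).
  have tP : 0 < t * P by rewrite mulr_gt0//; lra.
  have v0 : 0 <= (u + t * P) * (1 + 4 * x) by rewrite mulr_ge0//; lra.
  rewrite -(ger0_norm v0) -normrM (mulrA (u - t * P)) e1 normrN normrM ger0_norm ?sqr_ge0//.
  rewrite expr2 -mulrA; apply: ler_wpM2l; first exact: ltW.
  apply: le_trans (_ : 1 * `|x ^+ 3 * (40 - 60 * x + 144 * x ^+ 2)| <= _).
    by rewrite ler_wpM2r.
  rewrite mul1r normrM (ger0_norm (exprn_ge0 3 x0)); apply: ler_wpM2l; first exact: exprn_ge0.
  rewrite ler_norml; have : x ^+ 2 <= q ^+ 2 by rewrite lerXn2r ?nnegrE.
  have := sqr_ge0 x; move: (x ^+ 2) (q ^+ 2) => a b; lra.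
have W0 : 0 <= x ^+ 3 * (40 + 60 * q + 144 * q ^+ 2).
  exact: mulr_ge0 (exprn_ge0 3 x0) w0.
move: (x ^+ 3 * _) W0 e2 => W W0 e2.
have n0 := normr_ge0 (u - t * P).
have e3 : `|u - t * P| * (5 / 6 * t) <= `|u - t * P| * ((u + t * P) * (1 + 4 * x)).
  apply: ler_wpM2l => //; apply: le_trans (_ : u + t * P <= _).
    have := ler_wpM2l (ltW t0) P0; lra.
  by rewrite ler_peMr; [|have := ler_wpM2l (ltW t0) P0; lra|lra].
have := le_trans e3 e2; move: (`|_|) n0 => d d0.
have -> : d * (5 / 6 * t) = t * (5 / 6 * d) by ring.
rewrite ler_pM2l//; lra.
Qed.

Lemma mx_ext M N : (forall v, M *m v = N *m v) -> M = N.
Proof.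
move=> h; apply/eqP; rewrite -subr_eq0; apply/eqP/dotc_polar => v.
by rewrite mulmxBl h subrr dotc0r.
Qed.

Lemma selfadj_nilpotent M : selfadjmx M -> M *m M = 0 -> M = 0.
Proof.
move=> sM M2; apply: mx_ext => v; rewrite mul0mx; apply/eqP.
rewrite -vnorm_eq0 -sqrf_eq0; have := dotcc (M *m v).
rewrite -(dotc_selfadj v _ sM) mulmxA M2 mul0mx dotc0r.
by move=> /(congr1 (@complex.Re R)) /= <-.
Qed.

(** The factor [M + c] annihilates [w = (M - c) v], so a nonzero [w] would be an eigenvector for the
    negative number [- c]. *)
Lemma posdef_sqrt M (c : R) : 0 < c -> posdefmx M -> M *m M = (c ^+ 2)%:C%:M -> M = c%:C%:M.
Proof.
move=> c0 [sM pM] M2; apply: mx_ext => v; apply/eqP; rewrite -subr_eq0 -mulmxBl.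
set w := _ *m v; apply: contraT => wn0.
have e : M *m w = - (c%:C *: w).
  apply/eqP; rewrite -subr_eq0 opprK -mul_scalar_mx -mulmxDl /w mulmxA.
  rewrite mulmxDl !mulmxBr M2 -scalar_mxC subrKA -scalar_mxM -rmorphM -expr2 subrr.
  by rewrite mul0mx.
have := pM w wn0; rewrite -mulmxA -/(dotc w _) e dotcNr dotcZr dotcc.
rewrite -rmorphM -rmorphN/= ltcR oppr_gt0.
by rewrite pmulr_rlt0// ltNge sqr_ge0.
Qed.

End Moments.

(** * Coefficients from the first, second and fourth moments *)

Section MomentRigidity.
Variables (R : realType) (m : nat).
Implicit Types (v w : 'cV[R[i]]_m.+1) (M N : 'M[R[i]]_m.+1).
Lemma conj_sub_sqr M (a : R[i]) :
  M *m (a%:M - M *m M) *m M = (a%:M - M *m M) *m (M *m M).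
Proof. by rewrite mulmxBr mulmxBl scalar_mxC mulmxBl !mulmxA. Qed.

Lemma ring_cross (S : pzRingType) (X D s : S) :
  (X - D) * (s + D) + (X + D) * (s - D) = (X * s) *+ 2 - (D * D) *+ 2.
Proof.
rewrite mulrBl mulrDl !mulrDr !mulrN opprD addrACA; congr (_ + _).
  by rewrite addrACA subrr addr0 mulr2n.
by rewrite addrACA addNr add0r mulr2n opprD.
Qed.

Variables (A B : int -> 'M[R[i]]_m.+1) (c c0 : R).
Hypothesis pA : forall k, posdefmx (A k).
Local Notation T0 := (jacobi_sub A B c0%:C).
Let c2 : R[i] := (c ^+ 2)%:C.
Hypothesis mom1 : forall k v, iter 1 T0 (spike k v) k = 0.
Hypothesis mom2 : forall k v, iter 2 T0 (spike k v) k = (2 * c2) *: v.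
Hypothesis mom4 : forall k v, iter 4 T0 (spike k v) k = (6 * c2 ^+ 2) *: v.

Lemma moment_B k : B k = c0%:C%:M.
Proof.
apply: mx_ext => v; have := mom1 k v.
rewrite /= /jacobi_sub /jacobi /shiftp /shiftm /spike eqxx.
have -> : k + 1 == k = false by rewrite -{2}[k]addr0 (inj_eq (addrI k)).
have -> : k - 1 == k = false by rewrite -{2}[k]addr0 (inj_eq (addrI k)).
by rewrite !mulmx0 !add0r => /eqP; rewrite subr_eq0 => /eqP ->; rewrite mul_scalar_mx.
Qed.

Let q k v n (d : int) := iter n T0 (spike k v) (k + d).

(** Since [B] equals the constant [c0], only the hopping terms are left, and a moment at [k] is a
    sum over closed paths starting from [k]. *)
Lemma q_rec k v n d : q k v n.+1 d = A (k + d) *m q k v n (d + 1) + A (k + d - 1) *m q k v n (d - 1).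
Proof.
rewrite /q /= /jacobi_sub /jacobi /shiftp /shiftm moment_B mul_scalar_mx addrK.
by rewrite !addrA.
Qed.

Lemma q_zero k v d : q k v 0 d = if d == 0 then v else 0.
Proof. by rewrite /q /= /spike -{2}[k]addr0 (inj_eq (addrI k)). Qed.

Lemma q_up k v : q k v 1 1 = A k *m v.
Proof. by rewrite q_rec !q_zero /= mulmx0 add0r addrK. Qed.

Lemma q_down k v : q k v 1 (-1) = A (k - 1) *m v.
Proof. by rewrite q_rec !q_zero /= mulmx0 addr0. Qed.

Lemma moment_sum k : A k *m A k + A (k - 1) *m A (k - 1) = (2 * c2)%:M.
Proof.
apply: mx_ext => v; rewrite mul_scalar_mx -(mom2 k).
have -> : iter 2 T0 (spike k v) k = q k v 2 0 by rewrite /q addr0.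
by rewrite q_rec add0r sub0r q_up q_down addr0 mulmxDl !mulmxA.
Qed.

(* With [D = A k ^ 2 - c ^ 2], the second moments turn the fourth one into
   [6 c ^ 4 - 2 D ^ 2]. *)
Lemma moment_sqr k : A k *m A k = c2%:M.
Proof.
set P := A k *m A k; set Q := A (k - 1) *m A (k - 1).
have S0 : P + Q = (2 * c2)%:M := moment_sum k.
(* The second moments at the neighbouring sites express the outer coefficients through [P] and
   [Q]. *)
have S1 : A (k + 1) *m A (k + 1) = (2 * c2)%:M - P.
  by have := moment_sum (k + 1); rewrite addrK => <-; rewrite addrK.
have S2 : A (k - 1 - 1) *m A (k - 1 - 1) = (2 * c2)%:M - Q.
  by rewrite -(moment_sum (k - 1)) [RHS]addrC addKr.
(* Closed paths of length 4, grouped by the direction of their first and last steps; paths that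
   return to [k] halfway contribute through the second moment [2 * c2]. *)
have E : A k *m (A (k + 1) *m A (k + 1) + (2 * c2)%:M) *m A k +
    A (k - 1) *m ((2 * c2)%:M + A (k - 1 - 1) *m A (k - 1 - 1)) *m A (k - 1) = (6 * c2 ^+ 2)%:M.
  apply: mx_ext => v; rewrite mul_scalar_mx -(mom4 k).
  have -> : iter 4 T0 (spike k v) k = q k v 4 0 by rewrite /q addr0.
  have q20 : q k v 2 0 = (2 * c2) *: v by rewrite /q addr0 mom2.
  have q13 : q k v 1 3 = 0 by rewrite q_rec !q_zero /= !mulmx0 addr0.
  have q1m3 : q k v 1 (-3) = 0 by rewrite q_rec !q_zero /= !mulmx0 addr0.
  have q22 : q k v 2 2 = A (k + 1) *m (A k *m v).
    rewrite q_rec (_ : 2 + 1 = 3)// (_ : 2 - 1 = 1)// q13 q_up mulmx0 add0r.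
    by congr (A _ *m _); rewrite -addrA.
  have q2m2 : q k v 2 (-2) = A (k - 1 - 1) *m (A (k - 1) *m v).
    rewrite q_rec (_ : -2 + 1 = -1)// (_ : -2 - 1 = -3)// q1m3 q_down mulmx0 addr0.
    by congr (A _ *m _); rewrite -addrA.
  have q31 : q k v 3 1 = A (k + 1) *m (A (k + 1) *m (A k *m v)) + A k *m ((2 * c2) *: v).
    by rewrite q_rec (_ : 1 + 1 = 2)// subrr q22 q20 addrK.
  have q3m1 : q k v 3 (-1) = A (k - 1) *m ((2 * c2) *: v) +
      A (k - 1 - 1) *m (A (k - 1 - 1) *m (A (k - 1) *m v)).
    have e0 : -1 + 1 = 0 :> int by [].
    have e2 : -1 - 1 = -2 :> int by [].
    by rewrite q_rec e0 e2 q20 q2m2.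
  rewrite q_rec add0r sub0r q31 q3m1 addr0 !mulmxDl !mulmxDr -!mulmxA.
  by rewrite !mulmxDl -!mulmxA !mul_scalar_mx -!scalemxAr.
have sA j : selfadjmx (A j) by case: (pA j).
pose D := P - c2%:M.
have PE : P = c2%:M + D by rewrite /D addrC subrK.
have QE : Q = c2%:M - D.
  have -> : Q = (2 * c2)%:M - P by rewrite -S0 addrC addKr.
  by rewrite PE opprD addrA -raddfB/= mulrDl mul1r addrK.
have E2 : ((4 * c2)%:M - P) *m P + ((4 * c2)%:M - Q) *m Q = (6 * c2 ^+ 2)%:M.
  have c4 : (4 * c2)%:M = (2 * c2)%:M + (2 * c2)%:M :> 'M[R[i]]_m.+1.
    by rewrite -raddfD/= -mulrDl -natrD.
  rewrite -E S1 S2 addrAC -c4 addrA -c4; congr (_ + _); symmetry; exact: conj_sub_sqr.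
have D2 : D *m D = 0.
  have h : ((3 * c2)%:M - D) *m (c2%:M + D) + ((3 * c2)%:M + D) *m (c2%:M - D) = (6 * c2 ^+ 2)%:M.
    have e1 : (4 * c2)%:M - P = (3 * c2)%:M - D.
      by rewrite {1}PE opprD addrA -raddfB/=; congr (_%:M - _); ring.
    have e2 : (4 * c2)%:M - Q = (3 * c2)%:M + D.
      by rewrite {1}QE opprB addrA addrAC -raddfB/=; congr (_%:M + _); ring.
    by rewrite -e1 -e2 -PE -QE.
  move: h; rewrite mulmxE ring_cross -!mulmxE -scalar_mxM => h.
  have e : (3 * c2 * c2)%:M *+ 2 = (6 * c2 ^+ 2)%:M :> 'M[R[i]]_m.+1.
    by rewrite -raddfMn/=; congr _%:M; rewrite -mulr_natl; ring.
  rewrite e in h; have : D *m D *+ 2 = 0 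
    by apply/eqP; rewrite -oppr_eq0 -(inj_eq (addrI (6 * c2 ^+ 2)%:M)) addr0 h.
  by rewrite -scaler_nat => /eqP; rewrite scaler_eq0 pnatr_eq0/= => /eqP.
have sD : selfadjmx D.
  rewrite /selfadjmx /D /adjmx linearB/= raddfB/= -/(adjmx P) -/(adjmx c2%:M).
  rewrite /P adjmxM sA /adjmx tr_scalar_mx map_scalar_mx/=; congr (_ - _%:M).
  by rewrite /c2; apply: complexP; rewrite /= ?oppr0.
by rewrite PE (selfadj_nilpotent sD D2) addr0.
Qed.

End MomentRigidity.

(** * Moments read off the Green's matrix *)

Section GreenMoments.
Variables (R : realType) (m : nat).
Implicit Types (v w : 'cV[R[i]]_m.+1) (M N : 'M[R[i]]_m.+1).
Variables (A B : int -> 'M[R[i]]_m.+1) (C c c0 : R).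
Hypothesis (C0 : 0 <= C).
Hypothesis (sA : forall k, selfadjmx (A k)) (sB : forall k, selfadjmx (B k)).
Hypothesis (bA : forall k, mbound (A k) C) (bB : forall k, mbound (B k) C).
Hypothesis hres : forall z, complex.Im z != 0 -> resolvent_set A B z.
Local Notation T0 := (jacobi_sub A B c0%:C).
Variable k : int.
Hypothesis hG : forall y : R, 0 < y ->
  green A B (c0 +i* y) k = ('i * (Num.sqrt (y ^+ 2 + 4 * c ^+ 2))^-1%:C)%:M.

(** The difference between the expansion of the root and the Neumann sum, sorted by powers of [T],
    the inverse height: the orders 0 and 1 cancel, and the moment [p j] appears at order [j + 1]. *)
Lemma neumann_coefs (T : R[i]) (p : nat -> R[i]) (d : R[i]) :
  'i * (T - 2 * d * T ^+ 3 + 6 * d ^+ 2 * T ^+ 5) * p 0%N -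
    \sum_(j < 5) ('i * T * (- ('i * T)) ^+ j) * p j =
  \sum_(j < 6) T ^+ j * nth 0 [:: 0; 0; - p 1%N; 'i * (p 2%N - 2 * d * p 0%N); p 3%N;
    'i * (6 * d ^+ 2 * p 0%N - p 4%N)] j.
Proof.
have i2 : 'i * 'i = -1 :> R[i] by rewrite -expr2 sqr_i.
rewrite !big_ord_recr !big_ord0 /=.
have e1 : 'i * T * (- ('i * T)) ^+ 1 = T ^+ 2.
  have -> : 'i * T * (- ('i * T)) ^+ 1 = - ('i * 'i) * T ^+ 2 by ring.
  by rewrite i2 opprK mul1r.
have e2 : 'i * T * (- ('i * T)) ^+ 2 = - 'i * T ^+ 3.
  have -> : 'i * T * (- ('i * T)) ^+ 2 = 'i * ('i * 'i) * T ^+ 3 by ring.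
  by rewrite i2 mulrN1.
have e3 : 'i * T * (- ('i * T)) ^+ 3 = - T ^+ 4.
  have -> : 'i * T * (- ('i * T)) ^+ 3 = - (('i * 'i) * ('i * 'i)) * T ^+ 4 by ring.
  by rewrite i2 mulrNN mul1r mulN1r.
have e4 : 'i * T * (- ('i * T)) ^+ 4 = 'i * T ^+ 5.
  have -> : 'i * T * (- ('i * T)) ^+ 4 = 'i * (('i * 'i) * ('i * 'i)) * T ^+ 5 by ring.
  by rewrite i2 mulrNN mul1r mulr1.
rewrite e1 e2 e3 e4; ring.
Qed.

Lemma neumann_vec (T : R[i]) (p : nat -> 'cV[R[i]]_m.+1) (d : R[i]) :
  ('i * (T - 2 * d * T ^+ 3 + 6 * d ^+ 2 * T ^+ 5)) *: p 0%N -
    \sum_(j < 5) ('i * T * (- ('i * T)) ^+ j) *: p j =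
  \sum_(j < 6) T ^+ j *: nth 0 [:: 0; 0; - p 1%N; 'i *: (p 2%N - (2 * d) *: p 0%N); p 3%N;
    'i *: ((6 * d ^+ 2) *: p 0%N - p 4%N)] j.
Proof.
apply/colP => l; rewrite mxE [X in _ + X]mxE !summxE mxE.
under [X in _ - X]eq_bigr do rewrite mxE.
rewrite (neumann_coefs T (fun j => p j l 0)); apply: eq_bigr => j _.
rewrite [RHS]mxE; congr (_ * _).
by case: j => [[|[|[|[|[|[|?]]]]]] ?] //=; rewrite !mxE.
Qed.

Let P v j := iter j T0 (spike k v) k.
Let c2 : R[i] := (c ^+ 2)%:C.

Lemma green_moments v :
  [/\ P v 1 = 0, P v 2 = (2 * c2) *: v & P v 4 = (6 * c2 ^+ 2) *: v].
Proof.
have [K K0 hK] := inv_sqrt_series c.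
(* The coefficients of [neumann_vec]; entries 2, 3 and 5 vanish exactly when the moments 1, 2 and 4
   have the stated values. *)
pose x j : 'cV[R[i]]_m.+1 := nth 0 [:: 0; 0; - P v 1; 'i *: (P v 2 - (2 * c2) *: v); P v 3;
    'i *: ((6 * c2 ^+ 2) *: v - P v 4)] j.
have P0 : P v 0 = v by rewrite /P /= /spike eqxx.
have hx t : 0 < t <= 1 -> vnorm (\sum_(j < 6) (t ^+ j)%:C *: x j) <=
    ((3 * C + `|c0|) ^+ 5 * vnorm v + K * vnorm v) * t ^+ 6.
  move=> /andP[t0 t1]; have ti : 0 < t^-1 by rewrite invr_gt0.
  have hz : resolvent_set A B (c0 +i* t^-1) by apply: hres; rewrite /= lt0r_neq0.
  have hn := neumann_green C0 sA sB bA bB k v ti hz 5.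
  rewrite hG// invrK (exprVn t 6) (invrK (t ^+ 6)) mul_scalar_mx in hn.
  set nu : R := (Num.sqrt _)^-1 in hn.
  pose q := t - 2 * c ^+ 2 * t ^+ 3 + 6 * c ^+ 4 * t ^+ 5.
  have hnu : `|nu - q| <= K * t ^+ 6 by have := hK t; rewrite t0 t1 => /(_ isT).
  have -> : \sum_(j < 6) (t ^+ j)%:C *: x j =
      (('i * nu%:C) *: v - \sum_(j < 5) ('i * t%:C * (- ('i * t%:C)) ^+ j) *: P v j)
      - ('i * (nu - q)%:C) *: v.
    have -> : ('i * nu%:C) *: v - \sum_(j < 5) ('i * t%:C * (- ('i * t%:C)) ^+ j) *: P v j
      - ('i * (nu - q)%:C) *: v = ('i * q%:C) *: v - \sum_(j < 5) ('i * t%:C * (- ('i * t%:C)) ^+ j) *: P v j.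
      by rewrite addrAC -scalerBl -mulrBr rmorphB/= subKr.
    have -> : q%:C = t%:C - 2 * c2 * t%:C ^+ 3 + 6 * c2 ^+ 2 * t%:C ^+ 5.
      rewrite /q /c2 (_ : c ^+ 4 = c ^+ 2 ^+ 2); last by rewrite -exprM.
      by move: (c ^+ 2) => d; rewrite !(rmorphD, rmorphN, rmorphM, rmorphXn, rmorph_nat).
    have := neumann_vec t%:C (P v) c2; rewrite P0 => ->.
    by apply: eq_bigr => j _; rewrite rmorphXn.
  apply: le_trans (vnormB _ _) _; rewrite mulrDl; apply: lerD.
    by apply: le_trans hn _; rewrite mulrAC.
  rewrite vnormZ cnormM cnorm_i mul1r cnorm_real [K * _ * _]mulrAC.
  by rewrite ler_wpM2r ?vnorm_ge0.
have h := vec_poly_zero hx.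
have i0 : ('i : R[i]) != 0 by rewrite -cnorm_eq0 cnorm_i oner_eq0.
split.
- by apply/eqP; rewrite -oppr_eq0; apply/eqP; exact: (h 2%N).
- have /eqP := h 3%N isT; rewrite /x /= scaler_eq0 (negbTE i0)/= subr_eq0 => /eqP ->.
  by [].
- have /eqP := h 5%N isT; rewrite /x /= scaler_eq0 (negbTE i0)/= subr_eq0 => /eqP ->.
  by [].
Qed.

End GreenMoments.

Theorem theorem4p7 (R : realType) (m : nat) (hm : (0 < m)%N)
    (A B : int -> 'M[R[i]]_m)
    (hA : forall k, posdefmx (A k)) (hB : forall k, selfadjmx (B k))
    (C : R) (hC : 0 < C) (hAB : forall k, opnorm (A k) + opnorm (B k) <= C)
    (hrefl : reflectionless A B)
    (Em Ep : R) (hE : Em < Ep)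
    (hspec : spectrum A B = [set x%:C | x in `[Em, Ep]]) :
  forall k : int,
    A k = ((Ep - Em) / 4)%:C%:M /\ B k = ((Em + Ep) / 2)%:C%:M.
Proof.
case: m hm A B hA hB hAB hrefl hspec => // m _ A B hA hB hAB hrefl hspec.
have C0 := ltW hC.
have sA k : selfadjmx (A k) by case: (hA k).
have bA k : mbound (A k) C.
  have [a0 ha] := opnorm_bound (A k); have [b0 hb] := opnorm_bound (B k).
  apply: (mbound_le _ ha); apply: le_trans (hAB k); rewrite lerDl; exact: b0.
have bB k : mbound (B k) C.
  have [a0 ha] := opnorm_bound (A k); have [b0 hb] := opnorm_bound (B k).
  apply: (mbound_le _ hb); apply: le_trans (hAB k); rewrite lerDr; exact: a0.
have hr := resolvent_nonreal hspec.
pose c0 := (Em + Ep) / 2; pose c := (Ep - Em) / 4.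
have c_gt0 : 0 < c by rewrite /c divr_gt0// subr_gt0.
have rlo x : x < Em -> resolvent_set A B x%:C.
  by move=> xE; apply: (resolvent_real hspec); rewrite negb_and -ltNge xE.
have rhi x : Ep < x -> resolvent_set A B x%:C.
  by move=> xE; apply: (resolvent_real hspec); rewrite negb_and -!ltNge xE orbT.
have nlo u : l2 u -> Em * nsq u <= 1 * pair (jacobi A B u) u.
  apply: (numeric_range C0 sA hB bA bB); first exact: expr1n.
  by move=> x xE; rewrite mul1r; exact: rlo.
have s1 : (-1 : R) ^+ 2 = 1 by rewrite sqrrN expr1n.
(* The upper end of the band is the lower end of the spectrum of [- H]. *)
have nhi u : l2 u -> - Ep * nsq u <= -1 * pair (jacobi A B u) u.
  apply: (numeric_range C0 sA hB bA bB s1) => x xE.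
  by apply: rhi; rewrite mulN1r ltrNr.
have hG k y : 0 < y ->
    green A B (c0 +i* y) k = ('i * (Num.sqrt (y ^+ 2 + 4 * c ^+ 2))^-1%:C)%:M.
  apply: (@nev_reflectionless R m (fun z => green A B z k) Em Ep (3 * C + `|c0|) 1 hE).
  - exact: (nev_green C0 sA hB bA bB k hr).
  - move=> x xE; exists (green A B x%:C k); last exact: (mcvg_green C0 bA bB k hr (rlo _ xE)).
    rewrite -[green _ _ _ _]scale1r -[1]/(1%:C).
    apply: (posreal_green C0 sA hB bA bB _ (expr1n _ 2) (rlo _ xE) _ nlo); by rewrite mul1r.
  - move=> x xE; exists ((-1)%:C *: green A B x%:C k).
      apply: (posreal_green C0 sA hB bA bB _ s1 (rhi _ xE) _ nhi); by rewrite mulN1r ltrN2.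
    move=> e e0; apply: filterS (mcvg_green C0 bA bB k hr (rhi _ xE) e0) => n.
    by move=> /mboundN; rewrite rmorphN1 scaleN1r opprB opprK addrC.
  - move=> v; apply: ae_mono (hrefl k) => x hx xE.
    by apply: Xi_form; apply: hx; exact: (ess_spectrum_interval hspec).
  - by rewrite addr_ge0// mulr_ge0.
  (* The Neumann expansion with one term: its remainder is of order [t ^- 2] with constant
     [3 * C + |c0|], for heights from 1 on. *)
  - move=> t t1 v; have t0 : 0 < t := lt_le_trans ltr01 t1.
    have hz : resolvent_set A B (c0 +i* t) by apply: hr; rewrite /= lt0r_neq0.
    have := neumann_green C0 sA hB bA bB k v t0 hz 1.
    by rewrite big_ord1 expr0 mulr1 expr1 /= /spike eqxx mulmxBl mul_scalar_mx.
have mom k v := green_moments C0 sA hB bA bB hr (hG k) v.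
have m1 k v : iter 1 (jacobi_sub A B c0%:C) (spike k v) k = 0 by case: (mom k v).
have m2 k v := let: And3 _ h _ := mom k v in h.
have m4 k v := let: And3 _ _ h := mom k v in h.
move=> k; split; last exact: moment_B m1 k.
by apply: (posdef_sqrt c_gt0 (hA k)); exact: (moment_sqr hA m1 m2 m4).
Qed.
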